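(* Let $0<\alpha<d$, $1<p\le q<\infty$, and $\beta,\gamma\in\mathbb R$ satisfy $$\beta<\frac dq,\qquad\gamma<\frac d{p'},\qquad\beta+\gamma\ge0,\qquad\frac1q=\frac1p-\frac{\alpha-\beta-\gamma}d,\qquad \alpha-\beta-\gamma>0,$$ and let $1\le\rho\le\infty$. There exists $\lambda_0>0$ such that, for every $|\lambda|<\lambda_0$ and every $f$ satisfying $|x|^\gamma f\in L^{p,\rho}(\mathbb R^d)$, the critical fractional Hardy--Schrödinger equation $$(-\Delta)^{\alpha/2}u-\lambda|x|^{-\alpha}u=f\qquad\text{in }\mathbb R^d$$ has a unique mild solution $u\in X_\beta^{q,\rho}$, and $$\big\||x|^{-\beta}u\big\|_{L^{q,\rho}}\lesssim\big\||x|^\gamma f\big\|_{L^{p,\rho}},$$ with implicit constant independent of $f$.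
   Context: For a measurable $g$ on $\mathbb R^d$ with decreasing rearrangement $g^*$, $\|g\|_{L^{a,b}}:=\big(\frac ba\int_0^\infty[\tau^{1/a}g^*(\tau)]^b\frac{d\tau}\tau\big)^{1/b}$ for $0<a,b<\infty$, and $\|g\|_{L^{a,\infty}}:=\sup_{\tau>0}\tau^{1/a}g^*(\tau)$. $p'$ is the conjugate exponent of $p$. $X_\beta^{q,\rho}:=\{u:|x|^{-\beta}u\in L^{q,\rho}(\mathbb R^d)\}$. The operator $(-\Delta)^{-\alpha/2}$ is $\kappa_{d,\alpha}I_\alpha$, where $I_\alpha g(x)=\int_{\mathbb R^d}\frac{g(y)}{|x-y|^{d-\alpha}}dy$ and $\kappa_{d,\alpha}>0$ is the normalization constant for which $u=\kappa_{d,\alpha}I_\alpha((-\Delta)^{\alpha/2}u)$ for Schwartz $u$. A mild solution of $(-\Delta)^{\alpha/2}u-a(x)u=f$ is a function $u$ satisfying $u=(-\Delta)^{-\alpha/2}(au+f)$; here $a(x)=\lambda|x|^{-\alpha}$. *)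

(* Defs.v *)
From HB Require Import structures.
From mathcomp Require Import all_boot all_order all_algebra.
From mathcomp Require Import all_classical all_reals all_analysis.
From mathcomp Require Import complex.

Set Implicit Arguments.
Unset Strict Implicit.
Unset Printing Implicit Defensive.

Import Order.TTheory GRing.Theory Num.Theory.
Import numFieldNormedType.Exports.

Local Open Scope classical_set_scope.
Local Open Scope ring_scope.
Local Open Scope complex_scope.

(* 'rV[R]_n carries the sigma-algebra generated by its coordinates, i.e. the
   Borel sigma-algebra of R^n; this mirrors the library instance on tuples. *)
Section measurable_rV.
Context (R : realType) (n : nat).

Definition rV_coord (i : 'I_n) (x : 'rV[R]_n) : R := x ord0 i.

Let rV_set0 : g_sigma_preimage rV_coord set0.
Proof. exact: sigma_algebra0. Qed.

Let rV_setC A : g_sigma_preimage rV_coord A -> g_sigma_preimage rV_coord (~` A).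
Proof. exact: sigma_algebraC. Qed.

Let rV_bigcup (F : (set 'rV[R]_n)^nat) :
  (forall i, g_sigma_preimage rV_coord (F i)) ->
  g_sigma_preimage rV_coord (\bigcup_i (F i)).
Proof. exact: sigma_algebra_bigcup. Qed.

HB.instance Definition _ := @isMeasurable.Build default_measure_display
  'rV[R]_n (g_sigma_preimage rV_coord) rV_set0 rV_setC rV_bigcup.

End measurable_rV.

Section measurable_rV_lemmas.
Context (R : realType) (n : nat).

Lemma measurable_rV_coord (i : 'I_n) :
  measurable_fun [set: 'rV[R]_n] (@rV_coord R n i).
Proof.
move=> _ Y mY; rewrite setTI; apply: sub_sigma_algebra => /=.
rewrite -bigcup_seq/=; exists i => /=; first by rewrite mem_index_enum.
by exists Y => //; rewrite setTI.
Qed.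

Lemma measurable_fun_rV d (T : measurableType d) (f : T -> 'rV[R]_n) :
  (forall i, measurable_fun [set: T] (fun x => f x ord0 i)) ->
  measurable_fun [set: T] f.
Proof.
move=> mf _ Y mY; rewrite setTI.
have : g_sigma_preimage (fun i => @rV_coord R n i \o f) (f @^-1` Y).
  by rewrite g_sigma_preimage_comp; exists Y => //; rewrite setTI.
apply: smallest_sub; first exact: sigma_algebra_measurable.
rewrite -bigcup_seq; apply: bigcup_sub => i _ _ [B mB <-].
exact: mf.
Qed.

End measurable_rV_lemmas.

(* R * R^n -> R^(n+1) *)
Definition rV_cons (R : realType) (n : nat) (p : R * 'rV[R]_n) : 'rV[R]_n.+1 :=
  \row_i (if unlift ord0 i is Some j then p.2 ord0 j else p.1).

Lemma measurable_rV_cons (R : realType) (n : nat) :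
  measurable_fun [set: R * 'rV[R]_n] (@rV_cons R n).
Proof.
apply: measurable_fun_rV => i.
case: (unliftP ord0 i) => [j|] ->.
- rewrite (_ : (fun _ => _) = @rV_coord R n j \o snd).
    by apply: measurableT_comp => //; exact: measurable_rV_coord.
  by apply/funext => x /=; rewrite mxE liftK.
- rewrite (_ : (fun _ => _) = fst) //.
  by apply/funext => x /=; rewrite mxE unlift_none.
Qed.

Definition rV_uncons (R : realType) (n : nat) (x : 'rV[R]_n.+1) :
  R * 'rV[R]_n := (x ord0 ord0, \row_j x ord0 (lift ord0 j)).

Lemma measurable_rV_uncons (R : realType) (n : nat) :
  measurable_fun [set: 'rV[R]_n.+1] (@rV_uncons R n).
Proof.
apply: measurable_fun_pair; first exact: (measurable_rV_coord ord0).
apply: measurable_fun_rV => i.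
rewrite (_ : (fun _ => _) = @rV_coord R n.+1 (lift ord0 i)).
  exact: measurable_rV_coord.
by apply/funext => x /=; rewrite mxE.
Qed.

Lemma rV_consK (R : realType) (n : nat) :
  cancel (@rV_cons R n) (@rV_uncons R n).
Proof.
move=> [t y]; rewrite /rV_uncons /rV_cons mxE unlift_none /=.
by congr pair; apply/rowP => j; rewrite !mxE liftK.
Qed.

(* The push-forward of lebesgue_measure \x mu along R * R^n -> R^(n+1). *)
Section lebesgue_rV_step.
Local Open Scope ereal_scope.
Context (R : realType) (n : nat).
Variable mu : {sigma_finite_measure set 'rV[R]_n -> \bar R}.

Definition lebesgue_rV_step (A : set 'rV[R]_n.+1) : \bar R :=
  (@lebesgue_measure R \x mu) (@rV_cons R n @^-1` A).

Let step0 : lebesgue_rV_step set0 = 0.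
Proof. by rewrite /lebesgue_rV_step preimage_set0 measure0. Qed.

Let step_ge0 A : 0 <= lebesgue_rV_step A.
Proof. exact: measure_ge0. Qed.

Let step_sigma_additive : semi_sigma_additive lebesgue_rV_step.
Proof.
have mc := @measurable_rV_cons R n.
exact: (@measure_semi_sigma_additive _ _ _
  (pushforward (@lebesgue_measure R \x mu) (@rV_cons R n))).
Qed.

HB.instance Definition _ := isMeasure.Build _ _ _ lebesgue_rV_step
  step0 step_ge0 step_sigma_additive.

Let step_sigma_finite : sigma_finite setT lebesgue_rV_step.
Proof.
have /sigma_finiteP[F [TF ndF Foo]] := sigma_finiteT (@lebesgue_measure R).
have /sigma_finiteP[G [TG ndG Goo]] := sigma_finiteT mu.
exists (fun k => @rV_uncons R n @^-1` (F k `*` G k)).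
  rewrite -preimage_bigcup (_ : \bigcup_k _ = setT) ?preimage_setT//.
  apply/seteqP; split => // -[x y] _.
  have [k _ Fkx] : (\bigcup_k F k) x by rewrite -TF.
  have [l _ Gly] : (\bigcup_k G k) y by rewrite -TG.
  exists (maxn k l) => //; split.
  - by move: (x) Fkx; exact/subsetPset/ndF/leq_maxl.
  - by move: (y) Gly; exact/subsetPset/ndG/leq_maxr.
move=> k; have [mF Fk] := Foo k; have [mG Gk] := Goo k; split.
  rewrite -[X in measurable X]setTI; apply: measurable_rV_uncons => //.
  exact: measurableX.
rewrite /lebesgue_rV_step -comp_preimage.
rewrite (_ : _ \o _ = id) ?preimage_id; last first.
  by apply/funext => x /=; rewrite rV_consK.
by rewrite product_measure1E// lte_mul_pinfty// ge0_fin_numE.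
Qed.

HB.instance Definition _ := Measure_isSigmaFinite.Build _ _ _ lebesgue_rV_step
  step_sigma_finite.

End lebesgue_rV_step.

(* Lebesgue measure on R^n: the n-fold product of lebesgue_measure (the unit
   mass at the only point when n = 0). *)
Fixpoint lebesgue_rV (R : realType) (n : nat) :
    {sigma_finite_measure set 'rV[R]_n -> \bar R} :=
  match n with
  | 0%N => \d_(0 : 'rV[R]_0)
  | k.+1 => lebesgue_rV_step (lebesgue_rV R k)
  end.

Section euclidean.
Context (R : realType) (n : nat).
Implicit Types x y : 'rV[R]_n.

Definition dotp x y : R := \sum_(i < n) x ord0 i * y ord0 i.

(* The library norm `|x| on 'rV[R]_n is the sup norm, hence this one. *)
Definition enorm x : R := Num.sqrt (dotp x x).

End euclidean.

(* Complex-valued functions on R^n, measured and integrated componentwise. *)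
Section complex_functions.
Context (R : realType) (n : nat).
Implicit Types (f g u : 'rV[R]_n -> R[i]).

Definition cabs (z : R[i]) : R := ComplexField.Normc.normc z.

Definition cmeasurable g : Prop :=
  measurable_fun setT (fun x => complex.Re (g x)) /\
  measurable_fun setT (fun x => complex.Im (g x)).

Definition cintegrable g : Prop :=
  (lebesgue_rV R n).-integrable setT (fun x => (complex.Re (g x))%:E) /\
  (lebesgue_rV R n).-integrable setT (fun x => (complex.Im (g x))%:E).

Definition cintegral g : R[i] :=
  Rintegral (lebesgue_rV R n) setT (fun x => complex.Re (g x)) +i*
  Rintegral (lebesgue_rV R n) setT (fun x => complex.Im (g x)).

(* x |-> |x|^s g(x); its value at the origin is irrelevant. *)
Definition weighted (s : R) g : 'rV[R]_n -> R[i] :=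
  fun x => (enorm x `^ s)%:C * g x.

End complex_functions.

Section lorentz.
Context (R : realType) (n : nat).
Implicit Types (g u : 'rV[R]_n -> R[i]).

Definition distribution_function g (s : R) : \bar R :=
  lebesgue_rV R n [set x | s < cabs (g x)].

(* g^*(tau) = inf {s >= 0 | |{|g| > s}| <= tau}, with inf set0 = +oo. *)
Definition rearrangement g (tau : R) : \bar R :=
  ereal_inf [set s%:E | s in
    [set s : R | 0 <= s /\ (distribution_function g s <= tau%:E)%E]].

(* Only used for 0 < a and 0 < b <= +oo; the value at b = -oo is junk. *)
Definition lorentz_norm (a : R) (b : \bar R) g : \bar R :=
  match b with
  | b%:E =>
      ((b / a)%:E * \int[@lebesgue_measure R]_(tau in `]0%R, +oo[)
         (((tau `^ a^-1)%:E * rearrangement g tau) `^ b * (tau^-1)%:E)) `^ b^-1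
  | +oo =>
      ereal_sup [set (tau `^ a^-1)%:E * rearrangement g tau |
                 tau in [set tau : R | (0 < tau)%R]]
  | -oo => 0
  end%E.

Definition in_lorentz (a : R) (b : \bar R) g : Prop :=
  cmeasurable g /\ (lorentz_norm a b g < +oo)%E.

(* The space X_s^{a,b}. *)
Definition in_weighted_lorentz (s a : R) (b : \bar R) u : Prop :=
  in_lorentz a b (weighted (- s) u).

End lorentz.

Section schwartz.
Context (R : realType) (n : nat).

Fixpoint iter_partial (s : seq 'I_n) (v : 'rV[R]_n -> R) : 'rV[R]_n -> R :=
  if s is i :: s' then fun x => 'D_(delta_mx ord0 i) (iter_partial s' v) x
  else v.

(* All iterated partial derivatives exist and decay rapidly. Their continuity
   need not be required: a function with bounded partial derivatives is
   Lipschitz. *)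
Definition schwartz_real (v : 'rV[R]_n -> R) : Prop :=
  forall s : seq 'I_n,
    (forall i x, derivable (iter_partial s v) x (delta_mx ord0 i)) /\
    (forall N : nat, exists C : R, forall x,
       (1 + enorm x) ^+ N * `|iter_partial s v x| <= C).

Definition schwartz (u : 'rV[R]_n -> R[i]) : Prop :=
  schwartz_real (fun x => complex.Re (u x)) /\
  schwartz_real (fun x => complex.Im (u x)).

End schwartz.

Section riesz.
Context (R : realType) (n : nat).
Implicit Types (a f g u : 'rV[R]_n -> R[i]).

Definition expi (t : R) : R[i] := cos t +i* sin t.

Definition fourier u (xi : 'rV[R]_n) : R[i] :=
  cintegral (fun x => expi (- (2 * pi * dotp x xi)) * u x).

Definition inverse_fourier g (x : 'rV[R]_n) : R[i] :=
  cintegral (fun xi => expi (2 * pi * dotp x xi) * g xi).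

(* (-Delta)^(alpha/2), the Fourier multiplier |2 pi xi|^alpha. *)
Definition frac_laplacian (alpha : R) u : 'rV[R]_n -> R[i] :=
  inverse_fourier (fun xi => ((2 * pi * enorm xi) `^ alpha)%:C * fourier u xi).

Definition riesz_integrand (alpha : R) g (x y : 'rV[R]_n) : R[i] :=
  g y / (enorm (x - y) `^ (n%:R - alpha))%:C.

Definition riesz_potential (alpha : R) g (x : 'rV[R]_n) : R[i] :=
  cintegral (riesz_integrand alpha g x).

Definition is_riesz_constant (alpha kappa : R) : Prop :=
  0 < kappa /\
  forall u, schwartz u -> forall x,
    u x = kappa%:C * riesz_potential alpha (frac_laplacian alpha u) x.

(* For 0 < alpha < n exactly one kappa satisfies is_riesz_constant (namely
   Gamma((n - alpha)/2) / (pi^(n/2) 2^alpha Gamma(alpha/2))), so that the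
   default value 1 plays no role. *)
Definition riesz_constant (alpha : R) : R := xget 1 (is_riesz_constant alpha).

(* (-Delta)^(-alpha/2) g *)
Definition inv_frac_laplacian (alpha : R) g : 'rV[R]_n -> R[i] :=
  fun x => (riesz_constant alpha)%:C * riesz_potential alpha g x.

(* u = (-Delta)^(-alpha/2) (a u + f) almost everywhere, the integral being
   absolutely convergent for almost every x. *)
Definition mild_solution (alpha : R) a f u : Prop :=
  {ae lebesgue_rV R n, forall x,
    cintegrable (riesz_integrand alpha (fun y => a y * u y + f y) x) /\
    u x = inv_frac_laplacian alpha (fun y => a y * u y + f y) x}.

Definition hardy_potential (alpha : R) (lambda : R[i]) : 'rV[R]_n -> R[i] :=
  fun x => lambda * (enorm x `^ (- alpha))%:C.

End riesz.

(* Main.v *)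
(* Write K for the kernel |x|^(-beta) |x - y|^(-eta) |y|^(-gamma), eta = d - alpha.
   Splitting R^n according to the relative sizes of |x|, |y| and |x - y| gives
   restricted bounds: the integral of K over E x F is at most
   C |E|^(1 - b) |F|^(b + 1 - (beta + eta + gamma) / d) for b near 1/q.
   Slicing a function g into its superlevel sets and using two such b, one on
   each side of 1/q, bounds the rearrangement of the potential of g at t by the
   values of g^*(tau), up to a gain min(tau / t, t / tau)^e which every Lorentz
   functional absorbs. This is the Stein-Weiss inequality from L^(p,rho) to
   L^(q,rho) with weights, for all 1 <= rho <= oo.
   The same inequality with p = q and gamma = alpha - beta shows that
   G |-> I_alpha(|x|^(-alpha) G) is bounded on X_beta^(q,rho), so for small
   lambda the nonnegative iteration W_(k+1) = c I_alpha |f| + c |lambda|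
   I_alpha(|x|^(-alpha) W_k) stays bounded in X_beta^(q,rho), and by Fatou its
   limit is finite almost everywhere. The increments of the Picard iterates of
   the equation are dominated by those of W_k; hence the iterates converge
   almost everywhere, and the limit is a mild solution by dominated convergence.
   Two mild solutions differ by some w with |w| <= c |lambda|
   I_alpha(|x|^(-alpha) |w|), whose norm vanishes by contraction. *)
From HB Require Import structures.
From mathcomp Require Import all_boot all_order all_algebra.
From mathcomp Require Import all_classical all_reals all_analysis.
From mathcomp Require Import measurable_realfun complex ring lra.
Require Import Defs.

Set Implicit Arguments.
Unset Strict Implicit.
Unset Printing Implicit Defensive.

Import Order.TTheory GRing.Theory Num.Theory.
Import numFieldNormedType.Exports.

Local Open Scope classical_set_scope.
Local Open Scope ring_scope.

(** Lorentz functionals enter only as monotone quasi-norms: order is respected up to a constant, and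
    the functional of a sum is at most a constant times a maximum. Summing a series of norms would
    pay the quasi-triangle constant at every term. The nonnegative recursion avoids this: one bound
    M reproduces itself as soon as A1 max(s, th M) <= M, and monotonicity hands the bound to the
    limit.

    The Hardy operator is the delicate case, since its weighted kernel is homogeneous of degree
    exactly -d. The restricted bounds survive there because the two outer exponents add up to alpha
    > 0, and a small part of this power can be moved between the factors.

    Rearrangement inequalities are stated by testing against real bounds m ([bump_dominated]). In
    this form finite and infinite rho, as well as infinite values, follow one pattern, and
    monotonicity and quasi-additivity of the functional come from the same lemma as the
    interpolation.

    A real power of 0 with nonzero exponent is 0 by convention. Identities between weights therefore
    hold off the origin, a null set because d > 0. *)

Section dyadic.
Context d (T : measurableType d) (R : realType).
Variable m : {measure set T -> \bar R}.

(** [f] is dominated by the sum of the [c k] times the indicators of the [A k], and the integrals of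
    the terms are bounded by a geometric series. Points where [f] vanishes are exempt from the
    covering, which later disposes of the singular point of a kernel. *)
Lemma integral_le_dyadic (D : set T) (f : T -> \bar R) (A : (set T)^nat)
    (c v : R^nat) (M r : R) :
  measurable D -> measurable_fun D f ->
  (forall x, D x -> (0 <= f x)%E) -> (forall k, measurable (A k)) ->
  (forall k, 0 <= c k) -> 0 < r < 1 -> 0 <= M ->
  (forall x, D x -> (f x != 0)%E -> exists2 k, A k x & (f x <= (c k)%:E)%E) ->
  (forall k, (m (A k) <= (v k)%:E)%E) ->
  (forall k, c k * v k <= M * r ^+ k) ->
  (\int[m]_(x in D) f x <= (M / (1 - r))%:E)%E.
Proof.
move=> mD mf f0 mA c0 /andP[r0 r1] M0 fA mv cv.
apply: (@le_trans _ _ (\int[m]_(x in D)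
    (\sum_(0 <= k <oo) (c k * \1_(A k) x)%:E)%E)%E).
  apply: ge0_le_integral => //.
    apply: ge0_emeasurable_sum => [k x _ _|k _].
      by rewrite lee_fin mulr_ge0// indicE ler0n.
    by apply/measurable_EFinP; exact: measurable_funM.
  move=> x Dx; have [->|fx0] := eqVneq (f x) 0%E.
    by apply: nneseries_ge0 => k _ _; rewrite lee_fin mulr_ge0.
  have [k Akx fxc] := fA _ Dx fx0.
  apply: (le_trans fxc).
  apply: (le_trans _ (nneseries_lim_ge k.+1 _)); last first.
    by move=> n _ _; rewrite lee_fin mulr_ge0.
  rewrite big_nat_recr//= -[leLHS]add0e leeD//.
    by apply: sume_ge0 => n _; rewrite lee_fin mulr_ge0.
  by rewrite indicE mem_set// mulr1.
rewrite integral_nneseries//; last 2 first.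
- by move=> k; apply/measurable_EFinP; exact: measurable_funM.
- by move=> k x _; rewrite lee_fin mulr_ge0// indicE ler0n.
apply: (@le_trans _ _ (\sum_(0 <= k <oo) (M * r ^+ k)%:E)%E).
  apply: lee_nneseries => [k _ _|k _].
    by apply: integral_ge0 => x _; rewrite lee_fin mulr_ge0// indicE ler0n.
  under eq_integral do rewrite EFinM.
  rewrite ge0_integralZl ?lee_fin//; last exact/measurable_EFinP.
  rewrite integral_indic//; apply: (@le_trans _ _ ((c k)%:E * (v k)%:E)%E).
    rewrite lee_wpmul2l ?lee_fin//; apply: le_trans (mv k).
    by apply: le_measure; rewrite ?inE//; exact: measurableI.
  by rewrite -EFinM lee_fin.
apply: lime_le.
  by apply: is_cvg_nneseries => k _ _; rewrite lee_fin mulr_ge0 ?exprn_ge0// ltW.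
apply: nearW => k; rewrite sumEFin lee_fin.
apply: geometric_le_lim => //.
by rewrite ger0_norm// ltW.
Qed.

End dyadic.

Lemma dyadic_interval (R : realType) (z : R) : 1 <= z ->
  exists k, 2 ^+ k <= z < 2 ^+ k.+1.
Proof.
move=> z1.
have ex : exists n, z < 2 ^+ n.
  by exists (Num.bound z); exact: upper_nthrootP.
case: (ex_minnP ex) => -[|k] zk mink; first by move: zk; rewrite ltNge z1.
exists k; rewrite zk andbT leNgt; apply/negP => /mink.
by rewrite ltnn.
Qed.

(** * Euclidean geometry and Lebesgue measure *)

Section euclidean_geometry.
Context (R : realType) (n : nat).
Implicit Types x y : 'rV[R]_n.
Local Notation mu := (lebesgue_rV R n).

Lemma dotp_ge0 x : 0 <= dotp x x.
Proof. by apply: sumr_ge0 => i _; rewrite -expr2 sqr_ge0. Qed.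

Lemma enorm_ge0 x : 0 <= enorm x.
Proof. exact: sqrtr_ge0. Qed.

Lemma sqr_enorm x : enorm x ^+ 2 = dotp x x.
Proof. by rewrite sqr_sqrtr// dotp_ge0. Qed.

Lemma enormN x : enorm (- x) = enorm x.
Proof. by congr Num.sqrt; apply: eq_bigr => i _; rewrite !mxE mulrNN. Qed.

Lemma enormC x y : enorm (x - y) = enorm (y - x).
Proof. by rewrite -enormN opprB. Qed.

Lemma coord_le_enorm x i : `|x ord0 i| <= enorm x.
Proof.
rewrite -sqrtr_sqr ler_wsqrtr// /dotp (bigD1 i)//= -expr2 lerDl.
by apply: sumr_ge0 => j _; rewrite -expr2 sqr_ge0.
Qed.

Lemma enorm_eq0 x : enorm x = 0 -> x = 0.
Proof.
move=> x0; apply/rowP => i; rewrite mxE; apply/eqP; rewrite -normr_le0 -x0.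
exact: coord_le_enorm.
Qed.

Lemma enorm_gt0 x : x <> 0 -> 0 < enorm x.
Proof.
move=> x0; rewrite lt_neqAle enorm_ge0 andbT eq_sym.
by apply/eqP => /enorm_eq0.
Qed.

(** The constant 2 allows a proof coordinate by coordinate, from a^2 <= 2 (a - b)^2 + 2 b^2. *)
Lemma enorm_quasitriangle x y : enorm x <= 2 * (enorm (x - y) + enorm y).
Proof.
rewrite -(@ler_pXn2r _ 2)// ?nnegrE ?enorm_ge0//; last first.
  by rewrite mulr_ge0// addr_ge0 ?enorm_ge0.
have : enorm x ^+ 2 <= 2 * (enorm (x - y) ^+ 2 + enorm y ^+ 2).
  rewrite !sqr_enorm /dotp -big_split/= mulr_sumr ler_sum// => i _.
  rewrite !mxE; set a := x _ _; set b := y _ _.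
  by have := sqr_ge0 (a - 2 * b); rewrite expr2; nra.
by have := enorm_ge0 (x - y); have := enorm_ge0 y; nra.
Qed.

Lemma measurable_enorm d (T : measurableType d) (f : T -> 'rV[R]_n) :
  measurable_fun setT f -> measurable_fun setT (fun t => enorm (f t)).
Proof.
move=> mf; have mfi i : measurable_fun setT (fun t => f t ord0 i).
  exact: measurableT_comp (@measurable_rV_coord R n i) mf.
under eq_fun do rewrite /enorm -powR12_sqrt ?dotp_ge0//.
apply: (measurableT_comp (@measurable_powR R _)).
by apply: measurable_sum => i; exact: measurable_funM.
Qed.

Lemma measurable_rVB d (T : measurableType d) (f g : T -> 'rV[R]_n) :
  measurable_fun setT f -> measurable_fun setT g ->
  measurable_fun setT (fun t => f t - g t).
Proof.
move=> mf mg; apply: measurable_fun_rV => i.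
under eq_fun do rewrite !mxE.
apply: measurable_funB.
  exact: measurableT_comp (@measurable_rV_coord R n i) mf.
exact: measurableT_comp (@measurable_rV_coord R n i) mg.
Qed.

End euclidean_geometry.

(** Induction peels off the first coordinate, following the recursion of [lebesgue_rV]; in dimension
    0 the only point has mass 1, the empty product. Radius 0 is included and later shows that points
    are null. *)
Lemma lebesgue_box (R : realType) (n : nat) (c : 'rV[R]_n) (r : R) : 0 <= r ->
  let B := [set x : 'rV[R]_n |
              forall i, x ord0 i \in `[c ord0 i - r, c ord0 i + r]] in
  measurable B /\ (lebesgue_rV R n B <= ((2 * r) ^+ n)%:E)%E.
Proof.
move=> r0 B; split.
  have -> : B = \bigcap_(i in [set: 'I_n])
      (fun x : 'rV[R]_n => x ord0 i) @^-1` `[c ord0 i - r, c ord0 i + r].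
    by apply/seteqP; split => [x Bx i _ /=|x Bx i]; [exact: Bx|exact: (Bx i)].
  apply: fin_bigcap_measurable => // i _.
  by rewrite -[X in measurable X]setTI; exact: measurable_rV_coord.
rewrite {}/B; elim: n c => [|n ih] c.
  by rewrite expr0 /= diracE lee_fin; case: (_ \in _).
rewrite [lebesgue_rV R n.+1]/= /lebesgue_rV_step.
set B := [set x : 'rV[R]_n | forall i, x ord0 i \in
  `[(\row_j c ord0 (lift ord0 j)) ord0 i - r,
    (\row_j c ord0 (lift ord0 j)) ord0 i + r]].
rewrite [X in (X <= _)%E](_ : _ =
  (lebesgue_measure \x lebesgue_rV R n)%E (`[c ord0 ord0 - r, c ord0 ord0 + r]%classic
    `*` B)); last first.
  congr (product_measure1 _ _ _).
  apply/seteqP; split => [[t y] /= Bty|[t y] /= [Bt By] i].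
    split => [|i]; first by have := Bty ord0; rewrite mxE unlift_none.
    by have := Bty (lift ord0 i); rewrite !mxE liftK.
  rewrite mxE; case: (unliftP ord0 i) => [j|] ->; last exact: Bt.
  by have := By j; rewrite mxE.
rewrite /= product_measure1E//; last first.
  have -> : B = \bigcap_(i in [set: 'I_n])
      (fun x : 'rV[R]_n => x ord0 i) @^-1`
        `[(\row_j c ord0 (lift ord0 j)) ord0 i - r,
          (\row_j c ord0 (lift ord0 j)) ord0 i + r].
    by apply/seteqP; split => [x Bx i _ /=|x Bx i]; [exact: Bx|exact: (Bx i)].
  apply: fin_bigcap_measurable => // i _.
  by rewrite -[X in measurable X]setTI; exact: measurable_rV_coord.
rewrite exprS EFinM lee_pmul//; last exact: ih.
have := @lebesgue_measure_itv R `[c ord0 ord0 - r, c ord0 ord0 + r].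
move=> /= ->; case: ifPn => _; last by rewrite lee_fin mulr_ge0.
by rewrite -EFinB lee_fin; lra.
Qed.

Section balls.
Context (R : realType) (n : nat).
Implicit Types x y : 'rV[R]_n.
Local Notation mu := (lebesgue_rV R n).

Definition eball y (r : R) : set 'rV[R]_n := [set x | enorm (y - x) < r].

Lemma measurable_eball y r : measurable (eball y r).
Proof.
rewrite -[X in measurable X]setTI.
have : measurable_fun setT (fun x : 'rV[R]_n => enorm (y - x) < r).
  apply: measurable_fun_ltr => //.
  by apply: measurable_enorm; exact: measurable_rVB.
by move/(_ measurableT [set true]) => /(_ I).
Qed.

Lemma eball_measure y r : 0 <= r -> (mu (eball y r) <= ((2 * r) ^+ n)%:E)%E.
Proof.
move=> r0; have [mB] := lebesgue_box y r0; apply: le_trans.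
apply: le_measure; rewrite ?inE//; first exact: measurable_eball.
move=> x /= xr i; have := coord_le_enorm (y - x) i; rewrite !mxE in_itv/=.
move=> /le_lt_trans/(_ xr); rewrite ltr_norml => /andP[? ?].
by apply/andP; split; lra.
Qed.

Lemma lebesgue_rV_point (x : 'rV[R]_n) : (0 < n)%N -> mu [set x] = 0.
Proof.
move=> n0; apply/eqP; rewrite eq_le measure_ge0 andbT.
have [_] := lebesgue_box x (lexx 0); rewrite mulr0 expr0n gtn_eqF//.
rewrite [X in mu X](_ : _ = [set x])//.
apply/seteqP; split => [y /= xy|y /= -> i]; last first.
  by rewrite in_itv/= subr0 addr0 lexx.
apply/rowP => i; have := xy i; rewrite in_itv/= subr0 addr0 => /andP[? ?].
by apply/eqP; rewrite eq_le; apply/andP.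
Qed.

Lemma measurable_rV_point (x : 'rV[R]_n) : measurable [set x].
Proof.
have [mB _] := lebesgue_box x (lexx 0).
move: mB; rewrite [X in measurable X -> _](_ : _ = [set x])//.
apply/seteqP; split => [y /= xy|y /= -> i]; last first.
  by rewrite in_itv/= subr0 addr0 lexx.
apply/rowP => i; have := xy i; rewrite in_itv/= subr0 addr0 => /andP[? ?].
by apply/eqP; rewrite eq_le; apply/andP.
Qed.

End balls.

Section powR_positive.
Context (R : realType).
Implicit Types x y z a b : R.

Lemma powR_expR x a : 0 < x -> x `^ a = expR (a * ln x).
Proof. by move=> x0; rewrite /powR gt_eqF. Qed.

Lemma powR_gt0D x a b : 0 < x -> x `^ (a + b) = x `^ a * x `^ b.
Proof. by move=> x0; rewrite powRD// (lt0r_neq0 x0) implybT. Qed.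

Lemma powR_antitone a x y : a <= 0 -> 0 < x -> x <= y -> y `^ a <= x `^ a.
Proof.
move=> a0 x0 xy; have y0 := lt_le_trans x0 xy.
rewrite -[a]opprK !(powRN _ (- a)) lef_pV2 ?posrE ?powR_gt0//.
by rewrite ge0_ler_powR ?nnegrE ?oppr_ge0// ltW.
Qed.

Lemma powR_homo a x y : 0 <= a -> 0 <= x -> x <= y -> x `^ a <= y `^ a.
Proof.
by move=> a0 x0 xy; rewrite ge0_ler_powR ?nnegrE// (le_trans x0).
Qed.

End powR_positive.

(** * Tonelli's theorem over measurable domains *)

Section tonelli_domain.
Local Open Scope ereal_scope.
Context d1 d2 (T1 : measurableType d1) (T2 : measurableType d2) (R : realType).
Variable m1 : {sigma_finite_measure set T1 -> \bar R}.
Variable m2 : {sigma_finite_measure set T2 -> \bar R}.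

Lemma integral_indicl d (T : measurableType d) (m : {measure set T -> \bar R})
    (D : set T) (f : T -> \bar R) : measurable D ->
  \int[m]_(x in D) f x = \int[m]_x ((\1_D x)%:E * f x).
Proof.
move=> mD; rewrite integral_mkcond; apply: eq_integral => x _.
by rewrite patchE indicE; case: ifPn => _; rewrite ?mul1e ?mul0e.
Qed.

(** Indicators move both domains into the integrand, where Tonelli on the whole product applies. *)
Lemma tonelli_domain (D1 : set T1) (D2 : set T2) (f : T1 -> T2 -> \bar R) :
  measurable D1 -> measurable D2 ->
  measurable_fun setT (fun z => f z.1 z.2) -> (forall x y, 0 <= f x y) ->
  \int[m1]_(x in D1) \int[m2]_(y in D2) f x y =
  \int[m2]_(y in D2) \int[m1]_(x in D1) f x y.
Proof.
move=> mD1 mD2 mf f0.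
have mi1 : measurable_fun setT (fun z : T1 * T2 => (\1_D1 z.1)%:E : \bar R).
  by apply/measurable_EFinP; apply: measurableT_comp.
have mi2 : measurable_fun setT (fun z : T1 * T2 => (\1_D2 z.2)%:E : \bar R).
  by apply/measurable_EFinP; apply: measurableT_comp.
rewrite integral_indicl// [RHS]integral_indicl//.
under eq_integral => x _.
  rewrite integral_indicl// -ge0_integralZl//; last 2 first.
  - apply: emeasurable_funM; first exact/measurable_EFinP.
    exact: measurableT_comp mf (measurable_pair1 x).
  - by move=> y _; rewrite mule_ge0// lee_fin.
  over.
under [RHS]eq_integral => y _.
  rewrite integral_indicl// -ge0_integralZl//; last 2 first.
  - apply: emeasurable_funM; first exact/measurable_EFinP.
    exact: measurableT_comp mf (measurable_pair2 y).
  - by move=> x _; rewrite mule_ge0// lee_fin.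
  over.
rewrite (fubini_tonelli (fun z => (\1_D1 z.1)%:E * ((\1_D2 z.2)%:E * f z.1 z.2)))/=.
- by do 2 (apply: eq_integral => ? _); rewrite muleCA.
- by apply: emeasurable_funM => //; exact: emeasurable_funM.
- by move=> z; rewrite !mule_ge0// lee_fin.
Qed.

Lemma measurable_integral_domain (D2 : set T2) (f : T1 -> T2 -> \bar R) :
  measurable D2 ->
  measurable_fun setT (fun z => f z.1 z.2) -> (forall x y, 0 <= f x y) ->
  measurable_fun setT (fun x => \int[m2]_(y in D2) f x y).
Proof.
move=> mD2 mf f0; under eq_fun do rewrite integral_indicl//.
apply: (measurable_fun_fubini_tonelli_F (fun z => (\1_D2 z.2)%:E * f z.1 z.2)).
  apply: emeasurable_funM => //; apply/measurable_EFinP.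
  exact: measurableT_comp.
by move=> z; rewrite mule_ge0// lee_fin.
Qed.

End tonelli_domain.

Lemma measurable_slice d1 d2 d (T1 : measurableType d1) (T2 : measurableType d2)
    (U : measurableType d) (f : T1 -> T2 -> U) (x : T1) :
  measurable_fun setT (fun z => f z.1 z.2) -> measurable_fun setT (f x).
Proof. by move=> mf; exact: measurableT_comp mf (measurable_pair1 x). Qed.

(** * Integrals of |x - y|^-s over sets of given measure *)

Section riesz_mass.
Context (R : realType) (n : nat).
Hypothesis n0 : (0 < n)%N.
Implicit Types x y : 'rV[R]_n.
Local Notation mu := (lebesgue_rV R n).

Lemma measurable_riesz x (s : R) :
  measurable_fun setT (fun y => (enorm (x - y) `^ s)%:E).
Proof.
apply/measurable_EFinP; apply: (measurableT_comp (@measurable_powR R s)).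
by apply: measurable_enorm; exact: measurable_rVB.
Qed.

(** On the annulus at distance about r / 2^k the kernel is about (r / 2^k)^-s and the measure about
    (r / 2^k)^n, which gives a geometric series of ratio 2^(s - n) < 1. *)
Lemma riesz_mass_ball (s r : R) x : 0 <= s < n%:R -> 0 < r ->
  (\int[mu]_(y in eball x r) (enorm (x - y) `^ (- s))%:E <=
   (r `^ (n%:R - s) * (4 `^ n%:R * 2 `^ s / (1 - 2 `^ (s - n%:R))))%:E)%E.
Proof.
move=> /andP[s0 sn] r0; rewrite mulrA.
(* The factor 2 in the radius puts the closed bound |x - y| <= r / 2^k inside an open ball. *)
apply: (@integral_le_dyadic _ _ _ _ _ _ (fun k => eball x (2 * r / 2 ^+ k))
  (fun k => (r / 2 ^+ k.+1) `^ (- s)) (fun k => (2 * (2 * r / 2 ^+ k)) ^+ n)).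
- exact: measurable_eball.
- by apply: measurable_funTS; exact: measurable_riesz.
- by move=> y _; rewrite lee_fin powR_ge0.
- by move=> k; exact: measurable_eball.
- by move=> k; rewrite powR_ge0.
- rewrite powR_gt0//= powR_expR// expR_lt1.
  by rewrite pmulr_llt0 ?subr_lt0// ln_gt0// ltr1n.
- by rewrite !mulr_ge0 ?powR_ge0.
(* At y = x the kernel takes the value 0 if s > 0, so no cover is asked for; if s = 0 its value is 1
   and k = 0 serves. *)
- move=> y /= yr; have [xy0|xy0] := eqVneq (enorm (x - y)) 0.
    rewrite xy0; have [-> _|s0'] := eqVneq s 0; last first.
      by rewrite powR0 ?eqxx// oppr_eq0.
    exists 0%N; last by rewrite oppr0 !powRr0.
    by rewrite /eball/= xy0 expr0 divr1 mulr_gt0.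
  have xy : 0 < enorm (x - y) by rewrite lt_neqAle eq_sym xy0 enorm_ge0.
  move=> _; have [|k /andP[k1 k2]] := @dyadic_interval R (r / enorm (x - y)).
    by rewrite ler_pdivlMr// mul1r ltW.
  exists k; rewrite /eball/=.
    rewrite ltr_pdivlMr ?exprn_gt0//; move: k1.
    rewrite ler_pdivlMr// mulrC => /le_lt_trans; apply.
    by rewrite ltr_pMl// ltr1n.
  rewrite lee_fin; apply: powR_antitone; rewrite ?oppr_le0//.
    by rewrite divr_gt0// exprn_gt0.
  rewrite ler_pdivrMr ?exprn_gt0// mulrC -ler_pdivrMr//.
  exact: ltW.
- move=> k; apply: eball_measure.
  by rewrite divr_ge0 ?exprn_ge0// mulr_ge0// ltW.
- move=> k; have l2 : ln (4 : R) = 2 * ln 2.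
    by rewrite (_ : 4 = 2 ^+ 2) ?lnXn ?mulr_natl//; rewrite expr2; lra.
  rewrite -!powR_mulrn ?powR_ge0//; last first.
    by rewrite !(mulr_ge0, divr_ge0)// ?powR_ge0// ltW.
  rewrite !powR_expR ?divr_gt0 ?mulr_gt0 ?divr_gt0 ?mulr_gt0 ?powR_gt0 ?expR_gt0//.
  rewrite !lnM ?lnV ?posrE ?mulr_gt0 ?invr_gt0 ?expR_gt0//.
  rewrite !expRK l2 -!expRD.
    by rewrite ler_expR -natr1; lra.
  by rewrite invr_gt0 expR_gt0.
Qed.

(** Cut at the radius r with r^n = e. Inside, the ball estimate applies; outside, the kernel is at
    most r^-s on a set of measure at most e. Both parts are multiples of r^(n - s). *)
Lemma riesz_mass (s : R) : 0 <= s < n%:R ->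
  exists2 C : R, 0 < C & forall x (E : set 'rV[R]_n) (e : R),
    measurable E -> 0 < e -> (mu E <= e%:E)%E ->
    (\int[mu]_(y in E) (enorm (x - y) `^ (- s))%:E <=
     (C * e `^ (1 - s / n%:R))%:E)%E.
Proof.
move=> /[dup] sn' /andP[s0 sn].
have nn : 0 < n%:R :> R by rewrite ltr0n.
pose K : R := 4 `^ n%:R * 2 `^ s / (1 - 2 `^ (s - n%:R)).
have K0 : 0 < K.
  rewrite divr_gt0 ?mulr_gt0 ?powR_gt0// subr_gt0 powR_expR// expR_lt1.
  by rewrite pmulr_llt0 ?subr_lt0// ln_gt0// ltr1n.
exists (1 + K); first by rewrite addr_gt0.
move=> x E e mE e0 Ee; pose r := e `^ n%:R^-1.
have r0 : 0 < r by rewrite powR_gt0.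
have er : e `^ (1 - s / n%:R) = r `^ (n%:R - s).
  rewrite -powRrM mulrBr mulVf ?gt_eqF//.
  by congr (_ `^ (_ - _)); rewrite mulrC.
have mf D : measurable_fun D (fun y => (enorm (x - y) `^ (- s))%:E : \bar R).
  by apply: measurable_funTS; exact: measurable_riesz.
have f0 y : (0 <= (enorm (x - y) `^ (- s))%:E :> \bar R)%E.
  by rewrite lee_fin powR_ge0.
have mB := measurable_eball x r.
rewrite -(setUIDK E (eball x r)) ge0_integral_setU//; last 3 first.
- exact: measurableI.
- exact: measurableD.
- by apply/disj_setPS => y [[_ ?] [_]].
rewrite mulrDl mul1r EFinD addeC leeD//.
  apply: (@le_trans _ _ (\int[mu]_(y in E `\` eball x r) (r `^ (- s))%:E)%E).
    apply: ge0_le_integral => //; first exact: measurableD.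
    move=> y [_] /negP; rewrite -leNgt => rxy.
    by rewrite lee_fin; apply: powR_antitone => //; rewrite oppr_le0.
  rewrite integral_cst; last exact: measurableD.
  apply: (@le_trans _ _ ((r `^ (- s))%:E * e%:E)%E).
    rewrite lee_wpmul2l ?lee_fin ?powR_ge0//; apply: le_trans Ee.
    by apply: le_measure; rewrite ?inE//; exact: measurableD.
  have rn : r `^ n%:R = e.
    by rewrite -powRrM mulVf ?gt_eqF// powRr1// ltW.
  by rewrite -EFinM lee_fin er (addrC n%:R) powR_gt0D// rn.
apply: (@le_trans _ _ (\int[mu]_(y in eball x r) (enorm (x - y) `^ (- s))%:E)%E).
  by apply: ge0_subset_integral => //; exact: measurableI.
by rewrite er mulrC; exact: riesz_mass_ball.
Qed.

End riesz_mass.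

(* Locked, so that failing unification problems do not unfold them. *)
HB.lock Definition npow (R : realType) (n : nat) (s : R) (x : 'rV[R]_n) : R :=
  enorm x `^ s.
HB.lock Definition dpow (R : realType) (n : nat) (s : R) (x y : 'rV[R]_n) : R :=
  enorm (x - y) `^ s.

Section npow_theory.
Context (R : realType) (n : nat).
Implicit Types (x y : 'rV[R]_n) (s : R).

Lemma npowE s x : npow s x = enorm x `^ s.
Proof. by rewrite npow.unlock. Qed.

Lemma dpowE s x y : dpow s x y = npow s (x - y).
Proof. by rewrite npow.unlock dpow.unlock. Qed.

Lemma dpowC s x y : dpow s x y = dpow s y x.
Proof. by rewrite !dpowE !npowE enormC. Qed.

Lemma dpow0l s x : dpow s 0 x = npow s x.
Proof. by rewrite dpowE !npowE sub0r enormN. Qed.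

Lemma npow_ge0 s x : 0 <= npow s x.
Proof. by rewrite npowE powR_ge0. Qed.

Lemma dpow_ge0 s x y : 0 <= dpow s x y.
Proof. by rewrite dpowE npow_ge0. Qed.

Lemma measurable_npow d (T : measurableType d) (f : T -> 'rV[R]_n) s :
  measurable_fun setT f -> measurable_fun setT (fun t => npow s (f t)).
Proof.
move=> mf; under eq_fun do rewrite npowE.
apply: (measurableT_comp (@measurable_powR R s)).
exact: measurable_enorm.
Qed.

Lemma measurable_dpow s : measurable_fun setT
  (fun z : 'rV[R]_n * 'rV[R]_n => dpow s z.1 z.2).
Proof.
under eq_fun do rewrite dpowE.
by apply: measurable_npow; exact: measurable_rVB.
Qed.

Lemma measurable_dpowr s x D : measurable_fun D (dpow s x).
Proof.
apply: measurable_funTS.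
exact: (measurable_slice (f := fun x y => dpow s x y)) (measurable_dpow s).
Qed.

Lemma measurable_npowT s D : measurable_fun D (@npow R n s).
Proof. by apply: measurable_funTS; exact: measurable_npow. Qed.

End npow_theory.

(** * Restricted bounds for the Stein-Weiss kernel *)

Section stein_weiss_form.
Context (R : realType) (n : nat).
Hypothesis n0 : (0 < n)%N.
Implicit Types (x y : 'rV[R]_n) (E F : set 'rV[R]_n).
Local Notation mu := (lebesgue_rV R n).
Local Notation N := (n%:R : R).

Definition sw_kernel (be eta ga : R) x y : R :=
  npow (- be) x * dpow (- eta) x y * npow (- ga) y.

Definition sw_form (be eta ga : R) E F : \bar R :=
  \int[mu]_(x in E) \int[mu]_(y in F) (sw_kernel be eta ga x y)%:E.

(** Sizes are tested through positive real upper bounds [e] and [f], so that null sets are not a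
    separate case. *)
Definition sw_form_bound (be eta ga a b : R) : Prop :=
  exists2 C : R, 0 < C & forall E F (e f : R),
    measurable E -> measurable F -> 0 < e -> 0 < f ->
    (mu E <= e%:E)%E -> (mu F <= f%:E)%E ->
    (sw_form be eta ga E F <= (C * (e `^ a * f `^ b))%:E)%E.

Lemma sw_kernel_ge0 be eta ga x y : 0 <= sw_kernel be eta ga x y.
Proof. by rewrite !mulr_ge0 ?npow_ge0 ?dpow_ge0. Qed.

Lemma sw_kernelC be eta ga x y : sw_kernel be eta ga x y = sw_kernel ga eta be y x.
Proof. by rewrite /sw_kernel (dpowC _ x) [LHS]mulrC mulrA [LHS]mulrAC. Qed.

Lemma measurable_sw_kernel be eta ga :
  measurable_fun setT (fun z : 'rV[R]_n * 'rV[R]_n => (sw_kernel be eta ga z.1 z.2)%:E).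
Proof.
apply/measurable_EFinP; apply: measurable_funM; first apply: measurable_funM.
- exact: measurable_npow.
- exact: measurable_dpow.
- exact: measurable_npow.
Qed.

Lemma measurable_sw_kernelr be eta ga x D :
  measurable_fun D (fun y => (sw_kernel be eta ga x y)%:E).
Proof.
apply/measurable_EFinP; apply: measurable_funM; first apply: measurable_funM.
- by [].
- exact: measurable_dpowr.
- exact: measurable_npowT.
Qed.

Lemma sw_kernelE be eta ga x y : sw_kernel be eta ga x y =
  npow (- be) x * (dpow (- eta) x y * npow (- ga) y).
Proof. by rewrite /sw_kernel mulrA. Qed.

Lemma measurable_sw_inner be eta ga F : measurable F ->
  measurable_fun setT (fun x => \int[mu]_(y in F) (sw_kernel be eta ga x y)%:E)%E.
Proof.
move=> mF; apply: (measurable_integral_domain mu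
  (f := fun x y => (sw_kernel be eta ga x y)%:E) mF).
  exact: measurable_sw_kernel.
by move=> x y; rewrite lee_fin; exact: sw_kernel_ge0.
Qed.

Lemma sw_inner_ge0 be eta ga F x :
  (0 <= \int[mu]_(y in F) (sw_kernel be eta ga x y)%:E)%E.
Proof. by apply: integral_ge0 => y _; rewrite lee_fin sw_kernel_ge0. Qed.

Lemma sw_formC be eta ga E F : measurable E -> measurable F ->
  sw_form be eta ga E F = sw_form ga eta be F E.
Proof.
move=> mE mF; rewrite /sw_form
  (tonelli_domain mu mu (f := fun x y => (sw_kernel be eta ga x y)%:E) mE mF).
- apply: eq_integral => x _; apply: eq_integral => y _.
  by rewrite (sw_kernelC be eta ga y x).
- exact: measurable_sw_kernel.
- by move=> x y; rewrite lee_fin; exact: sw_kernel_ge0.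
Qed.

Lemma sw_form_boundC be eta ga a b :
  sw_form_bound be eta ga a b -> sw_form_bound ga eta be b a.
Proof.
move=> [C C0 bnd]; exists C => // E F e f mE mF e0 f0 Ee Ff.
by rewrite sw_formC// (mulrC (e `^ _)) bnd.
Qed.

(** The smaller of [a] and [b] takes over the whole exponent. For [a = 0] the left side vanishes
    because [u] is nonzero. *)
Lemma powR_prod_le (u v a b : R) : 0 <= a -> 0 <= b -> 0 < u -> 0 <= v ->
  a `^ (- u) * b `^ (- v) <= a `^ (- (u + v)) + b `^ (- (u + v)).
Proof.
move=> a0 b0 u0 v0.
have [->|an0] := eqVneq a 0.
  rewrite powR0 ?oppr_eq0 ?gt_eqF// mul0r.
  by rewrite addr_ge0// powR_ge0.
have [->|bn0] := eqVneq b 0.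
  have [->|vn0] := eqVneq v 0; first by rewrite oppr0 !powRr0 addr0 mulr1 lerDl powR_ge0.
  rewrite [0 `^ (- v)]powR0 ?oppr_eq0// mulr0.
  by rewrite addr_ge0// powR_ge0.
have {an0}a0 : 0 < a by rewrite lt_neqAle eq_sym an0.
have {bn0}b0 : 0 < b by rewrite lt_neqAle eq_sym bn0.
rewrite opprD !powR_gt0D//.
have [ab|/ltW ba] := leP a b.
  rewrite ler_wpDr// ?mulr_ge0 ?powR_ge0//.
  by rewrite ler_wpM2l ?powR_ge0// powR_antitone// oppr_le0.
rewrite ler_wpDl// ?mulr_ge0 ?powR_ge0//.
by rewrite ler_wpM2r ?powR_ge0// powR_antitone// oppr_le0 ltW.
Qed.

Lemma dpow_mass (s : R) : 0 <= s < N ->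
  exists2 C : R, 0 < C & forall x E (e : R),
    measurable E -> 0 < e -> (mu E <= e%:E)%E ->
    (\int[mu]_(y in E) (dpow (- s) x y)%:E <= (C * e `^ (1 - s / N))%:E)%E.
Proof.
move=> /(riesz_mass n0)[C C0 H]; exists C; first exact: C0.
move=> x E e mE e0 Ee; under eq_integral do rewrite dpowE npowE.
exact: H.
Qed.

Lemma npow_mass (s : R) : 0 <= s < N ->
  exists2 C : R, 0 < C & forall E (e : R),
    measurable E -> 0 < e -> (mu E <= e%:E)%E ->
    (\int[mu]_(y in E) (npow (- s) y)%:E <= (C * e `^ (1 - s / N))%:E)%E.
Proof.
move=> /dpow_mass[C C0 H]; exists C; first exact: C0.
move=> E e mE e0 Ee; have := H 0 E e mE e0 Ee.
by under eq_integral do rewrite dpow0l.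
Qed.

(** By [powR_prod_le], |x - y|^-eta |y|^-ga is at most |x - y|^-(ga + eta) + |y|^-(ga + eta), whose
    integral over F is bounded uniformly in x. The integral of |x|^-be over E then factors out. *)
Lemma sw_form_endpoint be eta ga :
  0 <= be < N -> 0 <= ga -> 0 < eta -> ga + eta < N ->
  sw_form_bound be eta ga (1 - be / N) (1 - (ga + eta) / N).
Proof.
move=> beN ga0 eta0 gN; have gN' : 0 <= ga + eta < N by rewrite gN andbT addr_ge0// ltW.
have [C1 C10 H1] := npow_mass beN.
have [C2 C20 H2] := dpow_mass gN'.
have [C3 C30 H3] := npow_mass gN'.
exists (C1 * (C2 + C3)); first by rewrite mulr_gt0// addr_gt0.
move=> E F e f mE mF e0 f0 Ee Ff.
have {}H1 := H1 E e mE e0 Ee.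
have {}H2 x := H2 x F f mF f0 Ff.
have {}H3 := H3 F f mF f0 Ff.
pose K := (C2 + C3) * f `^ (1 - (ga + eta) / N).
have K0 : 0 <= K by rewrite mulr_ge0 ?powR_ge0// addr_ge0// ltW.
have md s x D : measurable_fun D (fun y => (dpow s x y)%:E).
  by apply/measurable_EFinP; exact: measurable_dpowr.
have mn s D : measurable_fun D (fun x : 'rV[R]_n => (npow s x)%:E).
  by apply/measurable_EFinP; exact: measurable_npowT.
have d0 s x y : (0 <= (dpow s x y)%:E)%E by rewrite lee_fin dpow_ge0.
have p0 s y : (0 <= (npow s y : R)%:E)%E by rewrite lee_fin npow_ge0.
have mdn s t x D : measurable_fun D (fun y => (dpow s x y * npow t y)%:E).
  apply/measurable_EFinP; apply: measurable_funM.
    exact: measurable_dpowr.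
  exact: measurable_npowT.
have dn0 s t x y : (0 <= (dpow s x y * npow t y)%:E)%E.
  by rewrite lee_fin mulr_ge0 ?dpow_ge0 ?npow_ge0.
have inner x : (\int[mu]_(y in F) (sw_kernel be eta ga x y)%:E <=
    K%:E * (npow (- be) x)%:E)%E.
  under eq_integral do rewrite sw_kernelE EFinM.
  rewrite (ge0_integralZl mu mF (mdn _ _ x F) (fun y _ => dn0 _ _ x y) (p0 _ x)).
  rewrite muleC; apply: lee_wpmul2r; first exact: p0.
  apply: (@le_trans _ _ (\int[mu]_(y in F)
     ((dpow (- (ga + eta)) x y)%:E + (npow (- (ga + eta)) y)%:E))%E).
    apply: ge0_le_integral.
    - exact: mF.
    - by move=> y _; exact: dn0.
    - exact: mdn.
    - by apply: emeasurable_funD; [exact: md|exact: mn].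
    - move=> y _; rewrite -EFinD lee_fin !dpowE !npowE (addrC ga).
      by apply: powR_prod_le; rewrite ?enorm_ge0.
  rewrite (ge0_integralD mu mF (fun y _ => d0 _ x y) (md _ x F) (fun y _ => p0 _ y) (mn _ F)).
  by rewrite /K mulrDl EFinD; apply: leeD; [exact: H2|exact: H3].
apply: (@le_trans _ _ (\int[mu]_(x in E) (K%:E * (npow (- be) x)%:E))%E).
  apply: ge0_le_integral.
  - exact: mE.
  - by move=> x _; exact: sw_inner_ge0.
  - by apply: measurable_funTS; exact: measurable_sw_inner.
  - by apply: emeasurable_funM; [exact: measurable_cst|exact: mn].
  - by move=> x _; exact: inner.
rewrite (ge0_integralZl_EFin mu mE (fun y _ => p0 _ y) (mn _ E) K0).
apply: (@le_trans _ _ (K%:E * (C1 * e `^ (1 - be / N))%:E)%E).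
  by apply: lee_wpmul2l; [rewrite lee_fin|exact: H1].
by rewrite -EFinM lee_fin /K le_eqVlt; apply/orP; left; apply/eqP; ring.
Qed.

(** The minimum of two bounds X and Y is at most their weighted geometric mean X^t Y^(1 - t). *)
Lemma sw_form_interpolate be eta ga a0 b0 a1 b1 t : 0 <= t <= 1 ->
  sw_form_bound be eta ga a0 b0 -> sw_form_bound be eta ga a1 b1 ->
  sw_form_bound be eta ga (t * a0 + (1 - t) * a1) (t * b0 + (1 - t) * b1).
Proof.
move=> /andP[t0 t1] [C0 C00 H0] [C1 C10 H1].
exists (C0 + C1); first by rewrite addr_gt0.
move=> E F e f mE mF e0 f0 Ee Ff.
have {}H0 := H0 _ _ _ _ mE mF e0 f0 Ee Ff.
have {}H1 := H1 _ _ _ _ mE mF e0 f0 Ee Ff.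
set X := e `^ a0 * f `^ b0 in H0; set Y := e `^ a1 * f `^ b1 in H1.
have X0 : 0 < X by rewrite mulr_gt0 ?powR_gt0.
have Y0 : 0 < Y by rewrite mulr_gt0 ?powR_gt0.
rewrite (_ : e `^ _ * f `^ _ = X `^ t * Y `^ (1 - t)); last first.
  rewrite /X /Y !powRM ?powR_ge0// -!powRrM !powR_gt0D//.
  by rewrite !(mulrC t) !(mulrC (1 - t)); ring.
have XX : X = X `^ t * X `^ (1 - t).
  by rewrite -powR_gt0D// addrC subrK powRr1// ltW.
have YY : Y = Y `^ t * Y `^ (1 - t).
  by rewrite -powR_gt0D// addrC subrK powRr1// ltW.
have [XY|/ltW YX] := leP X Y.
  apply: le_trans H0 _; rewrite lee_fin mulrDl ler_wpDr//.
    by rewrite !mulr_ge0 ?powR_ge0// ltW.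
  apply: (ler_wpM2l (ltW C00)); rewrite {1}XX.
  apply: ler_wpM2l; first exact: powR_ge0.
  by apply: powR_homo; rewrite ?subr_ge0// ltW.
apply: le_trans H1 _; rewrite lee_fin mulrDl ler_wpDl//.
  by rewrite !mulr_ge0 ?powR_ge0// ltW.
apply: (ler_wpM2l (ltW C10)); rewrite {1}YY.
apply: ler_wpM2r; first exact: powR_ge0.
by apply: powR_homo; rewrite // ltW.
Qed.

(** The endpoint estimate gives b = be / N, and the same estimate with the variables exchanged gives
    b = (be + eta) / N. Values in between follow by interpolation, [t] being the barycentric
    coordinate. *)
Lemma sw_form_bound_nneg be eta ga b :
  0 <= be -> 0 <= ga -> 0 < eta -> be + eta < N -> ga + eta < N ->
  be <= N * b <= be + eta ->
  sw_form_bound be eta ga (1 - b) (b + 1 - (be + eta + ga) / N).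
Proof.
move=> be0 ga0 eta0 beN gaN /andP[b1 b2].
have N0 : 0 < N by rewrite ltr0n.
have H0 : sw_form_bound be eta ga (1 - be / N) (1 - (ga + eta) / N).
  by apply: sw_form_endpoint => //; rewrite be0/=; lra.
have H1 : sw_form_bound be eta ga (1 - (be + eta) / N) (1 - ga / N).
  by apply/sw_form_boundC/sw_form_endpoint => //; rewrite ga0/=; lra.
pose t := (be + eta - N * b) / eta.
have t01 : 0 <= t <= 1.
  by rewrite /t ler_pdivlMr// ler_pdivrMr// mul0r mul1r; apply/andP; split; lra.
have := sw_form_interpolate t01 H0 H1.
rewrite (_ : t * _ + _ = 1 - b); last by rewrite /t; field; apply/andP; split; lra.
by rewrite (_ : t * _ + _ = b + 1 - (be + eta + ga) / N)//;
  rewrite /t; field; apply/andP; split; lra.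
Qed.

End stein_weiss_form.

(** * Restricted bounds when one outer exponent may be negative *)

Section stein_weiss_form_general.
Context (R : realType) (n : nat).
Hypothesis n0 : (0 < n)%N.
Implicit Types (x y : 'rV[R]_n) (E F : set 'rV[R]_n).
Local Notation mu := (lebesgue_rV R n).
Local Notation N := (n%:R : R).

(** The origin is a null set in positive dimension. It is removed because [npow] takes a
    conventional value there, for which comparisons between kernels with different exponents can
    fail. *)
Lemma sw_form_off0 be eta ga E F : measurable E -> measurable F ->
  sw_form be eta ga E F = sw_form be eta ga (E `\ 0%R) (F `\ 0%R).
Proof.
move=> mE mF; have z0 := lebesgue_rV_point (0 : 'rV[R]_n) n0.
have mz := measurable_rV_point (0 : 'rV[R]_n).
have mI : measurable_fun E (fun x => \int[mu]_(y in F) (sw_kernel be eta ga x y)%:E)%E.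
  by apply: measurable_funTS; exact: measurable_sw_inner.
rewrite /sw_form.
rewrite (ge0_negligible_integral mz mE mI (fun x _ => sw_inner_ge0 be eta ga F x) z0).
apply: eq_integral => x _.
apply: (ge0_negligible_integral mz mF _ _ z0).
- exact: measurable_sw_kernelr.
- by move=> y _; rewrite lee_fin; exact: sw_kernel_ge0.
Qed.

Lemma sw_form_bound_sum be eta ga be1 eta1 ga1 be2 eta2 ga2 a b c : 0 < c ->
  (forall x y, x <> 0 -> y <> 0 -> sw_kernel be eta ga x y <=
     c * (sw_kernel be1 eta1 ga1 x y + sw_kernel be2 eta2 ga2 x y)) ->
  sw_form_bound n be1 eta1 ga1 a b -> sw_form_bound n be2 eta2 ga2 a b ->
  sw_form_bound n be eta ga a b.
Proof.
move=> c0 ker_le [C1 C10 H1] [C2 C20 H2].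
exists (c * (C1 + C2)); first by rewrite mulr_gt0// addr_gt0.
move=> E F e f mE mF e0 f0 Ee Ff; rewrite (sw_form_off0 _ _ _ mE mF).
have mz := measurable_rV_point (0 : 'rV[R]_n).
have mE0 : measurable (E `\ 0%R) by exact: measurableD.
have mF0 : measurable (F `\ 0%R) by exact: measurableD.
have {}Ee : (mu (E `\ 0%R) <= e%:E)%E.
  by apply: le_trans Ee; apply: le_measure; rewrite ?inE.
have {}Ff : (mu (F `\ 0%R) <= f%:E)%E.
  by apply: le_trans Ff; apply: le_measure; rewrite ?inE.
have {}H1 := H1 _ _ _ _ mE0 mF0 e0 f0 Ee Ff.
have {}H2 := H2 _ _ _ _ mE0 mF0 e0 f0 Ee Ff.
apply: (@le_trans _ _ (c%:E * (sw_form be1 eta1 ga1 (E `\ 0%R) (F `\ 0%R) +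
                        sw_form be2 eta2 ga2 (E `\ 0%R) (F `\ 0%R))))%E; last first.
  rewrite -mulrA EFinM; apply: lee_wpmul2l; first by rewrite lee_fin ltW.
  by rewrite mulrDl EFinD; apply: leeD; [exact: H1|exact: H2].
have mI be' eta' ga' : measurable_fun (E `\ 0%R) (fun x : 'rV[R]_n =>
    \int[mu]_(y in F `\ 0%R) (sw_kernel be' eta' ga' x y)%:E)%E.
  by apply: measurable_funTS; exact: measurable_sw_inner.
have I0 be' eta' ga' x : (E `\ 0%R) x ->
    (0 <= \int[mu]_(y in F `\ 0%R) (sw_kernel be' eta' ga' x y)%:E)%E.
  by move=> _; exact: sw_inner_ge0.
have mk be' eta' ga' x : measurable_fun (F `\ 0%R) (fun y : 'rV[R]_n =>
    (sw_kernel be' eta' ga' x y)%:E).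
  exact: measurable_sw_kernelr.
have k0 be' eta' ga' x y : (F `\ 0%R) y -> (0 <= (sw_kernel be' eta' ga' x y)%:E)%E.
  by move=> _; rewrite lee_fin; exact: sw_kernel_ge0.
rewrite {2 3}/sw_form -(ge0_integralD mu mE0 (I0 be1 eta1 ga1) (mI be1 eta1 ga1)
  (I0 be2 eta2 ga2) (mI be2 eta2 ga2)).
rewrite -(ge0_integralZl_EFin mu mE0 _ _ (ltW c0)); last 2 first.
- by move=> x Ex; apply: adde_ge0; exact: I0.
- by apply: emeasurable_funD; exact: mI.
apply: ge0_le_integral.
- exact: mE0.
- exact: I0.
- exact: mI.
- apply: emeasurable_funM; first exact: measurable_cst.
  by apply: emeasurable_funD; exact: mI.
move=> x [_ /= x0].
rewrite -(ge0_integralD mu mF0 (k0 be1 eta1 ga1 x) (mk be1 eta1 ga1 x)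
  (k0 be2 eta2 ga2 x) (mk be2 eta2 ga2 x)).
rewrite -(ge0_integralZl_EFin mu mF0 _ _ (ltW c0)); last 2 first.
- by move=> y Ey; apply: adde_ge0; exact: k0.
- by apply: emeasurable_funD; exact: mk.
apply: ge0_le_integral.
- exact: mF0.
- exact: k0.
- exact: mk.
- apply: emeasurable_funM; first exact: measurable_cst.
  by apply: emeasurable_funD; exact: mk.
by move=> y [_ /= y0]; rewrite -EFinD -EFinM lee_fin; exact: ker_le.
Qed.

(* For [be <= 0] the weight grows; it is moved to the other two factors by the
   triangle inequality, after sparing a small power [de] of decay. *)
Lemma sw_kernel_split be eta ga de x y : be <= 0 -> 0 <= de -> 0 < eta ->
  x <> 0 -> y <> 0 ->
  sw_kernel be eta ga x y <= 4 `^ (de - be) *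
    (sw_kernel de (eta + be - de) ga x y + sw_kernel de eta (ga + be - de) x y).
Proof.
move=> be0 de0 eta0 /enorm_gt0 x0 /enorm_gt0 y0.
rewrite /sw_kernel !dpowE !npowE.
have := enorm_ge0 (x - y); have := enorm_quasitriangle x y.
move: (enorm x) (enorm (x - y)) (enorm y) x0 y0 => X D Y x0 y0 tri.
rewrite le_eqVlt => /predU1P[<-|d0].
  rewrite [0 `^ (- eta)]powR0 ?oppr_eq0 ?gt_eqF// !(mul0r, mulr0) addr0.
  by rewrite !mulr_ge0 ?powR_ge0.
have c0 : 0 <= de - be by lra.
(* The base 4 comes from |x| <= 2 (|x - y| + |y|) <= 4 max(|x - y|, |y|). *)
have XDY : X `^ (de - be) <= 4 `^ (de - be) * (D `^ (de - be) + Y `^ (de - be)).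
  have [DY|/ltW YD] := leP D Y.
    apply: (@le_trans _ _ ((4 * Y) `^ (de - be))).
      by apply: powR_homo => //; [rewrite ltW|lra].
    by rewrite powRM// ?(ltW y0)// ler_wpM2l ?powR_ge0// lerDr powR_ge0.
  apply: (@le_trans _ _ ((4 * D) `^ (de - be))).
    by apply: powR_homo => //; [rewrite ltW|lra].
  by rewrite powRM// ?(ltW d0)// ler_wpM2l ?powR_ge0// lerDl powR_ge0.
have [c cE] : {c | c = de - be} by exists (de - be).
rewrite -cE in XDY c0 *.
rewrite (_ : - be = - de + c); last by rewrite cE; ring.
rewrite (_ : - (eta + be - de) = c - eta); last by rewrite cE; ring.
rewrite (_ : - (ga + be - de) = c - ga); last by rewrite cE; ring.
rewrite (powR_gt0D (- de))// (powR_gt0D _ (- eta))// (powR_gt0D _ (- ga))//.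
rewrite [leRHS](_ : _ = X `^ (- de) * (4 `^ c * (D `^ c + Y `^ c))
    * D `^ (- eta) * Y `^ (- ga)); last by ring.
apply: ler_wpM2r; first exact: powR_ge0.
apply: ler_wpM2r; first exact: powR_ge0.
by apply: ler_wpM2l; first exact: powR_ge0.
Qed.

(** Both kernels produced by [sw_kernel_split] have nonnegative outer exponents and the homogeneity
    of the original one, so [sw_form_bound_nneg] applies to each with the same [b]. *)
Lemma sw_form_bound_npos be eta ga b : be <= 0 -> 0 < eta < N -> 0 <= be + ga ->
  be + eta + ga <= N -> be + eta + ga < N \/ 0 < be + ga ->
  be < N * b < be + eta -> 0 < b ->
  sw_form_bound n be eta ga (1 - b) (b + 1 - (be + eta + ga) / N).
Proof.
move=> be0 /andP[eta0 etaN] bega omN omN' /andP[b1 b2] b0.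
have N0 : 0 < N by rewrite ltr0n.
have Nb0 : 0 < N * b by rewrite mulr_gt0.
(* The three entries keep [ga + be - de] nonnegative, [de + eta] below N, and [de] below [N * b]. *)
pose de := Num.min (be + ga) (Num.min ((N - eta) / 2) (N * b / 2)).
have de1 : de <= be + ga by rewrite ge_min lexx.
have de2 : de <= (N - eta) / 2 by rewrite !ge_min lexx !orbT.
have de3 : de <= N * b / 2 by rewrite !ge_min lexx !orbT.
have de0 : 0 <= de by rewrite !le_min bega/= !divr_ge0//; lra.
(* At homogeneity exactly N this strict inequality is what a positive [de] buys, and [0 < be + ga]
   leaves room for it. *)
have omde : be + eta + ga - de < N.
  case: omN' => [|bega0]; first lra.
  suff : 0 < de by lra.
  by rewrite !lt_min bega0/= !divr_gt0//; lra.
have c0 : 0 < 4 `^ (de - be) :> R by rewrite powR_gt0.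
apply: (@sw_form_bound_sum be eta ga de (eta + be - de) ga de eta (ga + be - de)
  _ _ _ c0).
- by move=> x y; exact: sw_kernel_split.
- rewrite (_ : be + eta + ga = de + (eta + be - de) + ga); last by ring.
  by apply: (sw_form_bound_nneg n0); try (apply/andP; split); lra.
- rewrite (_ : be + eta + ga = de + eta + (ga + be - de)); last by ring.
  by apply: (sw_form_bound_nneg n0); try (apply/andP; split); lra.
Qed.

(** As be + ga >= 0, at most one of the two is negative. A nonpositive [ga] becomes a nonpositive
    first exponent after exchanging the variables, which turns [b] into (be + eta + ga) / N - b. *)
Lemma sw_form_bound_general be eta ga b : 0 < eta < N -> 0 <= be + ga ->
  be + eta + ga <= N -> be + eta + ga < N \/ 0 < be + ga ->
  be < N * b < be + eta -> 0 < b -> N * b < be + eta + ga ->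
  sw_form_bound n be eta ga (1 - b) (b + 1 - (be + eta + ga) / N).
Proof.
move=> etaN bega omN omN' bN b0 bom.
have N0 : 0 < N by rewrite ltr0n.
have [be0|be0] := leP be 0; first exact: sw_form_bound_npos.
have [ga0|ga0] := leP ga 0; last first.
  move: etaN bN => /andP[eta0 etaN] /andP[b1 b2].
  by apply: (sw_form_bound_nneg n0); try (apply/andP; split); lra.
apply: sw_form_boundC.
pose b' := (be + eta + ga) / N - b.
have Nb' : N * b' = be + eta + ga - N * b.
  by rewrite /b' mulrBr mulrCA divff ?mulr1// gt_eqF.
have b'0 : 0 < b' by rewrite -(pmulr_rgt0 _ N0) Nb'; lra.
have := @sw_form_bound_npos ga eta be b' ga0 etaN.
rewrite Nb' (_ : 1 - b' = b + 1 - (be + eta + ga) / N); last by rewrite /b'; ring.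
rewrite (_ : b' + 1 - _ = 1 - b); last by rewrite /b'; ring.
move: etaN bN => /andP[eta0 etaN] /andP[b1 b2]; apply; lra.
Qed.

End stein_weiss_form_general.

(** * The two-sided decay factor min(r^e, r^-e) *)

Section bump.
Context (R : realType).
Implicit Types e r m s t : R.

Definition bump e r : R := Num.min (r `^ e) (r `^ (- e)).

Lemma bump_ge0 e r : 0 <= bump e r.
Proof. by rewrite le_min !powR_ge0. Qed.

Lemma bump_le1 e r : 0 < e -> 0 < r -> bump e r <= 1.
Proof.
move=> e0 r0; rewrite ge_min !powR_expR// !expR_le1 mulNr oppr_le0.
have [r1|r1] := leP r 1; first by rewrite pmulr_rle0// ln_le0.
by rewrite orbC mulr_ge0 ?ln_ge0// ltW.
Qed.

Lemma bumpV e r : 0 < r -> bump e r^-1 = bump e r.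
Proof.
by move=> r0; rewrite /bump minC !powR_expR ?invr_gt0// !lnV ?posrE// !mulrN !mulNr opprK.
Qed.

Lemma powR_min (x y b : R) : 0 <= b -> 0 <= x -> 0 <= y ->
  (Num.min x y) `^ b = Num.min (x `^ b) (y `^ b).
Proof.
move=> b0 x0 y0; have [xy|/ltW yx] := leP x y.
  by rewrite [RHS]min_l//; exact: powR_homo.
by rewrite [RHS]min_r//; exact: powR_homo.
Qed.

Lemma bump_powR e r b : 0 <= b -> bump e r `^ b = bump (e * b) r.
Proof. by move=> b0; rewrite /bump powR_min ?powR_ge0// -!powRrM mulNr. Qed.

Lemma bump_half e r s : 0 < e -> 0 < r -> r / 2 <= s <= r ->
  2 `^ (- e) * bump e r <= bump e s.
Proof.
move=> e0 r0 /andP[rs sr]; have r20 : 0 < r / 2 by rewrite divr_gt0.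
have s0 : 0 < s by exact: lt_le_trans rs.
have e1 : 2 `^ (- e) <= 1 :> R.
  by rewrite powR_expR// expR_le1 mulNr oppr_le0 mulr_ge0 ?ln_ge0 ?ler1n// ltW.
rewrite le_min; apply/andP; split.
  apply: (@le_trans _ _ (2 `^ (- e) * r `^ e)).
    by rewrite ler_wpM2l ?powR_ge0// ge_min lexx.
  rewrite mulrC powRN -[(2 `^ e)^-1]powRN.
  rewrite (_ : r `^ e * _ = (r / 2) `^ e); last first.
    by rewrite powRM// ?ltW// -powR_inv1// -powRrM mulN1r.
  by apply: powR_homo; rewrite // ltW.
apply: (@le_trans _ _ (1 * r `^ (- e))).
  by apply: ler_pM; rewrite ?powR_ge0 ?bump_ge0// ge_min lexx orbT.
by rewrite mul1r; apply: powR_antitone; rewrite ?oppr_le0// ltW.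
Qed.

Lemma measurable_invr : measurable_fun setT (fun x : R => x^-1).
Proof.
(* A power of the nonnegative number x^2 appears on the right; at x = 0 both sides are 0. *)
have -> : (fun x : R => x^-1) = (fun x => x * (x ^+ 2) `^ (-1)).
  apply/funext => x; rewrite powR_inv1 ?sqr_ge0//.
  have [->|x0] := eqVneq x 0; first by rewrite invr0 mul0r.
  by rewrite expr2 invfM mulrA divff// mul1r.
apply: measurable_funM => //.
apply: (measurableT_comp (@measurable_powR R _)).
exact: measurable_funX.
Qed.

Lemma measurable_bump e : measurable_fun setT (bump e).
Proof. by apply: measurable_minr; exact: measurable_powR. Qed.

Let rho e : R := 2 `^ (- e).

Let rho01 e : 0 < e -> 0 < rho e < 1.
Proof.
move=> e0; rewrite /rho powR_gt0//= powR_expR// expR_lt1.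
by rewrite mulNr oppr_lt0 mulr_gt0// ln_gt0// ltr1n.
Qed.

Let two_powR e k : (2 ^+ k) `^ (- e) = rho e ^+ k.
Proof.
have r0 : 0 <= rho e by exact: powR_ge0.
by rewrite -powR_mulrn// -(powR_mulrn k r0) powRAC.
Qed.

Let measurable_bump_div e m : measurable_fun setT (fun s : R => (bump e (s / m) / s)%:E).
Proof.
apply/measurable_EFinP; apply: measurable_funM; last exact: measurable_invr.
apply: (measurableT_comp (measurable_bump e)).
exact: measurable_funM.
Qed.

Let bump_div_ge0 e m s : 0 < s -> (0 <= (bump e (s / m) / s)%:E)%E.
Proof. by move=> s0; rewrite lee_fin divr_ge0 ?bump_ge0// ltW. Qed.

(** Scale invariance of ds/s makes the constant independent of [m]. On each side of [m] the dyadic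
    blocks contribute a geometric series of ratio 2^-e. *)
Lemma bump_mass e : 0 < e -> exists2 C : R, 0 < C & forall m, 0 < m ->
  (\int[@lebesgue_measure R]_(s in `]0%R, +oo[) (bump e (s / m) / s)%:E <= C%:E)%E.
Proof.
move=> e0; have r01 := rho01 e0; have /andP[r0 r1] := r01.
have K0 : 0 < 2 / (1 - rho e) by rewrite divr_gt0// subr_gt0.
exists (2 / (1 - rho e) + 2 / (1 - rho e)); first by rewrite addr_gt0.
move=> m m0.
have mI b c : @measurable _ R [set` Interval b c] by exact: measurable_itv.
have -> : `]0%R, +oo[%classic = `]0%R, m[%classic `|` `[m, +oo[%classic :> set R.
  apply/seteqP; split => [s|s [|]]; rewrite /= !in_itv/= !andbT.
  - by have [sm s0|sm _] := ltP s m; [left; rewrite s0|right].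
  - by case/andP.
  - exact: lt_le_trans.
rewrite ge0_integral_setU//; last 3 first.
- by apply: measurable_funTS; exact: measurable_bump_div.
- move=> s [/=|/=]; rewrite in_itv/= => /andP[s0 _]; apply: bump_div_ge0 => //.
  exact: lt_le_trans s0.
- apply/disj_setPS => s [/=]; rewrite !in_itv/= andbT => /andP[_ +].
  by rewrite ltNge => /negP.
have bumpN z k : 1 <= z -> 2 ^+ k <= z -> bump e z <= rho e ^+ k.
  move=> z1 kz; apply: (@le_trans _ _ (z `^ (- e))); first by rewrite ge_min lexx orbT.
  have k0 : 0 < 2 ^+ k :> R by rewrite exprn_gt0.
  have eN0 : - e <= 0 by rewrite oppr_le0 ltW.
  by rewrite -two_powR; exact: powR_antitone eN0 k0 kz.
rewrite EFinD; apply: leeD.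
- apply: (@integral_le_dyadic _ _ R (@lebesgue_measure R) _ _ (fun k => `[0, m / 2 ^+ k]%classic)
    (fun k => rho e ^+ k * (2 ^+ k.+1 / m)) (fun k => m / 2 ^+ k) 2 (rho e)); rewrite ?r01//.
  + by apply: measurable_funTS; exact: measurable_bump_div.
  + by move=> s /=; rewrite in_itv/= => /andP[s0 _]; exact: bump_div_ge0.
  + by move=> k; rewrite mulr_ge0 ?exprn_ge0 ?powR_ge0// divr_ge0 ?exprn_ge0// ltW.
  + move=> s /=; rewrite in_itv/= => /andP[s0 sm] _.
    have z1 : 1 <= m / s by rewrite ler_pdivlMr// mul1r ltW.
    have [k /andP[k1 k2]] := dyadic_interval z1.
    exists k; rewrite /= ?in_itv/=.
      rewrite ltW//= ler_pdivlMr ?exprn_gt0//; move: k1.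
      by rewrite ler_pdivlMr// mulrC.
    rewrite lee_fin -bumpV ?divr_gt0// invf_div.
    apply: ler_pM; rewrite ?bump_ge0 ?invr_ge0 ?(ltW s0)//; first exact: bumpN.
    rewrite ler_pdivlMr// mulrC; exact: ltW.
  + move=> k; have := @lebesgue_measure_itv R `[0, m / 2 ^+ k].
    move=> /= ->; case: ifPn => _; first by rewrite oppr0 adde0.
    by rewrite lee_fin divr_ge0 ?exprn_ge0// ltW.
  + move=> k; rewrite le_eqVlt; apply/orP; left; apply/eqP.
    by rewrite exprS; field; rewrite expf_neq0//= gt_eqF.
- apply: (@integral_le_dyadic _ _ R (@lebesgue_measure R) _ _ (fun k => `[0, m * 2 ^+ k.+1]%classic)
    (fun k => rho e ^+ k * (2 ^+ k * m)^-1) (fun k => m * 2 ^+ k.+1) 2 (rho e)); rewrite ?r01//.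
  + by apply: measurable_funTS; exact: measurable_bump_div.
  + move=> s /=; rewrite in_itv/= andbT => ms; apply: bump_div_ge0.
    exact: lt_le_trans ms.
  + by move=> k; rewrite mulr_ge0 ?exprn_ge0 ?powR_ge0// invr_ge0 mulr_ge0 ?exprn_ge0// ltW.
  + move=> s /=; rewrite in_itv/= andbT => ms _.
    have s0 : 0 < s by exact: lt_le_trans ms.
    have z1 : 1 <= s / m by rewrite ler_pdivlMr// mul1r.
    have [k /andP[k1 k2]] := dyadic_interval z1.
    exists k; rewrite /= ?in_itv/=.
      by rewrite ltW//= mulrC -ler_pdivrMr// ltW.
    rewrite lee_fin; apply: ler_pM; rewrite ?bump_ge0 ?invr_ge0 ?(ltW s0)//.
      exact: bumpN.
    by rewrite lef_pV2 ?posrE ?mulr_gt0 ?exprn_gt0// -ler_pdivlMr.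
  + move=> k; have := @lebesgue_measure_itv R `[0, m * 2 ^+ k.+1].
    move=> /= ->; case: ifPn => _; first by rewrite oppr0 adde0.
    by rewrite lee_fin mulr_ge0 ?exprn_ge0// ltW.
  + move=> k; rewrite le_eqVlt; apply/orP; left; apply/eqP.
    by rewrite exprS; field; rewrite expf_neq0//= gt_eqF.
Qed.

End bump.

(** * Lorentz functionals and rearrangements *)

Section lorentz_functional.
Context (R : realType).
Implicit Types (G H : R -> \bar R) (a b e t m P Q C : R).
Local Notation leb := (@lebesgue_measure R).

(** [lorentz_norm] with an arbitrary function in place of the rearrangement: the estimates below
    only ask that it be nonincreasing and nonnegative. *)
Definition lorentz_fun (a : R) (b : \bar R) (G : R -> \bar R) : \bar R :=
  match b with
  | b%:E =>
      ((b / a)%:E * \int[leb]_(tau in `]0%R, +oo[)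
         (((tau `^ a^-1)%:E * G tau) `^ b * (tau^-1)%:E)) `^ b^-1
  | +oo =>
      ereal_sup [set (tau `^ a^-1)%:E * G tau | tau in [set tau : R | (0 < tau)%R]]
  | -oo => 0
  end%E.

Definition noninc G := forall s t, s <= t -> (G t <= G s)%E.

Definition nonneg_fun G := forall t, (0 <= G t)%E.

(* [H t] is controlled by the values of [G], with a loss away from [t]; this is
   the form taken by the interpolation inequalities below. *)
Definition bump_dominated e P Q C G H := forall t m, 0 < t -> 0 < m ->
  (forall tau, 0 < tau -> ((bump e (tau / t) * tau `^ P)%:E * G tau <= m%:E)%E) ->
  ((t `^ Q)%:E * H t <= (C * m)%:E)%E.

(** Testing with positive reals [m] keeps later arguments among finite numbers; x = 0 is reached by
    letting [m] decrease to 0. *)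
Lemma lee_of_real (x y : \bar R) C : 0 < C -> (0 <= x)%E ->
  (forall m, 0 < m -> (x <= m%:E)%E -> (y <= (C * m)%:E)%E) ->
  (y <= C%:E * x)%E.
Proof.
move=> C0; case: x => [r|_ _|//]; last by rewrite gt0_muley ?leey// lte_fin.
rewrite lee_fin => r0 H; apply/lee_addgt0Pr => eps eps0.
have rC : 0 < r + eps / C by rewrite ltr_wpDl// divr_gt0.
apply: le_trans (H _ rC _) _; first by rewrite lee_fin lerDl divr_ge0// ltW.
by rewrite -EFinM -EFinD lee_fin mulrDr mulrCA divff ?mulr1// gt_eqF.
Qed.

Lemma le_poweR (x y : \bar R) b : 0 <= b -> (0 <= x)%E -> (x <= y)%E ->
  (x `^ b <= y `^ b)%E.
Proof.
move=> b0 x0 xy; apply: gt0_ler_poweR => //.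
  by rewrite in_itv/= x0 leey.
by rewrite in_itv/= (le_trans x0 xy) leey.
Qed.

Lemma le_poweR_inv (x y : \bar R) b : 0 < b -> (0 <= x)%E -> (x `^ b <= y)%E ->
  (x <= y `^ b^-1)%E.
Proof.
move=> b0 x0 xy; rewrite -[leLHS]poweRe1// -[1](@mulfV _ b) ?gt_eqF// poweRrM.
by apply: le_poweR => //; [rewrite invr_ge0 ltW|exact: poweR_ge0].
Qed.

(** Superlevel sets of a nonincreasing function are intervals. *)
Lemma noninc_measurable G D : noninc G -> measurable_fun D G.
Proof.
move=> niG; apply: measurable_funTS.
apply: (measurability _ (ErealGenOInfty.measurableE R)) => /= _ [_ [a ->]] <-.
apply: measurableI => //; apply: is_interval_measurable => s t /=.
rewrite !in_itv/= !andbT => _ Gt u /andP[_ ut].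
by rewrite in_itv/= andbT (lt_le_trans Gt)// niG.
Qed.

Let itv0y : set R := `]0%R, +oo[%classic.
Let mitv0y : @measurable _ R itv0y. Proof. exact: measurable_itv. Qed.

Let inE0 t : itv0y t = (0 < t) :> Prop.
Proof. by rewrite /itv0y /= in_itv/= andbT. Qed.

Definition lorentz_density P b G (t : R) : \bar R :=
  (((t `^ P)%:E * G t) `^ b * (t^-1)%:E)%E.

Lemma lorentz_funE a b G : lorentz_fun a b%:E G =
  (((b / a)%:E * \int[leb]_(t in itv0y) lorentz_density a^-1 b G t) `^ b^-1)%E.
Proof. by []. Qed.

Lemma lorentz_density_ge0 P b G t : 0 < t -> (0 <= lorentz_density P b G t)%E.
Proof.
by move=> t0; apply: mule_ge0; rewrite ?poweR_ge0// lee_fin invr_ge0 ltW.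
Qed.

Lemma measurable_lorentz_density P b G D : measurable_fun setT G ->
  measurable_fun D (lorentz_density P b G).
Proof.
move=> mG; apply: measurable_funTS; apply: emeasurable_funM; last first.
  by apply/measurable_EFinP; exact: measurable_invr.
apply: (measurableT_comp (measurable_poweR _)).
apply: emeasurable_funM => //; apply/measurable_EFinP.
exact: measurable_powR.
Qed.

Lemma lorentz_fun_ge0 a (b : \bar R) G : 0 < a -> nonneg_fun G -> (0 <= lorentz_fun a b G)%E.
Proof.
move=> a0 G0; case: b => [b| |] //=; first exact: poweR_ge0.
have H : (0 <= (1 `^ a^-1)%:E * G 1%R)%E.
  by rewrite powR1 mul1e; exact: G0.
by apply: (le_trans H); apply: ereal_sup_ubound; exists 1 => //=; exact: ltr01.
Qed.

Section finite_exponent.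
Variables (b : R) (b0 : 0 < b).

(* The values of a nonincreasing [G] on [[tau / 2, tau]] dominate [G tau]. *)
Lemma lorentz_density_local e P : 0 < e -> 0 <= P ->
  exists2 K : R, 0 < K & forall G, noninc G -> nonneg_fun G ->
    forall t tau, 0 < t -> 0 < tau ->
    (((bump e (tau / t) * tau `^ P)%:E * G tau) `^ b <=
     K%:E * \int[leb]_(s in itv0y) ((bump e (s / t) `^ b)%:E * lorentz_density P b G s))%E.
Proof.
move=> e0 P0.
(* Moving from tau to a point of [tau / 2, tau] costs 2^(e b) in the bump and 2^(P b) in the power.
   The extra 2 in [2 * k] makes up for the length tau / 2 of the interval. *)
pose k : R := 2 `^ (e * b) * 2 `^ (P * b).
have k0 : 0 < k by rewrite mulr_gt0 ?powR_gt0.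
exists (2 * k); first by rewrite mulr_gt0.
move=> G niG G0 t tau t0 tau0.
set X := (_ `^ b)%E; set J := integral _ _ _.
have X0 : (0 <= X)%E by exact: poweR_ge0.
have mf : measurable_fun itv0y
    (fun s => (bump e (s / t) `^ b)%:E * lorentz_density P b G s)%E.
  apply: emeasurable_funM; last first.
    by apply: measurable_lorentz_density; exact: noninc_measurable.
  apply/measurable_EFinP; apply: (measurableT_comp (@measurable_powR R _)).
  apply: measurable_funTS.
  apply: (measurableT_comp (measurable_bump e)).
  exact: measurable_funM.
have f0 s : itv0y s -> (0 <= (bump e (s / t) `^ b)%:E * lorentz_density P b G s)%E.
  rewrite inE0 => s0; apply: mule_ge0; first by rewrite lee_fin powR_ge0.
  exact: lorentz_density_ge0.
pose D : set R := `[tau / 2, tau]%classic.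
have mI : @measurable _ R D by exact: measurable_itv.
have sub : D `<=` itv0y.
  move=> s; rewrite inE0 /D /= in_itv/= => /andP[+ _].
  by apply: lt_le_trans; rewrite divr_gt0.
have : (\int[leb]_(s in D) ((k^-1 * tau^-1)%:E * X) <= J)%E.
  apply: (@le_trans _ _ (\int[leb]_(s in D)
    ((bump e (s / t) `^ b)%:E * lorentz_density P b G s))%E); last first.
    exact: ge0_subset_integral.
  apply: ge0_le_integral.
  - exact: mI.
  - by move=> s _; rewrite mule_ge0// lee_fin mulr_ge0// invr_ge0 ltW.
  - exact: measurable_cst.
  - exact: measurable_funS mf.
  move=> s; rewrite /D /= in_itv/= => /andP[s1 s2].
  have s0 : 0 < s by apply: lt_le_trans s1; rewrite divr_gt0.
  rewrite /lorentz_density muleA (muleC _ (s^-1)%:E) EFinM [in leLHS](muleC _ (tau^-1)%:E) -muleA.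
  apply: lee_pmul.
  - by rewrite lee_fin invr_ge0 ltW.
  - by rewrite mule_ge0// lee_fin invr_ge0 ltW.
  - by rewrite lee_fin lef_pV2 ?posrE.
  have -> : (k^-1)%:E = ((2 `^ (- e) * 2 `^ (- P))%:E `^ b)%E.
    rewrite poweR_EFin powRM ?powR_ge0// -!powRrM /k invfM !mulNr !powRN.
    by rewrite mulrC.
  have -> : (bump e (s / t) `^ b)%:E = ((bump e (s / t))%:E `^ b)%E by [].
  have tG x : (0 <= (x `^ P)%:E * G x)%E by rewrite mule_ge0 ?lee_fin ?powR_ge0//; exact: G0.
  rewrite -!poweRM ?lee_fin ?mulr_ge0 ?powR_ge0 ?bump_ge0//; last first.
    by rewrite mule_ge0 ?lee_fin ?mulr_ge0 ?powR_ge0 ?bump_ge0//; exact: G0.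
  apply: le_poweR; first exact: ltW.
    by rewrite !mule_ge0 ?lee_fin ?mulr_ge0 ?powR_ge0 ?bump_ge0//; exact: G0.
  rewrite !muleA -!EFinM; apply: lee_pmul.
  - by rewrite lee_fin !mulr_ge0 ?powR_ge0 ?bump_ge0.
  - exact: G0.
  - rewrite lee_fin [leLHS](_ : _ =
      (2 `^ (- e) * bump e (tau / t)) * (2 `^ (- P) * tau `^ P)); last by ring.
    apply: ler_pM; rewrite ?mulr_ge0 ?powR_ge0 ?bump_ge0//.
      apply: bump_half; rewrite ?divr_gt0//.
      by rewrite mulrAC !ler_pM2r ?invr_gt0// s1 s2.
    rewrite (_ : 2 `^ (- P) * _ = (tau / 2) `^ P); last first.
      by rewrite powRM// ?ltW// mulrC -[2^-1]powR_inv1// -powRrM mulN1r.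
    by apply: powR_homo; rewrite // ltW// divr_gt0.
  - exact: niG.
rewrite integral_cst//= /D lebesgue_measure_itv/= lte_fin ifT; last by lra.
rewrite -EFinB (_ : tau - tau / 2 = tau / 2); last by field.
move=> XJ.
have -> : (X = (2 * k)%:E * ((k^-1 * tau^-1)%:E * X * (tau / 2)%:E))%E.
  rewrite (muleC _ X) -muleA -EFinM muleCA -EFinM.
  rewrite (_ : 2 * k * _ = 1) ?mule1//.
  by field; rewrite !gt_eqF.
by apply: lee_wpmul2l => //; rewrite lee_fin mulr_ge0// ltW.
Qed.

(** If m is a real bound for K times the integral, the local estimate makes m^(1/b) admissible in
    [bump_dominated]; raising to the power b gives the claim. The right side is a convolution, for
    the multiplicative group, of the density of [G] with a power of the bump. *)
Lemma bump_dominated_density e P Q : 0 < e -> 0 <= P ->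
  exists2 K : R, 0 < K & forall C G H, 0 < C -> noninc G -> nonneg_fun G ->
    nonneg_fun H -> bump_dominated e P Q C G H -> forall t, 0 < t ->
    (lorentz_density Q b H t <= (C `^ b * K)%:E *
     \int[leb]_(s in itv0y) (((bump e (s / t) `^ b) / t)%:E * lorentz_density P b G s))%E.
Proof.
move=> e0 P0; have [K K0 HK] := lorentz_density_local e0 P0.
exists K => // C G H C0 niG G0 H0 dom t t0.
have mf : measurable_fun itv0y
    (fun s => (bump e (s / t) `^ b)%:E * lorentz_density P b G s)%E.
  apply: emeasurable_funM; last first.
    by apply: measurable_lorentz_density; exact: noninc_measurable.
  apply/measurable_EFinP; apply: (measurableT_comp (@measurable_powR R _)).
  apply: measurable_funTS.
  apply: (measurableT_comp (measurable_bump e)).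
  exact: measurable_funM.
have f0 s : itv0y s -> (0 <= (bump e (s / t) `^ b)%:E * lorentz_density P b G s)%E.
  rewrite inE0 => s0; apply: mule_ge0; first by rewrite lee_fin powR_ge0.
  exact: lorentz_density_ge0.
under eq_integral do rewrite mulrC EFinM -muleA.
have tV0 : 0 <= t^-1 by rewrite invr_ge0 ltW.
rewrite (ge0_integralZl_EFin leb mitv0y f0 mf tV0).
set J := integral _ _ _.
have J0 : (0 <= J)%E by exact: integral_ge0.
rewrite /lorentz_density muleCA (muleC _ (t^-1)%:E).
apply: lee_wpmul2l; first by rewrite lee_fin.
rewrite EFinM -muleA; apply: lee_of_real; first by rewrite powR_gt0.
  by apply: mule_ge0; rewrite // lee_fin ltW.
move=> m m0 KJm.
have mb0 : 0 < m `^ b^-1 by rewrite powR_gt0.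
have /(le_poweR (ltW b0)) : ((t `^ Q)%:E * H t <= (C * m `^ b^-1)%:E)%E.
  apply: dom => // tau tau0; rewrite -poweR_EFin.
  apply: le_poweR_inv => //.
    by rewrite mule_ge0 ?lee_fin ?mulr_ge0 ?bump_ge0 ?powR_ge0//; exact: G0.
  exact: le_trans (HK G niG G0 t tau t0 tau0) KJm.
rewrite poweR_EFin powRM ?(ltW C0) ?(ltW mb0)// -powRrM mulVf ?gt_eqF// powRr1 ?(ltW m0)//.
by apply; rewrite mule_ge0 ?lee_fin ?powR_ge0//; exact: H0.
Qed.

(** Young's inequality in L^1 for that multiplicative convolution: integrate in t, exchange the
    integrals, and bound the mass of the bump uniformly in s. *)
Lemma lorentz_density_dominated e P Q : 0 < e -> 0 <= P ->
  exists2 K : R, 0 < K & forall C G H, 0 < C -> noninc G -> nonneg_fun G ->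
    noninc H -> nonneg_fun H -> bump_dominated e P Q C G H ->
    (\int[leb]_(t in itv0y) lorentz_density Q b H t <=
     (C `^ b * K)%:E * \int[leb]_(s in itv0y) lorentz_density P b G s)%E.
Proof.
move=> e0 P0; have [K K0 HK] := bump_dominated_density Q e0 P0.
have eb0 : 0 < e * b by rewrite mulr_gt0.
have [L L0 HL] := bump_mass eb0.
exists (K * L); first by rewrite mulr_gt0.
move=> C G H C0 niG G0 niH H0 dom.
have {}HK := HK C G H C0 niG G0 H0 dom.
have mG : measurable_fun setT G by exact: noninc_measurable.
have mH : measurable_fun setT H by exact: noninc_measurable.
(* [D] and [V] are cut off outside (0, oo), which makes the integrand nonnegative and measurable on
   the whole plane for Tonelli. *)
pose D s := if 0 < s then lorentz_density P b G s else 0%E.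
have D0 s : (0 <= D s)%E.
  by rewrite /D; case: ifPn => // s0; exact: lorentz_density_ge0.
have mD : measurable_fun setT D.
  apply: measurable_fun_ifT => //; first exact: measurable_fun_ltr.
  exact: measurable_lorentz_density.
pose V t : R := if 0 < t then t^-1 else 0.
have V0 t : 0 <= V t.
  by rewrite /V; case: ifPn => // t0; rewrite invr_ge0 ltW.
have mV : measurable_fun setT V.
  apply: measurable_fun_ifT => //; first exact: measurable_fun_ltr.
  exact: measurable_invr.
pose f t s := ((bump e (s / t) `^ b * V t)%:E * D s)%E.
have f0 t s : (0 <= f t s)%E.
  by apply: mule_ge0 => //; rewrite lee_fin mulr_ge0// powR_ge0.
have mf : measurable_fun setT (fun z : R * R => f z.1 z.2).
  apply: emeasurable_funM; last exact: measurableT_comp mD measurable_snd.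
  apply/measurable_EFinP; apply: measurable_funM; last exact: measurableT_comp mV measurable_fst.
  apply: (measurableT_comp (@measurable_powR R _)).
  apply: (measurableT_comp (measurable_bump e)).
  apply: measurable_funM => //.
  apply: (measurableT_comp (f := fun x : R => x^-1)); first exact: measurable_invr.
  exact: measurable_fst.
have CK0 : 0 <= C `^ b * K by rewrite mulr_ge0 ?powR_ge0// ltW.
apply: (@le_trans _ _ (\int[leb]_(t in itv0y)
    ((C `^ b * K)%:E * \int[leb]_(s in itv0y) f t s))%E).
  apply: ge0_le_integral.
  - exact: mitv0y.
  - by move=> t; rewrite inE0 => t0; exact: lorentz_density_ge0.
  - exact: measurable_lorentz_density.
  - apply: emeasurable_funM; first exact: measurable_cst.
    apply: measurable_funTS.
    exact: (measurable_integral_domain leb (f := f) mitv0y mf f0).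
  move=> t; rewrite inE0 => t0; apply: le_trans (HK t t0) _.
  rewrite le_eqVlt; apply/orP; left; apply/eqP; congr (_ * _)%E.
  apply: eq_integral => s; rewrite inE inE0 => s0.
  by rewrite /f /D /V s0 t0.
rewrite ge0_integralZl_EFin//; last 2 first.
- by move=> t _; apply: integral_ge0 => s _; exact: f0.
- apply: measurable_funTS.
  exact: (measurable_integral_domain leb (f := f) mitv0y mf f0).
rewrite (tonelli_domain leb leb (f := f) mitv0y mitv0y mf f0).
rewrite mulrA (EFinM _ L) -muleA; apply: lee_wpmul2l; first by rewrite lee_fin.
rewrite -ge0_integralZl_EFin//; last 3 first.
- by move=> s; rewrite inE0 => s0; exact: lorentz_density_ge0.
- exact: measurable_lorentz_density.
- exact: ltW.
apply: ge0_le_integral.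
- exact: mitv0y.
- by move=> s _; apply: integral_ge0 => t _; exact: f0.
- apply: measurable_funTS.
  apply: (measurable_integral_domain leb (f := fun s t => f t s) mitv0y) => //.
  apply: (measurableT_comp (f := fun z : R * R => f z.1 z.2)
    (g := fun z : R * R => (z.2, z.1)) mf).
  exact: measurable_fun_pair measurable_snd measurable_fst.
- apply: emeasurable_funM; first exact: measurable_cst.
  exact: measurable_lorentz_density.
move=> s; rewrite inE0 => s0; rewrite /f /D s0.
have mb : measurable_fun itv0y (fun t => (bump (e * b) (t / s) / t)%:E).
  apply: measurable_funTS; apply/measurable_EFinP; apply: measurable_funM.
    apply: (measurableT_comp (measurable_bump _)).
    exact: measurable_funM.
  exact: measurable_invr.
under eq_integral => t.
  rewrite inE inE0 => t0; rewrite /V t0 bump_powR ?(ltW b0)//.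
  rewrite -bumpV ?divr_gt0// invf_div muleC.
  over.
rewrite ge0_integralZl//; last 2 first.
- by move=> t; rewrite inE0 => t0; rewrite lee_fin divr_ge0 ?bump_ge0// ltW.
- exact: lorentz_density_ge0.
by rewrite muleC; apply: lee_wpmul2r; [exact: lorentz_density_ge0|exact: HL].
Qed.

End finite_exponent.

(** For infinite rho the bump is simply bounded by 1. For finite rho the density bound is raised to
    the power 1/b; the ratio p / q comes from the normalizations b / q and b / p. *)
Lemma lorentz_fun_dominated p q e (rho : \bar R) : 0 < p -> 0 < q -> 0 < e ->
  (1 <= rho)%E -> exists2 A : R, 0 < A & forall C G H, 0 < C ->
    noninc G -> nonneg_fun G -> noninc H -> nonneg_fun H ->
    bump_dominated e p^-1 q^-1 C G H ->
    (lorentz_fun q rho H <= (A * C)%:E * lorentz_fun p rho G)%E.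
Proof.
move=> p0 q0 e0; case: rho => [b|_|//]; last first.
  exists 1 => // C G H C0 niG G0 niH H0 dom; rewrite mul1r.
  apply: lee_of_real => //; first by apply: lorentz_fun_ge0.
  move=> m m0 Gm; apply: ub_ereal_sup => _ [t t0 <-]; apply: dom => // tau tau0.
  apply: le_trans Gm; rewrite EFinM -muleA.
  have H1 : ((tau `^ p^-1)%:E * G tau <= lorentz_fun p +oo G)%E.
    by apply: ereal_sup_ubound; exists tau.
  apply: le_trans H1; rewrite -[leRHS]mul1e; apply: lee_wpmul2r.
    by rewrite mule_ge0 ?lee_fin ?powR_ge0//; exact: G0.
  by rewrite lee_fin bump_le1// divr_gt0.
rewrite lee_fin => b1; have b0 : 0 < b by exact: lt_le_trans b1.
have pV0 : 0 <= p^-1 by rewrite invr_ge0 ltW.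
have [K K0 HK] := lorentz_density_dominated b0 q^-1 e0 pV0.
exists ((p / q * K) `^ b^-1); first by rewrite powR_gt0// mulr_gt0// divr_gt0.
move=> C G H C0 niG G0 niH H0 dom; rewrite !lorentz_funE.
have {}HK := HK C G H C0 niG G0 niH H0 dom.
pose IH := (\int[leb]_(t in itv0y) lorentz_density q^-1 b H t)%E.
pose IG := (\int[leb]_(t in itv0y) lorentz_density p^-1 b G t)%E.
rewrite -/IH -/IG in HK *.
have IG0 : (0 <= IG)%E.
  apply: integral_ge0 => t; rewrite inE0 => t0.
  exact: (lorentz_density_ge0 p^-1 b G t0).
have IH0 : (0 <= IH)%E.
  apply: integral_ge0 => t; rewrite inE0 => t0.
  exact: (lorentz_density_ge0 q^-1 b H t0).
have CE : C = (C `^ b) `^ b^-1 by rewrite -powRrM mulfV ?gt_eqF// powRr1// ltW.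
rewrite [in leRHS]CE -powRM ?powR_ge0//; last by rewrite mulr_ge0// ?divr_ge0// ltW.
rewrite -poweR_EFin -poweRM//; last 2 first.
- by rewrite lee_fin !mulr_ge0 ?powR_ge0// ?invr_ge0 ltW.
- by rewrite mule_ge0// lee_fin divr_ge0// ltW.
apply: le_poweR; first by rewrite invr_ge0 ltW.
  by rewrite mule_ge0// lee_fin divr_ge0// ltW.
apply: (@le_trans _ _ ((b / q)%:E * ((C `^ b * K)%:E * IG)))%E.
  by apply: lee_wpmul2l; [rewrite lee_fin divr_ge0// ltW|exact: HK].
rewrite !muleA -!EFinM le_eqVlt; apply/orP; left; apply/eqP; congr (_%:E * _)%E.
by field; rewrite !gt_eqF.
Qed.

End lorentz_functional.

(** * Weak bound, maximum and Fatou property of the Lorentz functional *)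

Section lorentz_functional_order.
Context (R : realType).
Implicit Types (G H : R -> \bar R) (a p t : R) (rho : \bar R).
Local Notation leb := (@lebesgue_measure R).

Local Notation itv0y := (`]0%R, +oo[%classic : set R).
Let mitv0y : @measurable _ R itv0y. Proof. exact: measurable_itv. Qed.

Let inE0 t : itv0y t = (0 < t) :> Prop.
Proof. by rewrite /= in_itv/= andbT. Qed.

Lemma lorentz_density_le P b G H t : 0 <= b -> 0 < t -> nonneg_fun G ->
  (G t <= H t)%E -> (lorentz_density P b G t <= lorentz_density P b H t)%E.
Proof.
move=> b0 t0 G0 GH; apply: lee_wpmul2r; first by rewrite lee_fin invr_ge0 ltW.
apply: le_poweR => //; first by rewrite mule_ge0 ?lee_fin ?powR_ge0//; exact: G0.
by apply: lee_wpmul2l => //; rewrite lee_fin powR_ge0.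
Qed.

(** The embedding into the weak space. For finite rho the local density estimate is taken at tau =
    t, where the bump is 1; under the integral the bump is at most 1. *)
Lemma lorentz_fun_weak p rho : 0 < p -> (1 <= rho)%E ->
  exists2 A : R, 0 < A & forall G, noninc G -> nonneg_fun G ->
    forall t, 0 < t -> ((t `^ p^-1)%:E * G t <= A%:E * lorentz_fun p rho G)%E.
Proof.
move=> p0; case: rho => [b|_|//]; last first.
  exists 1 => // G niG G0 t t0; rewrite mul1e.
  by apply: ereal_sup_ubound; exists t.
rewrite lee_fin => b1; have b0 : 0 < b by exact: lt_le_trans b1.
have pV0 : 0 <= p^-1 by rewrite invr_ge0 ltW.
have [K K0 HK] := lorentz_density_local b0 ltr01 pV0.
exists ((K * (p / b)) `^ b^-1); first by rewrite powR_gt0// mulr_gt0// divr_gt0.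
move=> G niG G0 t t0; rewrite lorentz_funE.
pose IG := (\int[leb]_(s in itv0y) lorentz_density p^-1 b G s)%E.
rewrite -/IG.
have IG0 : (0 <= IG)%E.
  by apply: integral_ge0 => s; rewrite inE0; exact: lorentz_density_ge0.
rewrite -(poweR_EFin (K * (p / b))) -poweRM; last 2 first.
- by rewrite lee_fin mulr_ge0 ?divr_ge0// ltW.
- by rewrite mule_ge0// lee_fin divr_ge0// ltW.
apply: le_poweR_inv => //.
  by rewrite mule_ge0 ?lee_fin ?powR_ge0//; exact: G0.
have := HK G niG G0 t t t0 t0.
rewrite divff ?gt_eqF// {1}/bump !powR1 minxx mul1r => /le_trans; apply.
rewrite muleA -EFinM -mulrA (_ : p / b * _ = 1) ?mulr1; last first.
  by field; rewrite !gt_eqF.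
apply: lee_wpmul2l; first by rewrite lee_fin ltW.
have mD : measurable_fun itv0y (lorentz_density p^-1 b G).
  by apply: measurable_lorentz_density; exact: noninc_measurable.
apply: ge0_le_integral.
- exact: mitv0y.
- move=> s; rewrite inE0 => s0; apply: mule_ge0; first by rewrite lee_fin powR_ge0.
  exact: lorentz_density_ge0.
- apply: emeasurable_funM; last exact: mD.
  apply/measurable_EFinP; apply: (measurableT_comp (@measurable_powR R _)).
  apply: measurable_funTS.
  apply: (measurableT_comp (measurable_bump _)).
  exact: measurable_funM.
- exact: mD.
move=> s; rewrite inE0 => s0; rewrite -[leRHS]mul1e.
apply: lee_wpmul2r; first exact: lorentz_density_ge0.
rewrite lee_fin; apply: (@le_trans _ _ (1 `^ b)); last by rewrite powR1.
apply: powR_homo; rewrite ?bump_ge0 ?(ltW b0)//.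
by apply: bump_le1; rewrite ?divr_gt0.
Qed.

(** At each point the density of the maximum is one of the two densities, hence at most their sum,
    and the sum of the integrals is at most twice the larger one. *)
Lemma lorentz_fun_max p rho : 0 < p -> (1 <= rho)%E ->
  exists2 A : R, 0 < A & forall G H, noninc G -> nonneg_fun G ->
    noninc H -> nonneg_fun H ->
    (lorentz_fun p rho (fun t => maxe (G t) (H t)) <=
     A%:E * maxe (lorentz_fun p rho G) (lorentz_fun p rho H))%E.
Proof.
move=> p0; case: rho => [b|_|//]; last first.
  exists 1 => // G H niG G0 niH H0; rewrite mul1e.
  apply: ub_ereal_sup => _ [t t0 <-]; rewrite maxEle; case: ifPn => _.
    rewrite le_max; apply/orP; right.
    by apply: ereal_sup_ubound; exists t.
  rewrite le_max; apply/orP; left.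
  by apply: ereal_sup_ubound; exists t.
rewrite lee_fin => b1; have b0 : 0 < b by exact: lt_le_trans b1.
exists (2 `^ b^-1); first by rewrite powR_gt0.
move=> G H niG G0 niH H0; rewrite !lorentz_funE.
pose D := fun X => (\int[leb]_(s in itv0y) lorentz_density p^-1 b X s)%E.
rewrite -/(D G) -/(D H) -/(D (fun t => maxe (G t) (H t))).
have D0 X : (0 <= D X)%E.
  by apply: integral_ge0 => s; rewrite inE0; exact: lorentz_density_ge0.
have bp0 : 0 <= b / p by rewrite divr_ge0// ltW.
have cD0 X : (0 <= (b / p)%:E * D X)%E by rewrite mule_ge0// lee_fin.
have mD X : noninc X -> measurable_fun itv0y (lorentz_density p^-1 b X).
  by move=> niX; apply: measurable_lorentz_density; exact: noninc_measurable.
have DGH : (D (fun t => maxe (G t) (H t)) <= D G + D H)%E.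
  rewrite -ge0_integralD; last 5 first.
  - exact: mitv0y.
  - by move=> s; rewrite inE0; exact: lorentz_density_ge0.
  - exact: mD.
  - by move=> s; rewrite inE0; exact: lorentz_density_ge0.
  - exact: mD.
  apply: ge0_le_integral.
  - exact: mitv0y.
  - by move=> s; rewrite inE0; exact: lorentz_density_ge0.
  - apply: mD => s t st; rewrite ge_max !le_max.
    by rewrite niG//= niH// orbT.
  - by apply: emeasurable_funD; exact: mD.
  move=> s; rewrite inE0 => s0; rewrite {1}/lorentz_density maxEle; case: ifPn => _.
    by rewrite -[leLHS]add0e; apply: leeD => //; exact: lorentz_density_ge0.
  by rewrite -[leLHS]adde0; apply: leeD => //; exact: lorentz_density_ge0.
have step X Y : (D X <= D Y)%E -> (D X + D Y <= 2%:E * D Y)%E.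
  by move=> XY; rewrite mule_natl mule2n; apply: leeD.
have bV0 : 0 <= b^-1 by rewrite invr_ge0 ltW.
have main X : (D (fun t => maxe (G t) (H t)) <= 2%:E * D X)%E ->
    ((((b / p)%:E * D (fun t => maxe (G t) (H t))) `^ b^-1) <=
    (2 `^ b^-1)%:E * (((b / p)%:E * D X) `^ b^-1))%E.
  move=> DX; rewrite -poweR_EFin -poweRM//.
  apply: le_poweR => //; rewrite muleCA.
  by apply: lee_wpmul2l.
have [DD|/ltW DD] := leP (D G) (D H).
  apply: le_trans (main H _) _.
    by apply: le_trans DGH _; exact: step.
  by apply: lee_wpmul2l; rewrite ?lee_fin ?powR_ge0// le_max lexx orbT.
apply: le_trans (main G _) _.
  by apply: le_trans DGH _; rewrite addeC; exact: step.
by apply: lee_wpmul2l; rewrite ?lee_fin ?powR_ge0// le_max lexx.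
Qed.

(** The condition linking [H] to the sequence says that H(t) is at most the supremum of the
    [G_ n t], in a form applicable to any upper bound. For finite rho the densities increase with n
    and monotone convergence applies. *)
Lemma lorentz_fun_fatou p rho (G_ : nat -> R -> \bar R) H M : 0 < p ->
  (1 <= rho)%E -> (forall n, noninc (G_ n)) -> (forall n, nonneg_fun (G_ n)) ->
  (forall t, {homo G_ ^~ t : m n / (m <= n)%N >-> (m <= n)%E}) ->
  noninc H -> nonneg_fun H ->
  (forall t y, 0 < t -> (forall n, (G_ n t <= y)%E) -> (H t <= y)%E) ->
  (0 <= M)%E -> (forall n, lorentz_fun p rho (G_ n) <= M)%E ->
  (lorentz_fun p rho H <= M)%E.
Proof.
move=> p0 rho1 niG G0 ndG niH H0 HG M0 GM.
have cancel t x y P : 0 < t -> ((t `^ P)%:E * x <= y)%E <-> (x <= (t `^ (- P))%:E * y)%E.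
  move=> t0; have tt : t `^ P * t `^ (- P) = 1 by rewrite powRN divff// gt_eqF// powR_gt0.
  split=> xy.
    rewrite -[x]mul1e -tt mulrC EFinM -muleA.
    by apply: lee_wpmul2l => //; rewrite lee_fin powR_ge0.
  rewrite -[y]mul1e -tt EFinM -muleA.
  by apply: lee_wpmul2l => //; rewrite lee_fin powR_ge0.
case: rho rho1 GM => [b|_|//]; last first.
  move=> GM; apply: ub_ereal_sup => _ [t t0 <-].
  apply/cancel => //; apply: HG => // n; apply/cancel => //.
  by apply: le_trans (GM n); apply: ereal_sup_ubound; exists t.
rewrite lee_fin => b1 GM; have b0 : 0 < b by exact: lt_le_trans b1.
have bV0 : 0 <= b^-1 by rewrite invr_ge0 ltW.
have bp0 : 0 <= b / p by rewrite divr_ge0// ltW.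
pose D n := lorentz_density p^-1 b (G_ n).
have D0 n t : 0 < t -> (0 <= D n t)%E by exact: lorentz_density_ge0.
have mD n : measurable_fun itv0y (D n).
  by apply: measurable_lorentz_density; exact: noninc_measurable.
have ndD t : 0 < t -> {homo D ^~ t : m n / (m <= n)%N >-> (m <= n)%E}.
  by move=> t0 m n mn; apply: lorentz_density_le; rewrite ?(ltW b0)//; exact: ndG.
(* Inverting the formula for the density at its limit [L] gives a common upper bound for the
   [G_ n t], which then passes to [H t]. *)
have HD t : 0 < t -> (lorentz_density p^-1 b H t <= limn (D ^~ t))%E.
  move=> t0; set L := limn _.
  have DL n : (D n t <= L)%E.
    rewrite /L (cvg_lim _ (ereal_nondecreasing_cvgn (ndD t t0)))//.
    by apply: ereal_sup_ubound; exists n.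
  have L0 : (0 <= L)%E by apply: le_trans (DL 0%N); exact: D0.
  have tL0 : (0 <= t%:E * L)%E by rewrite mule_ge0// lee_fin ltW.
  have : (H t <= (t `^ (- p^-1))%:E * (t%:E * L) `^ b^-1)%E.
    apply: HG => // n; apply/cancel => //; apply: le_poweR_inv => //.
      by rewrite mule_ge0 ?lee_fin ?powR_ge0//; exact: G0.
    rewrite -[leLHS]mule1 -[1%E]/(1%:E) -(@mulVf _ t) ?gt_eqF// EFinM muleA muleC.
    by apply: lee_wpmul2l; [rewrite lee_fin ltW|exact: DL].
  move/cancel => /(_ t0) /(le_poweR (ltW b0)) HL.
  have {}HL : (((t `^ p^-1)%:E * H t) `^ b <= t%:E * L)%E.
    rewrite -[leRHS]poweRe1// -(@mulVf _ b) ?gt_eqF// poweRrM.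
    by apply: HL; rewrite mule_ge0 ?lee_fin ?powR_ge0//; exact: H0.
  apply: (@le_trans _ _ ((t%:E * L) * (t^-1)%:E))%E.
    by apply: lee_wpmul2r => //; rewrite lee_fin invr_ge0 ltW.
  by rewrite muleC muleA -EFinM mulVf ?gt_eqF// mul1e.
have intD n : ((b / p)%:E * \int[leb]_(t in itv0y) D n t <= M `^ b)%E.
  rewrite -[b in leRHS]invrK; apply: le_poweR_inv.
  - by rewrite invr_gt0.
  - by rewrite mule_ge0 ?lee_fin//; apply: integral_ge0 => t; rewrite inE0; exact: D0.
  - exact: GM n.
rewrite lorentz_funE.
have IH0 : (0 <= \int[leb]_(t in itv0y) lorentz_density p^-1 b H t)%E.
  by apply: integral_ge0 => t; rewrite inE0; exact: lorentz_density_ge0.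
rewrite -[leRHS]poweRe1// -(@mulfV _ b) ?gt_eqF// poweRrM.
apply: le_poweR => //; first by rewrite mule_ge0.
have MM : ((p / b)%:E * ((b / p)%:E * \int[leb]_(t in itv0y) lorentz_density p^-1 b H t)
   <= (p / b)%:E * M `^ b)%E.
  rewrite muleA -EFinM (_ : p / b * _ = 1) ?mul1e; last by field; rewrite !gt_eqF.
  apply: (@le_trans _ _ (\int[leb]_(t in itv0y) limn (D ^~ t))%E).
    apply: ge0_le_integral.
    - exact: mitv0y.
    - by move=> t; rewrite inE0; exact: lorentz_density_ge0.
    - by apply: measurable_lorentz_density; exact: noninc_measurable.
    - apply: (@emeasurable_fun_cvg _ _ R itv0y D (fun t => limn (D ^~ t))) => [|t].
        exact: mD.
      rewrite inE0 => t0.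
      exact: ereal_nondecreasing_is_cvgn (ndD t t0).
    - by move=> t; rewrite inE0; exact: HD.
  rewrite (monotone_convergence leb mitv0y mD); last 2 first.
  - by move=> n t; rewrite inE0; exact: D0.
  - by move=> t; rewrite inE0; exact: ndD.
  apply: lime_le.
    apply: ereal_nondecreasing_is_cvgn => m n mn; apply: ge0_le_integral.
    - exact: mitv0y.
    - by move=> t; rewrite inE0; exact: D0.
    - exact: mD.
    - exact: mD.
    - by move=> t; rewrite inE0 => t0; exact: ndD.
  apply: nearW => n.
  rewrite -[leLHS]mul1e -[1%E]/(1%:E) (_ : 1 = p / b * (b / p)); last by field; rewrite !gt_eqF.
  rewrite EFinM -muleA; apply: lee_wpmul2l; last exact: intD.
  by rewrite lee_fin divr_ge0// ltW.
rewrite -[leLHS]mul1e -[leRHS]mul1e -[1%E]/(1%:E).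
rewrite (_ : 1 = b / p * (p / b)); last by field; rewrite !gt_eqF.
by rewrite EFinM -!muleA; apply: lee_wpmul2l; [rewrite lee_fin|exact: MM].
Qed.

End lorentz_functional_order.

(** * Rearrangements on a sigma-finite measure space *)

Section rearrangement.
Context d (T : measurableType d) (R : realType).
Variable mu : {sigma_finite_measure set T -> \bar R}.
Implicit Types (G : T -> \bar R) (s t : R).

(** Extended real values are allowed because potentials of nonnegative functions may be infinite. *)
Definition dfun G s : \bar R := mu [set x | s%:E < G x]%E.

Definition rearr G t : \bar R :=
  ereal_inf [set s%:E | s in [set s : R | 0 <= s /\ (dfun G s <= t%:E)%E]].

Lemma measurable_superlevel G s : measurable_fun setT G ->
  measurable [set x | s%:E < G x]%E.
Proof.
by move=> mG; rewrite -[X in measurable X]setTI; exact: emeasurable_fun_o_infty.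
Qed.

Lemma rearr_ge0 G : nonneg_fun (rearr G).
Proof. by move=> t; apply: le_ereal_inf_tmp => _ [s [s0 _] <-]; rewrite lee_fin. Qed.

Lemma rearr_noninc G : noninc (rearr G).
Proof.
move=> s t st; apply: ereal_inf_le_tmp => _ [r [r0 Gr] <-]; exists r => //; split=> //.
by apply: le_trans Gr _; rewrite lee_fin.
Qed.

Lemma dfun_noninc G s t : measurable_fun setT G -> s <= t ->
  (dfun G t <= dfun G s)%E.
Proof.
move=> mG st; apply: le_measure; rewrite ?inE; try exact: measurable_superlevel.
by move=> x /=; apply: le_lt_trans; rewrite lee_fin.
Qed.

Lemma rearr_gt G s t : 0 <= s -> (s%:E < rearr G t)%E -> (t%:E < dfun G s)%E.
Proof.
move=> s0; rewrite !ltNge; apply: contra => Gs.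
by apply: ereal_inf_lbound; exists s.
Qed.

Lemma rearr_ge G s t : measurable_fun setT G -> (t%:E < dfun G s)%E ->
  (s%:E <= rearr G t)%E.
Proof.
move=> mG tGs; apply: le_ereal_inf_tmp => _ [r [r0 Gr] <-]; rewrite lee_fin leNgt.
apply/negP => rs; have := dfun_noninc mG (ltW rs).
by rewrite leNgt (le_lt_trans Gr tGs).
Qed.

Lemma lee_of_lt_real (x y : \bar R) : (0 <= y)%E ->
  (forall s, 0 <= s -> (s%:E < x)%E -> (s%:E <= y)%E) -> (x <= y)%E.
Proof.
move=> y0 H; rewrite leNgt; apply/negP => yx.
case: y y0 H yx => [r|_ _|//]; last by rewrite ltNge leey.
rewrite lee_fin => r0 H; case: x H => [z H|H _|//].
  rewrite lte_fin => rz; have /H : 0 <= (r + z) / 2 by lra.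
  by rewrite lte_fin lee_fin => /(_ ltac:(lra)); lra.
have /H/(_ (ltry _)) : 0 <= r + 1 by lra.
by rewrite lee_fin; lra.
Qed.

(** Together with [rearr_ge] this reduces inequalities between rearrangements to inequalities
    between measures of superlevel sets. *)
Lemma rearr_le (G : T -> \bar R) t (y : \bar R) : (0 <= y)%E ->
  (forall s, 0 <= s -> (t%:E < dfun G s)%E -> (s%:E <= y)%E) ->
  (rearr G t <= y)%E.
Proof.
by move=> y0 H; apply: lee_of_lt_real => // s s0 /(rearr_gt s0); exact: H.
Qed.

Lemma le_measure_ae (A B : set T) : measurable A -> measurable B ->
  {ae mu, forall x, A x -> B x} -> (mu A <= mu B)%E.
Proof.
move=> mA mB [N [mN N0 sub]].
apply: (@le_trans _ _ (mu (B `|` N))).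
  apply: le_measure; rewrite ?inE//; first exact: measurableU.
  move=> x Ax; have [Bx|nBx] := pselect (B x); [by left|right].
  by apply: sub => /= /(_ Ax).
have mN0 : mu N = 0 := N0.
by rewrite -[leRHS]adde0 -[X in (_ <= _ + X)%E]mN0; exact: measureU2.
Qed.

Lemma rearr_le_ae G1 G2 t : measurable_fun setT G1 -> measurable_fun setT G2 ->
  {ae mu, forall x, (G1 x <= G2 x)%E} -> (rearr G1 t <= rearr G2 t)%E.
Proof.
move=> mG1 mG2 GG; apply: rearr_le => [|s s0 tG]; first exact: rearr_ge0.
apply: rearr_ge => //; apply: lt_le_trans tG _; apply: le_measure_ae.
- exact: measurable_superlevel.
- exact: measurable_superlevel.
- by move: GG; apply: filterS => x GG /= /lt_le_trans; apply.
Qed.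

Lemma rearr_scale G c t : 0 < c -> measurable_fun setT G ->
  (rearr (fun x => c%:E * G x) t <= c%:E * rearr G t)%E.
Proof.
move=> c0 mG; apply: rearr_le => [|s s0 tG].
  by rewrite mule_ge0 ?lee_fin ?(ltW c0)//; exact: rearr_ge0.
have : ((s / c)%:E <= rearr G t)%E.
  apply: rearr_ge => //; move: tG; rewrite /dfun.
  rewrite (_ : [set x | _] = [set x | ((s / c)%:E < G x)%E])//.
  apply/seteqP; split => x /=; case: (G x) => [r| |] //=.
  - by rewrite -EFinM !lte_fin ltr_pdivrMr// mulrC.
  - by rewrite ltry.
  - by rewrite gt0_muleNy// lte_fin.
  - by rewrite -EFinM !lte_fin ltr_pdivrMr// mulrC.
  - by move=> _; rewrite gt0_muley ?lte_fin// ltry.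
rewrite (_ : s%:E = c%:E * (s / c)%:E)%E; last first.
  by rewrite -EFinM mulrCA divff ?mulr1// gt_eqF.
by apply: lee_wpmul2l; rewrite lee_fin ltW.
Qed.

(** If the sum exceeds s, one of the terms exceeds s / 2. A superlevel set of measure above t thus
    forces, for one of the two functions, a superlevel set of measure above t / 2. *)
Lemma rearr_add G1 G2 t : measurable_fun setT G1 -> measurable_fun setT G2 ->
  (forall x, 0 <= G1 x)%E -> (forall x, 0 <= G2 x)%E ->
  (rearr (fun x => G1 x + G2 x) t <=
   2%:E * maxe (rearr G1 (t / 2)%R) (rearr G2 (t / 2)%R))%E.
Proof.
move=> mG1 mG2 G10 G20; apply: rearr_le => [|s s0 tG].
  by rewrite mule_ge0// le_max rearr_ge0.
rewrite (_ : s%:E = 2%:E * (s / 2)%:E)%E; last by rewrite -EFinM; congr EFin; field.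
apply: lee_wpmul2l => //.
have sub : (dfun (fun x => G1 x + G2 x)%E s <= dfun G1 (s / 2) + dfun G2 (s / 2))%E.
  have m1 := measurable_superlevel (s / 2) mG1.
  have m2 := measurable_superlevel (s / 2) mG2.
  apply: le_trans (measureU2 mu m1 m2); apply: le_measure; rewrite ?inE.
  - by apply: measurable_superlevel; exact: emeasurable_funD.
  - exact: measurableU.
  move=> x /= sG; have [G1s|G1s] := ltP (s / 2)%:E (G1 x); [by left|right].
  rewrite /= ltNge; apply/negP => G2s; move: sG; apply/negP; rewrite -leNgt.
  by apply: le_trans (leeD G1s G2s) _; rewrite -EFinD lee_fin; lra.
have := lt_le_trans tG sub.
have [t1 _|t1] := ltP (t / 2)%:E (dfun G1 (s / 2)).
  by rewrite le_max rearr_ge.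
have [t2 _|t2] := ltP (t / 2)%:E (dfun G2 (s / 2)).
  by rewrite le_max orbC rearr_ge.
rewrite ltNge => /negP[]; apply: le_trans (leeD t1 t2) _.
by rewrite -EFinD lee_fin; lra.
Qed.

(** A superlevel set of [U] is covered by the increasing superlevel sets of the [U_ n]; continuity
    of the measure from below finds one n for which the measure already exceeds t. *)
Lemma rearr_sup (U_ : nat -> T -> \bar R) (U : T -> \bar R) t (y : \bar R) :
  (forall n, measurable_fun setT (U_ n)) ->
  (forall x, {homo U_ ^~ x : m n / (m <= n)%N >-> (m <= n)%E}) ->
  (forall x s, (s%:E < U x)%E -> exists n, (s%:E < U_ n x)%E) ->
  measurable_fun setT U ->
  (0 <= y)%E -> (forall n, (rearr (U_ n) t <= y)%E) -> (rearr U t <= y)%E.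
Proof.
move=> mU_ ndU UU mU y0 Uy; apply: rearr_le => // s s0 tU.
pose A n := [set x | (s%:E < U_ n x)%E].
have mA n : measurable (A n) by exact: measurable_superlevel.
have ndA : nondecreasing_seq A.
  by move=> m n mn; apply/subsetPset => x /= /lt_le_trans; apply; exact: ndU.
have : (t%:E < mu (\bigcup_n A n))%E.
  apply: lt_le_trans tU _; apply: le_measure; rewrite ?inE.
  - exact: measurable_superlevel.
  - exact: bigcupT_measurable.
  - by move=> x /= /UU[n sn]; exists n.
have ndmu : nondecreasing_seq (mu \o A).
  by move=> m n mn; apply: le_measure; rewrite ?inE//; exact/subsetPset/ndA.
rewrite -(cvg_lim _ (nondecreasing_cvg_mu mA (bigcupT_measurable A mA) ndA))//.
rewrite (cvg_lim _ (ereal_nondecreasing_cvgn ndmu))//.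
move=> /ereal_sup_gt[_ [n _ <-]] tn.
by apply: le_trans (Uy n); exact: rearr_ge.
Qed.

(** Restricted bounds apply to sets of finite measure only, while a superlevel set may have infinite
    measure. Intersecting with an exhaustion by sets of finite measure provides the replacement. *)
Lemma finite_measure_subset (A : set T) t : measurable A -> (t%:E < mu A)%E ->
  exists E, [/\ measurable E, E `<=` A, (t%:E < mu E)%E & (mu E < +oo)%E].
Proof.
move=> mA tA; have /sigma_finiteP[F [FT ndF Ffin]] := sigma_finiteT mu.
pose B n := A `&` F n.
have mB n : measurable (B n) by apply: measurableI => //; exact: (Ffin n).1.
have ndB : nondecreasing_seq B.
  by move=> m n mn; apply/subsetPset; apply: setIS; exact/subsetPset/ndF.
have AB : A = \bigcup_n B n by rewrite -setI_bigcupr -FT setIT.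
have ndmu : nondecreasing_seq (mu \o B).
  by move=> m n mn; apply: le_measure; rewrite ?inE//; exact/subsetPset/ndB.
move: tA; rewrite {1}AB.
rewrite -(cvg_lim _ (nondecreasing_cvg_mu mB (bigcupT_measurable B mB) ndB))//.
rewrite (cvg_lim _ (ereal_nondecreasing_cvgn ndmu))//.
move=> /ereal_sup_gt[_ [n _ <-]] tn; exists (B n); split => //.
  exact: subIsetl.
apply: le_lt_trans (Ffin n).2; apply: le_measure; rewrite ?inE//.
  exact: (Ffin n).1.
exact: subIsetr.
Qed.

End rearrangement.

(** * Interpolation of restricted bounds *)

Section bump_inverse.
Context (R : realType).
Implicit Types x y P e : R.

(* [bump_inv e P] is the inverse of [x |-> bump e x * x `^ P]. *)
Definition bump_inv e P y : R :=
  if y < 1 then y `^ (P + e)^-1 else y `^ (P - e)^-1.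

Lemma powR_lt x y P : 0 < P -> 0 <= x -> x < y -> x `^ P < y `^ P.
Proof.
by move=> P0 x0 xy; rewrite gt0_ltr_powR ?nnegrE// (le_trans x0)// ltW.
Qed.

(** The product is the minimum of x^(P + e) and x^(P - e), the first being the smaller one for x <=
    1. It serves to read a bound on a rearrangement as a bound on the measure of superlevel sets. *)
Lemma bump_inv_lt e P x y : 0 < e < P -> 0 < y -> bump_inv e P y < x ->
  y < bump e x * x `^ P.
Proof.
move=> /andP[e0 eP] y0 yx.
have Pe0 : 0 < P + e by rewrite addr_gt0// (lt_trans e0).
have Pe1 : 0 < P - e by rewrite subr_gt0.
have x0 : 0 < x.
  apply: le_lt_trans yx; rewrite /bump_inv; case: ifPn => _; exact: powR_ge0.
have up c : 0 < c -> y `^ c^-1 < x -> y < x `^ c.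
  move=> c0 /(powR_lt c0 (powR_ge0 _ _)).
  by rewrite -powRrM mulVf ?gt_eqF// powRr1// ltW.
have -> : bump e x * x `^ P = Num.min (x `^ (P + e)) (x `^ (P - e)).
  rewrite /bump; case: (leP (x `^ e)) => h; rewrite -powR_gt0D//.
    rewrite addrC [RHS]min_l// addrC (addrC P) !powR_gt0D//.
    by rewrite ler_wpM2r ?powR_ge0.
  rewrite (addrC (- e)) [RHS]min_r// !powR_gt0D//.
  by rewrite ler_wpM2l ?powR_ge0// ltW.
move: yx; rewrite /bump_inv lt_min; case: ifPn => [y1|].
  move=> /(up _ Pe0) yx; rewrite yx/=.
  have [x1|/ltW x1] := leP x 1.
    apply: lt_le_trans yx _; rewrite ger_powR ?x0//; lra.
  apply: lt_le_trans y1 _; rewrite -[leLHS](powRr0 x) ler_powR// ltW//.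
rewrite -leNgt => y1 yx; have := up _ Pe1 yx => yx'; rewrite yx' andbT.
apply: lt_le_trans yx' _; rewrite ler_powR//; last lra.
apply: le_trans (ltW yx); apply: (@le_trans _ _ (1 `^ (P - e)^-1)).
  by rewrite powR1.
by apply: powR_homo => //; rewrite invr_ge0 ltW.
Qed.

(** The exponents P + 2e and P - 2e overshoot the P + e and P - e of [bump_inv], and the excess is a
    power decay away from y = 1. Its rate is e / (P + e) below 1 and e / (P - e) above; the smaller
    rate serves both sides. This decay makes the integral over levels converge. *)
Lemma bump_inv_powR e P y : 0 < e -> 2 * e < P -> 0 < y ->
  (if y < 1 then bump_inv e P y `^ (P + 2 * e) else bump_inv e P y `^ (P - 2 * e))
  <= y * bump (e / (P + e)) y.
Proof.
move=> e0 eP y0; rewrite /bump_inv.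
have P0 : 0 < P by lra.
have Pe0 : 0 < P + e by lra.
have Pe1 : 0 < P - e by lra.
have d0 : 0 <= e / (P + e) by rewrite divr_ge0// ltW.
have yy : y = y `^ 1 by rewrite powRr1// ltW.
case: (ltP y 1) => y1; rewrite -powRrM.
  rewrite {2}yy /bump min_l; last first.
    by rewrite ger_powR ?y0 ?(ltW y1)//; lra.
  rewrite -powR_gt0D// (_ : (P + e)^-1 * _ = 1 + e / (P + e))//.
  by field; rewrite gt_eqF.
rewrite {2}yy /bump min_r; last first.
  by rewrite ler_powR//; lra.
rewrite -powR_gt0D// ler_powR//.
rewrite (_ : (P - e)^-1 * _ = 1 - e / (P - e)); last by field; rewrite gt_eqF.
rewrite lerD2l lerN2 ler_pM2l// lef_pV2 ?posrE//; lra.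
Qed.

End bump_inverse.

(** * Layer-cake formula *)

Section layer_cake.
Context d (T : measurableType d) (R : realType).
Variable mu : {sigma_finite_measure set T -> \bar R}.
Local Notation leb := (@lebesgue_measure R).

(** g(y), possibly infinite, is the length of the set of s > 0 with s < g(y); then Tonelli. *)
Lemma layer_cake (w g : T -> \bar R) :
  measurable_fun setT w -> measurable_fun setT g ->
  (forall y, 0 <= w y)%E -> (forall y, 0 <= g y)%E ->
  (\int[mu]_y (w y * g y) = \int[leb]_(s in `]0%R, +oo[)
     \int[mu]_(y in [set y | s%:E < g y]) w y)%E.
Proof.
move=> mw mg w0 g0.
have mI : @measurable _ R `]0%R, +oo[%classic by exact: measurable_itv.
pose f (y : T) (s : R) : \bar R := if (s%:E < g y)%E then w y else 0%E.
have f0 y s : (0 <= f y s)%E by rewrite /f; case: ifPn.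
have mf : measurable_fun setT (fun z : T * R => f z.1 z.2).
  apply: measurable_fun_ifT => //.
    apply: measurable_fun_lte; first exact/measurable_EFinP.
    exact: measurableT_comp mg measurable_fst.
  exact: measurableT_comp mw measurable_fst.
transitivity (\int[mu]_(y in setT) \int[leb]_(s in `]0%R, +oo[) f y s)%E.
  apply: eq_integral => y _.
  have -> : (\int[leb]_(s in `]0%R, +oo[) f y s =
      \int[leb]_(s in `]0%R, +oo[ `&` [set s | s%:E < g y]) w y)%E.
    rewrite integral_mkcondr; apply: eq_integral => s _.
    by rewrite patchE mem_setE.
  case gE : (g y) (g0 y) => [r| |] // r0.
    have -> : `]0%R, +oo[%classic `&` [set s | (s%:E < r%:E)%E] = `]0%R, r[%classic.
      apply/seteqP; split=> s /=; rewrite !in_itv/= andbT lte_fin.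
        by case=> -> ->.
      by case/andP.
    rewrite integral_cst//=.
    congr (_ * _)%E; rewrite lebesgue_measure_itv/= lte_fin; case: ifPn => [_|].
      by rewrite oppr0 adde0.
    by rewrite -leNgt => r0'; congr EFin; apply/eqP; rewrite eq_le r0' -lee_fin r0.
  have -> : `]0%R, +oo[%classic `&` [set s : R | (s%:E < +oo)%E] =
      `]0%R, +oo[%classic :> set R.
    by apply/seteqP; split=> s /=; [case|rewrite ltry].
  by rewrite integral_cst//= lebesgue_measure_itv/= ltry.
rewrite (tonelli_domain mu leb (f := f) measurableT mI mf f0).
apply: eq_integral => s _; rewrite [RHS]integral_mkcond; apply: eq_integral => y _.
by rewrite patchE mem_setE.
Qed.

Lemma measurable_layer (w g : T -> \bar R) D :
  measurable_fun setT w -> measurable_fun setT g -> (forall y, 0 <= w y)%E ->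
  measurable_fun D (fun s : R => \int[mu]_(y in [set y | s%:E < g y]) w y)%E.
Proof.
move=> mw mg w0; apply: measurable_funTS.
pose f (s : R) (y : T) : \bar R := if (s%:E < g y)%E then w y else 0%E.
have -> : (fun s : R => \int[mu]_(y in [set y | s%:E < g y]) w y)%E =
    (fun s => \int[mu]_(y in setT) f s y)%E.
  apply/funext => s; rewrite integral_mkcond; apply: eq_integral => y _.
  by rewrite patchE mem_setE.
apply: measurable_integral_domain.
- exact: measurableT.
- apply: measurable_fun_ifT => //.
    apply: measurable_fun_lte; first exact/measurable_EFinP.
    exact: measurableT_comp mg measurable_snd.
  exact: measurableT_comp mw measurable_snd.
- by move=> s y; rewrite /f; case: ifPn.
Qed.

End layer_cake.

Section restricted_interpolation.
Context d (T : measurableType d) (R : realType).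
Variable mu : {sigma_finite_measure set T -> \bar R}.
Local Notation leb := (@lebesgue_measure R).
Variable K : T -> T -> \bar R.
Hypothesis mK : measurable_fun setT (fun z : T * T => K z.1 z.2).
Hypothesis K0 : forall x y, (0 <= K x y)%E.
Implicit Types (g : T -> \bar R) (P Q e C : R).

Definition kernel_op g x : \bar R := \int[mu]_y (K x y * g y).

Definition restricted_bound (a b C : R) := forall E F (e f : R),
  measurable E -> measurable F -> 0 < e -> 0 < f ->
  (mu E <= e%:E)%E -> (mu F <= f%:E)%E ->
  (\int[mu]_(x in E) \int[mu]_(y in F) K x y <= (C * (e `^ a * f `^ b))%:E)%E.

Lemma measurable_kernel_integrand g : measurable_fun setT g ->
  measurable_fun setT (fun z : T * T => (K z.1 z.2 * g z.2)%E).
Proof.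
move=> mg; apply: emeasurable_funM => //.
exact: measurableT_comp mg measurable_snd.
Qed.

Lemma measurable_kernel_op g : measurable_fun setT g ->
  (forall y, 0 <= g y)%E -> measurable_fun setT (kernel_op g).
Proof.
move=> mg g0; apply: (measurable_integral_domain mu (f := fun x y => (K x y * g y)%E)).
- exact: measurableT.
- exact: measurable_kernel_integrand.
- by move=> x y; exact: mule_ge0.
Qed.

Lemma kernel_swap E F : measurable E -> measurable F ->
  (\int[mu]_(x in E) \int[mu]_(y in F) K x y =
   \int[mu]_(y in F) \int[mu]_(x in E) K x y)%E.
Proof. by move=> mE mF; rewrite (tonelli_domain mu mu (f := K) mE mF mK K0). Qed.

Lemma measurable_kernel_marginal E : measurable E ->
  measurable_fun setT (fun y => \int[mu]_(x in E) K x y)%E.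
Proof.
move=> mE; apply: (measurable_integral_domain mu (f := fun y x => K x y) mE) => //.
apply: (measurableT_comp (f := fun z : T * T => K z.1 z.2)
  (g := fun z : T * T => (z.2, z.1)) mK).
exact: measurable_fun_pair measurable_snd measurable_fst.
Qed.

Lemma kernel_marginal_ge0 E y : (0 <= \int[mu]_(x in E) K x y)%E.
Proof. exact: integral_ge0. Qed.

(** After exchanging the integrals the superlevel set is the outer domain, as [measurable_layer]
    expects. *)
Lemma measurable_kernel_layer g E D : measurable_fun setT g -> measurable E ->
  measurable_fun D (fun s : R =>
    \int[mu]_(x in E) \int[mu]_(y in [set y | s%:E < g y]) K x y)%E.
Proof.
move=> mg mE; rewrite (_ : (fun s : R => _) = fun s : R =>
    (\int[mu]_(y in [set y | s%:E < g y]) \int[mu]_(x in E) K x y)%E); last first.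
  by apply/funext => s; rewrite kernel_swap//; exact: measurable_superlevel.
apply: measurable_layer => //; first exact: measurable_kernel_marginal.
exact: kernel_marginal_ge0.
Qed.

Lemma kernel_op_layer g E : measurable_fun setT g -> (forall y, 0 <= g y)%E ->
  measurable E ->
  (\int[mu]_(x in E) kernel_op g x = \int[leb]_(s in `]0%R, +oo[)
    \int[mu]_(x in E) \int[mu]_(y in [set y | s%:E < g y]) K x y)%E.
Proof.
move=> mg g0 mE; rewrite /kernel_op.
have Kg0 x y : (0 <= K x y * g y)%E by exact: mule_ge0.
have mKg := measurable_kernel_integrand mg.
rewrite (tonelli_domain mu mu (f := fun x y => (K x y * g y)%E) mE measurableT mKg Kg0).
have mw := measurable_kernel_marginal mE; have w0 := kernel_marginal_ge0 E.
have mKy y D : measurable_fun D (fun x => K x y).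
  by apply: measurable_funTS; exact: measurableT_comp mK (measurable_pair2 y).
transitivity (\int[mu]_y ((\int[mu]_(x in E) K x y) * g y))%E.
  by apply: eq_integral => y _; rewrite ge0_integralZr.
rewrite (layer_cake mu mw mg w0 g0); apply: eq_integral => s _.
by rewrite kernel_swap//; exact: measurable_superlevel.
Qed.

(** If the potential exceeds s0 on a set of measure above t, pick E of finite measure eps > t in
    that set. Then s0 eps is at most the integral of the potential over E, which is an integral over
    levels s of the form on E and {g > s}. Each level is estimated by one of the two restricted
    bounds, and the sum over levels is a bump mass. *)
Lemma restricted_interpolation P Q e : 0 < e -> 2 * e < P -> 2 * e < Q ->
  exists2 A : R, 0 < A & forall C g, 0 < C ->
    restricted_bound (1 - (Q + 2 * e)) (P + 2 * e) C ->
    restricted_bound (1 - (Q - 2 * e)) (P - 2 * e) C ->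
    measurable_fun setT g -> (forall y, 0 <= g y)%E ->
    bump_dominated e P Q (A * C) (rearr mu g) (rearr mu (kernel_op g)).
Proof.
move=> e0 eP eQ; have P0 : 0 < P by lra.
have [eQ1 eQ2 eP1] : [/\ - Q <= 2 * e, 2 * e <= Q & 0 < P + 2 * e] by split; lra.
have [eQ3 eQ4 eP2] : [/\ - Q <= - (2 * e), - (2 * e) <= Q & 0 < P - 2 * e].
  by split; lra.
have d0 : 0 < e / (P + e) by rewrite divr_gt0//; lra.
have [L L0 HL] := bump_mass d0.
exists L => // C g C0 bnd1 bnd2 mg g0 t m t0 m0 Hm.
(* The critical level: the hypothesis will give |{g > s}| <= t X(s), and X(s) changes regime at s =
   m'. *)
pose m' := m * t `^ (- P).
have m'0 : 0 < m' by rewrite mulr_gt0// powR_gt0.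
pose X s := bump_inv e P (m' / s).
have X0 s : 0 < s -> 0 < X s.
  move=> s0; have y0 : 0 < m' / s by rewrite divr_gt0.
  by rewrite /X /bump_inv; case: ifPn => _; rewrite powR_gt0.
(* Otherwise |{g > s}| exceeds some tau > t X(s), and the hypothesis at this tau is violated; the
   slack [r] supplies the strict inequality. *)
have DX s : 0 < s -> (dfun mu g s <= (t * X s)%:E)%E.
  move=> s0; apply/lee_addgt0Pr => r r0; rewrite leNgt -EFinD; apply/negP => tD.
  have y0 : 0 < m' / s by rewrite divr_gt0.
  set tau := t * X s + r in tD.
  have tau0 : 0 < tau by rewrite addr_gt0// mulr_gt0// X0.
  have Xtau : X s < tau / t by rewrite ltr_pdivlMr// mulrC ltrDl.
  have := bump_inv_lt _ y0 Xtau; rewrite e0/= => /(_ ltac:(lra)).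
  rewrite ltr_pdivrMr// ltNge => /negP; apply.
  have sg : (s%:E <= rearr mu g tau)%E by exact: rearr_ge.
  have := Hm tau tau0; set b := bump e (tau / t).
  have b0 : 0 <= b * tau `^ P by rewrite mulr_ge0 ?bump_ge0 ?powR_ge0.
  have b0' : (0 <= (b * tau `^ P)%:E)%E by rewrite lee_fin.
  move=> /(le_trans (lee_wpmul2l b0' sg)); rewrite -EFinM lee_fin => bm.
  rewrite /m' powRM ?invr_ge0 ?(ltW tau0) ?(ltW t0)// -[t^-1]powR_inv1 ?(ltW t0)// -powRrM mulN1r.
  rewrite [leLHS](_ : _ = (b * tau `^ P * s) * t `^ (- P)); last by ring.
  by rewrite ler_wpM2r ?powR_ge0.
apply: (@le_trans _ _ ((t `^ Q)%:E * (L * C * m * t `^ (- Q))%:E)%E); last first.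
  rewrite -EFinM lee_fin mulrCA -powR_gt0D// subrr powRr0 mulr1//.
apply: lee_wpmul2l; first by rewrite lee_fin powR_ge0.
have LC0 : 0 <= L * C * m * t `^ (- Q) by rewrite !mulr_ge0 ?powR_ge0// ltW.
apply: rearr_le => [|s0 s00 ts0]; first by rewrite lee_fin.
have mTg := measurable_kernel_op mg g0.
(* As eps > t, nonpositive powers of eps may be replaced by powers of t; the remaining factor eps
   cancels against that of s0 eps. *)
have [E [mE EA tE Efin]] := finite_measure_subset (measurable_superlevel s0 mTg) ts0.
have [eps epsE] : exists eps, mu E = eps%:E.
  by exists (fine (mu E)); rewrite fineK// ge0_fin_numE.
rewrite epsE lte_fin in tE.
have eps0 : 0 < eps by exact: lt_trans tE.
have lower : (s0%:E * eps%:E <= \int[mu]_(x in E) kernel_op g x)%E.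
  rewrite -epsE -integral_cst//; apply: ge0_le_integral.
  - exact: mE.
  - by move=> x _; rewrite lee_fin.
  - exact: measurable_cst.
  - exact: measurable_funTS.
  - by move=> x /EA /ltW.
have slice s : 0 < s ->
    (\int[mu]_(x in E) \int[mu]_(y in [set y | s%:E < g y]) K x y <=
     (C * eps * t `^ (P - Q) * m')%:E * (bump (e / (P + e)) (s / m') / s)%:E)%E.
  move=> s1; have y0 : 0 < m' / s by rewrite divr_gt0.
  have tX0 : 0 < t * X s by rewrite mulr_gt0// X0.
  have mF := measurable_superlevel s mg.
  have Ee : (mu E <= eps%:E)%E by rewrite epsE.
  have H1 := bnd1 _ _ _ _ mE mF eps0 tX0 Ee (DX s s1).
  have H2 := bnd2 _ _ _ _ mE mF eps0 tX0 Ee (DX s s1).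
  have XB := bump_inv_powR e0 eP y0; rewrite -/(X s) in XB.
  (* the exponent of [eps] is nonpositive after dividing by [eps] *)
  have half c : - Q <= c -> c <= Q -> 0 < P + c ->
      X s `^ (P + c) <= m' / s * bump (e / (P + e)) (m' / s) ->
      (\int[mu]_(x in E) \int[mu]_(y in [set y | s%:E < g y]) K x y <=
        (C * (eps `^ (1 - (Q + c)) * (t * X s) `^ (P + c)))%:E)%E ->
      (\int[mu]_(x in E) \int[mu]_(y in [set y | s%:E < g y]) K x y <=
       (C * eps * t `^ (P - Q) * m')%:E * (bump (e / (P + e)) (s / m') / s)%:E)%E.
    move=> cQ1 cQ2 Pc XBc Hc; apply: le_trans Hc _; rewrite -EFinM lee_fin.
    rewrite [leRHS](_ : _ =
    C * (eps * t `^ (P - Q) * (m' / s * bump (e / (P + e)) (m' / s)))); last first.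
      by rewrite -(bumpV _ y0) invf_div; ring.
    rewrite ler_pM2l//.
    apply: (@le_trans _ _ (eps * t `^ (P - Q) * X s `^ (P + c))); last first.
      by rewrite ler_wpM2l// mulr_ge0 ?powR_ge0// ltW.
    rewrite powRM ?(ltW t0) ?(ltW (X0 s s1))// mulrA ler_wpM2r ?powR_ge0//.
    rewrite (powR_gt0D 1 _ eps0) powRr1 ?(ltW eps0)// -mulrA ler_wpM2l ?(ltW eps0)//.
    rewrite [t `^ (P - Q)](_ : _ = t `^ (- (Q + c)) * t `^ (P + c)); last first.
      by rewrite -powR_gt0D//; congr (_ `^ _); ring.
    rewrite ler_wpM2r ?powR_ge0//; apply: powR_antitone => //; last exact: ltW.
    lra.
  (* Levels above m' use the restricted bound with +2e, the others the one with -2e. *)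
  case: ifPn XB => _ XB.
    exact: half eQ1 eQ2 eP1 XB H1.
  exact: half eQ3 eQ4 eP2 XB H2.
have mb : measurable_fun (`]0%R, +oo[%classic : set R)
  (fun s : R => (bump (e / (P + e)) (s / m') / s)%:E).
  apply: measurable_funTS; apply/measurable_EFinP; apply: measurable_funM.
    apply: (measurableT_comp (measurable_bump _)).
    exact: measurable_funM.
  exact: measurable_invr.
have b0 (s : R) : (`]0%R, +oo[%classic : set R) s -> (0 <= (bump (e / (P + e)) (s / m') / s)%:E)%E.
  by rewrite /= in_itv/= andbT => s1; rewrite lee_fin divr_ge0 ?bump_ge0// ltW.
have cst0 : 0 <= C * eps * t `^ (P - Q) * m' by rewrite !mulr_ge0 ?powR_ge0// ltW.
have upper : (\int[mu]_(x in E) kernel_op g x <= (C * eps * t `^ (P - Q) * m' * L)%:E)%E.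
  rewrite kernel_op_layer//.
  apply: (@le_trans _ _ (\int[leb]_(s in `]0%R, +oo[) ((C * eps * t `^ (P - Q) * m')%:E *
      (bump (e / (P + e)) (s / m') / s)%:E))%E).
    have mI : @measurable _ R `]0%R, +oo[%classic by exact: measurable_itv.
    apply: ge0_le_integral.
    - exact: mI.
    - by move=> s _; apply: integral_ge0 => x _; apply: integral_ge0.
    - exact: measurable_kernel_layer.
    - by apply: emeasurable_funM; [exact: measurable_cst|exact: mb].
    - by move=> s; rewrite /= in_itv/= andbT; exact: slice.
  rewrite ge0_integralZl_EFin//.
  by rewrite (EFinM _ L); apply: lee_wpmul2l; [rewrite lee_fin|exact: HL].
have := le_trans lower upper; rewrite -EFinM !lee_fin -ler_pdivlMr// => /le_trans; apply.
rewrite le_eqVlt; apply/orP; left; apply/eqP; rewrite /m' powR_gt0D//.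
rewrite [LHS](_ : _ = L * C * m * t `^ (- Q) * (t `^ P * t `^ (- P))); last first.
  by field; rewrite gt_eqF.
by rewrite -powR_gt0D// subrr powRr0 mulr1.
Qed.

End restricted_interpolation.

(** * The Stein-Weiss inequality in Lorentz spaces *)

Section lorentz_seminorm.
Context d (T : measurableType d) (R : realType).
Variable mu : {sigma_finite_measure set T -> \bar R}.
Variables (p : R) (rho : \bar R).
Hypotheses (p0 : 0 < p) (rho1 : (1 <= rho)%E).
Implicit Types (G : T -> \bar R).

Definition lnorm (a : R) (b : \bar R) G := lorentz_fun a b (rearr mu G).

Lemma lnorm_ge0 G : (0 <= lnorm p rho G)%E.
Proof. by apply: lorentz_fun_ge0 => //; exact: rearr_ge0. Qed.

Let bump1 (t : R) : 0 < t -> bump 1 (t / t) = 1 :> R.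
Proof. by move=> t0; rewrite divff ?gt_eqF// /bump !powR1 minxx. Qed.

(** The domination lemma is applied with the single choice tau = t, where the bump is 1; this
    handles all rho at once at the price of the constant [A]. *)
Lemma lnorm_scale_ae : exists2 A : R, 0 < A & forall c G1 G2, 0 < c ->
  measurable_fun setT G1 -> measurable_fun setT G2 ->
  {ae mu, forall x, (G1 x <= c%:E * G2 x)%E} ->
  (lnorm p rho G1 <= (A * c)%:E * lnorm p rho G2)%E.
Proof.
have [A A0 HA] := lorentz_fun_dominated p0 p0 ltr01 rho1.
exists A => // c G1 G2 c0 mG1 mG2 GG.
apply: HA => //; try exact: rearr_noninc; try exact: rearr_ge0.
move=> t m t0 m0 /(_ t t0); rewrite bump1// mul1r => Gm.
have mcG2 : measurable_fun setT (fun x => c%:E * G2 x)%E.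
  by apply: emeasurable_funM; [exact: measurable_cst|].
have R12 : (rearr mu G1 t <= c%:E * rearr mu G2 t)%E.
  by apply: le_trans (rearr_scale _ _ c0 mG2); exact: rearr_le_ae.
have tp0 : (0 <= (t `^ p^-1)%:E)%E by rewrite lee_fin powR_ge0.
apply: le_trans (lee_wpmul2l tp0 R12) _.
rewrite muleCA EFinM; apply: lee_wpmul2l; last exact: Gm.
by rewrite lee_fin ltW.
Qed.

Lemma lnorm_add : exists2 A : R, 0 < A & forall G1 G2,
  measurable_fun setT G1 -> measurable_fun setT G2 ->
  (forall x, 0 <= G1 x)%E -> (forall x, 0 <= G2 x)%E ->
  (lnorm p rho (fun x => G1 x + G2 x) <=
   A%:E * maxe (lnorm p rho G1) (lnorm p rho G2))%E.
Proof.
have [A A0 HA] := lorentz_fun_dominated p0 p0 ltr01 rho1.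
have [B B0 HB] := lorentz_fun_max p0 rho1.
(* One factor 2 comes from [rearr_add], the other is the inverse of the bump at 1/2, and 2^(1/p)
   pays for replacing t by t / 2 in the power. *)
pose C : R := 2 * (2 * 2 `^ p^-1).
have C0 : 0 < C by rewrite !mulr_gt0// powR_gt0.
exists (A * C * B); first by rewrite !mulr_gt0.
move=> G1 G2 mG1 mG2 G10 G20.
pose M t := maxe (rearr mu G1 t) (rearr mu G2 t).
have niM : noninc M.
  by move=> s t st; rewrite ge_max !le_max !rearr_noninc ?orbT.
have M0 : nonneg_fun M by move=> t; rewrite le_max rearr_ge0.
apply: (@le_trans _ _ ((A * C)%:E * lorentz_fun p rho M)%E).
  apply: HA => //; try exact: rearr_noninc; try exact: rearr_ge0.
  move=> t m t0 m0 Hm; have t20 : 0 < t / 2 by rewrite divr_gt0.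
  have := Hm _ t20.
  have -> : bump 1 (t / 2 / t) = 2^-1 :> R.
    rewrite mulrAC divff ?gt_eqF// mul1r bumpV// /bump powRr1// powR_inv1// min_r//.
    by lra.
  have tp0 : (0 <= (t `^ p^-1)%:E)%E by rewrite lee_fin powR_ge0.
  have k0 : (0 <= C%:E)%E by rewrite lee_fin ltW.
  move=> /(lee_wpmul2l k0); rewrite -EFinM; apply: le_trans.
  have RA := rearr_add mu t mG1 mG2 G10 G20.
  apply: le_trans (lee_wpmul2l tp0 RA) _.
  rewrite muleA muleA -!EFinM -/(M (t / 2)) le_eqVlt; apply/orP; left; apply/eqP.
  congr (_%:E * _)%E; rewrite powRM ?(ltW t0)// -[2^-1 in X in _ = _ * (_ * (_ * X))]powR_inv1//.
  rewrite -powRrM mulN1r powRN /C; field.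
  by rewrite gt_eqF// powR_gt0.
rewrite (EFinM _ B) -muleA.
apply: lee_wpmul2l; first by rewrite lee_fin ltW// mulr_gt0.
by apply: HB; try exact: rearr_noninc; exact: rearr_ge0.
Qed.

Lemma lnorm_fatou (U_ : nat -> T -> \bar R) (U : T -> \bar R) (M : \bar R) :
  (forall n, measurable_fun setT (U_ n)) ->
  (forall x, {homo U_ ^~ x : m n / (m <= n)%N >-> (m <= n)%E}) ->
  (forall x s, (s%:E < U x)%E -> exists n, (s%:E < U_ n x)%E) ->
  measurable_fun setT U -> (0 <= M)%E ->
  (forall n, (lnorm p rho (U_ n) <= M)%E) -> (lnorm p rho U <= M)%E.
Proof.
move=> mU_ ndU UU mU M0 HM.
apply: (@lorentz_fun_fatou _ p rho (fun n => rearr mu (U_ n))) => //.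
- by move=> n; exact: rearr_noninc.
- by move=> n; exact: rearr_ge0.
- move=> t m n mn; apply: rearr_le_ae => //.
  by apply/aeW => x; exact: ndU.
- exact: rearr_noninc.
- exact: rearr_ge0.
- move=> t y t0 Hy; apply: (rearr_sup mU_ ndU UU mU) => //.
  by apply: le_trans (Hy 0%N); exact: rearr_ge0.
Qed.

(** If {G = oo} had measure above some t > 0, the rearrangement would be infinite at t, against the
    weak bound. *)
Lemma lnorm_fin_ae G : measurable_fun setT G ->
  (lnorm p rho G < +oo)%E -> {ae mu, forall x, (G x < +oo)%E}.
Proof.
move=> mG Gfin; have [A A0 HA] := lorentz_fun_weak p0 rho1.
pose N := [set x | (G x = +oo)%E].
have mN : measurable N.
  by have := mG measurableT _ (emeasurable_set1 +oo%E); rewrite setTI.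
have rfin t : 0 < t -> (rearr mu G t < +oo)%E.
  move=> t0; rewrite ltey; apply/eqP => rG.
  have := HA (rearr mu G) (@rearr_noninc _ _ _ mu G) (rearr_ge0 mu G) t t0.
  rewrite rG gt0_muley ?lte_fin ?powR_gt0// leye_eq => /eqP AG.
  suff : (A%:E * lnorm p rho G < +oo)%E by rewrite /lnorm AG.
  by rewrite lte_mul_pinfty// ?lee_fin ?(ltW A0).
exists N; split => //; last first.
  by move=> x /= /negP; rewrite -leNgt leye_eq => /eqP.
apply/eqP; rewrite eq_le measure_ge0 andbT; apply/lee_addgt0Pr => t t0.
rewrite add0e leNgt; apply/negP => tN.
suff rG : (rearr mu G t = +oo)%E by have := rfin t t0; rewrite rG ltxx.
apply/eqP; rewrite -leye_eq; apply: lee_of_lt_real => [|s s0 _].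
  exact: rearr_ge0.
apply: rearr_ge => //; apply: lt_le_trans tN _; apply: le_measure; rewrite ?inE//.
  exact: measurable_superlevel.
by move=> x /= ->; rewrite ltry.
Qed.

(** By the weak bound the rearrangement vanishes at every t > 0, so the superlevel sets at positive
    levels are null. *)
Lemma lnorm_eq0_ae G : measurable_fun setT G -> (forall x, 0 <= G x)%E ->
  (lnorm p rho G = 0)%E -> {ae mu, forall x, G x = 0%E}.
Proof.
move=> mG G0 Gz; have [A A0 HA] := lorentz_fun_weak p0 rho1.
have rz t : 0 < t -> (rearr mu G t <= 0)%E.
  move=> t0; have := HA (rearr mu G) (@rearr_noninc _ _ _ mu G) (rearr_ge0 mu G) t t0.
  rewrite -/(lnorm p rho G) Gz mule0; apply: contraTT.
  by rewrite -!ltNge => rt; rewrite mule_gt0// lte_fin powR_gt0.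
have dz s : 0 < s -> (dfun mu G s = 0)%E.
  move=> s0; apply/eqP; rewrite eq_le measure_ge0 andbT.
  apply/lee_addgt0Pr => t t0; rewrite add0e leNgt; apply/negP => tG.
  have := le_trans (rearr_ge mG tG) (rz t t0); rewrite lee_fin leNgt s0//.
pose B n := [set x | ((n.+1%:R^-1)%:E < G x)%E].
exists (\bigcup_n B n); split.
- by apply: bigcupT_measurable => n; exact: measurable_superlevel.
- apply/eqP; rewrite eq_le measure_ge0 andbT.
  apply: le_trans (generalized_Boole_inequality mu _ _) _.
  + by move=> n; exact: measurable_superlevel.
  + by apply: bigcupT_measurable => n; exact: measurable_superlevel.
  rewrite eseries0// => n _ _; by apply: dz; rewrite invr_gt0.
move=> x /= /eqP Gx0; have Gx : (0 < G x)%E by rewrite lt_neqAle eq_sym Gx0 G0.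
case GE : (G x) Gx => [r| |] // Gx; last by exists 0%N; rewrite // /B /= GE ltry.
rewrite lte_fin in Gx; exists (Num.bound r^-1); rewrite // /B /= GE lte_fin.
rewrite invf_plt ?posrE//; apply: lt_trans (archi_boundP _) _.
  by rewrite invr_ge0 ltW.
by rewrite ltr_nat.
Qed.

End lorentz_seminorm.

Section stein_weiss.
Context (R : realType) (n : nat).
Hypothesis n0 : (0 < n)%N.
Implicit Types (x y : 'rV[R]_n) (G g : 'rV[R]_n -> \bar R).
Local Notation mu := (lebesgue_rV R n).
Local Notation N := (n%:R : R).

Lemma sw_kernel_lorentz (be eta ga p q : R) (rho : \bar R) :
  0 < p -> 0 < q -> (1 <= rho)%E -> 0 < eta < N -> 0 <= be + ga ->
  be + eta + ga <= N -> be + eta + ga < N \/ 0 < be + ga ->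
  be < N * q^-1 < be + eta -> N * q^-1 < be + eta + ga ->
  p^-1 = q^-1 + 1 - (be + eta + ga) / N ->
  exists2 A : R, 0 < A & forall g, measurable_fun setT g ->
    (forall y, 0 <= g y)%E ->
    (lnorm mu q rho (kernel_op mu (fun x y => (sw_kernel be eta ga x y)%:E) g) <=
     A%:E * lnorm mu p rho g)%E.
Proof.
move=> p0 q0 rho1 etaN bega omN omN' /andP[bq1 bq2] omq pq.
have N0 : 0 < N by rewrite ltr0n.
have qV0 : 0 < q^-1 by rewrite invr_gt0.
have pV0 : 0 < p^-1 by rewrite invr_gt0.
set om := be + eta + ga in omN omN' omq pq *.
have qp : q^-1 <= p^-1.
  by rewrite pq -addrA lerDl subr_ge0 ler_pdivrMr// mul1r.
(* 2 N e is at most half of each slack, so 1/q + 2e and 1/q - 2e stay strictly inside the range of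
   [sw_form_bound_general]. *)
pose e := Num.min (N * q^-1 - be) (Num.min (be + eta - N * q^-1)
  (Num.min (om - N * q^-1) (N * q^-1))) / (4 * N).
have N40 : 0 < 4 * N by rewrite mulr_gt0.
have e0 : 0 < e by rewrite divr_gt0// !lt_min !subr_gt0 bq1 bq2 omq mulr_gt0.
have eE : 4 * (N * e) = Num.min (N * q^-1 - be) (Num.min (be + eta - N * q^-1)
    (Num.min (om - N * q^-1) (N * q^-1))).
  by rewrite /e mulrA mulrC divfK// gt_eqF.
have e1 : 4 * (N * e) <= N * q^-1 - be by rewrite eE ge_min lexx.
have e2 : 4 * (N * e) <= be + eta - N * q^-1 by rewrite eE !ge_min lexx ?orbT.
have e3 : 4 * (N * e) <= om - N * q^-1 by rewrite eE !ge_min lexx ?orbT.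
have e4 : 4 * (N * e) <= N * q^-1 by rewrite eE !ge_min lexx ?orbT.
have Ne0 : 0 < N * e by rewrite mulr_gt0.
have eq2 : 2 * e < q^-1.
  rewrite -(ltr_pM2l N0) (_ : N * (2 * e) = 2 * (N * e)); last by ring.
  by clear -e4 Ne0; lra.
have bound b : N * b = N * q^-1 + 2 * (N * e) \/ N * b = N * q^-1 - 2 * (N * e) ->
    sw_form_bound n be eta ga (1 - b) (b + 1 - om / N).
  move=> Nb.
  have Nb1 : be < N * b < be + eta.
    by clear -Nb e1 e2 Ne0; apply/andP; case: Nb => ->; split; lra.
  have Nb2 : N * b < om by clear -Nb e3 Ne0; case: Nb => ->; lra.
  have b0 : 0 < b.
    by rewrite -(pmulr_rgt0 _ N0); clear -Nb e4 Ne0; case: Nb => ->; lra.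
  exact: (sw_form_bound_general n0 etaN bega omN omN' Nb1 b0 Nb2).
have [|C1 C10 H1] := bound (q^-1 + 2 * e); first by left; ring.
have [|C2 C20 H2] := bound (q^-1 - 2 * e); first by right; ring.
have mK := measurable_sw_kernel (n := n) be eta ga.
have K0 x y : (0 <= (sw_kernel be eta ga x y)%:E)%E.
  by rewrite lee_fin; exact: sw_kernel_ge0.
have [A A0 HA] := restricted_interpolation mu mK K0 e0 (lt_le_trans eq2 qp) eq2.
have [B B0 HB] := lorentz_fun_dominated p0 q0 e0 rho1.
have C0 : 0 < C1 + C2 by rewrite addr_gt0.
exists (B * (A * (C1 + C2))); first by rewrite !mulr_gt0.
move=> g mg g0; apply: HB.
- by rewrite mulr_gt0.
- exact: rearr_noninc.
- exact: rearr_ge0.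
- exact: rearr_noninc.
- exact: rearr_ge0.
apply: HA => //.
- move=> E F e' f' mE mF e'0 f'0 Ee' Ff'.
  have := H1 E F e' f' mE mF e'0 f'0 Ee' Ff'.
  rewrite (_ : q^-1 + 2 * e + 1 - om / N = p^-1 + 2 * e); last by rewrite pq; ring.
  move/le_trans; apply; rewrite lee_fin ler_wpM2r ?mulr_ge0 ?powR_ge0//.
  by rewrite lerDl ltW.
- move=> E F e' f' mE mF e'0 f'0 Ee' Ff'.
  have := H2 E F e' f' mE mF e'0 f'0 Ee' Ff'.
  rewrite (_ : q^-1 - 2 * e + 1 - om / N = p^-1 - 2 * e); last by rewrite pq; ring.
  move/le_trans; apply; rewrite lee_fin ler_wpM2r ?mulr_ge0 ?powR_ge0//.
  by rewrite lerDr ltW.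
Qed.

Lemma npowN s x : x <> 0 -> npow (- s) x * npow s x = 1.
Proof.
by move=> /enorm_gt0 x0; rewrite !npowE -powR_gt0D// addNr powRr0.
Qed.

Definition riesz_op (eta : R) G x : \bar R := (\int[mu]_y ((dpow (- eta) x y)%:E * G y))%E.

Lemma measurable_riesz_integrand eta G x : measurable_fun setT G ->
  measurable_fun setT (fun y => (dpow (- eta) x y)%:E * G y)%E.
Proof.
move=> mG; apply: emeasurable_funM => //.
by apply/measurable_EFinP; exact: measurable_dpowr.
Qed.

Lemma riesz_integrand_ge0 eta G x y : (0 <= G y)%E ->
  (0 <= (dpow (- eta) x y)%:E * G y)%E.
Proof. by move=> Gy; rewrite mule_ge0// lee_fin dpow_ge0. Qed.

Lemma riesz_op_ge0 eta G x : (forall y, 0 <= G y)%E -> (0 <= riesz_op eta G x)%E.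
Proof. by move=> G0; apply: integral_ge0 => y _; exact: riesz_integrand_ge0. Qed.

Lemma measurable_riesz_op eta G : measurable_fun setT G -> (forall y, 0 <= G y)%E ->
  measurable_fun setT (riesz_op eta G).
Proof.
move=> mG G0; apply: (measurable_integral_domain mu
  (f := fun x y => ((dpow (- eta) x y)%:E * G y)%E)).
- exact: measurableT.
- apply: emeasurable_funM; last exact: measurableT_comp mG measurable_snd.
  by apply/measurable_EFinP; exact: measurable_dpow.
- by move=> x y; exact: riesz_integrand_ge0.
Qed.

Lemma le_riesz_op eta G1 G2 x : measurable_fun setT G1 -> measurable_fun setT G2 ->
  (forall y, 0 <= G1 y)%E -> (forall y, 0 <= G2 y)%E ->
  {ae mu, forall y, (G1 y <= G2 y)%E} -> (riesz_op eta G1 x <= riesz_op eta G2 x)%E.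
Proof.
move=> mG1 mG2 G10 G20 GG; apply: ae_ge0_le_integral.
- exact: measurableT.
- by move=> y _; exact: riesz_integrand_ge0.
- exact: measurable_riesz_integrand.
- by move=> y _; exact: riesz_integrand_ge0.
- exact: measurable_riesz_integrand.
- move: GG; apply: filterS => y GG _; apply: lee_wpmul2l => //.
  by rewrite lee_fin dpow_ge0.
Qed.

Lemma ae_neq0 : {ae mu, forall x : 'rV[R]_n, x <> 0}.
Proof.
exists [set 0]; split.
- exact: measurable_rV_point.
- exact: lebesgue_rV_point.
- by move=> x /= /contrapT.
Qed.

(* The factor [npow ga] is undone by the kernel except at the origin. *)
Lemma riesz_op_lorentz (be eta ga p q : R) (rho : \bar R) :
  0 < p -> 0 < q -> (1 <= rho)%E -> 0 < eta < N -> 0 <= be + ga ->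
  be + eta + ga <= N -> be + eta + ga < N \/ 0 < be + ga ->
  be < N * q^-1 < be + eta -> N * q^-1 < be + eta + ga ->
  p^-1 = q^-1 + 1 - (be + eta + ga) / N ->
  exists2 A : R, 0 < A & forall G, measurable_fun setT G ->
    (forall y, 0 <= G y)%E ->
    (lnorm mu q rho (fun x => (npow (- be) x)%:E * riesz_op eta G x) <=
     A%:E * lnorm mu p rho (fun y => (npow ga y)%:E * G y))%E.
Proof.
move=> p0 q0 rho1 etaN bega omN omN' bq omq pq.
have [A A0 HA] := sw_kernel_lorentz p0 q0 rho1 etaN bega omN omN' bq omq pq.
exists A => // G mG G0.
have mnG : measurable_fun setT (fun y => (npow ga y)%:E * G y)%E.
  by apply: emeasurable_funM => //; apply/measurable_EFinP; exact: measurable_npowT.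
have nG0 y : (0 <= (npow ga y)%:E * G y)%E by rewrite mule_ge0// lee_fin npow_ge0.
have := HA _ mnG nG0; congr (_ <= _)%E; congr lorentz_fun; congr rearr.
apply/funext => x; rewrite /kernel_op /riesz_op.
rewrite -ge0_integralZl_EFin; last 4 first.
- exact: measurableT.
- by move=> y _; exact: riesz_integrand_ge0.
- exact: measurable_riesz_integrand.
- exact: npow_ge0.
apply: ge0_ae_eq_integral.
- exact: measurableT.
- by apply: emeasurable_funM => //; exact: measurable_sw_kernelr.
- apply: emeasurable_funM; first exact: measurable_cst.
  exact: measurable_riesz_integrand.
- by move=> y _; rewrite mule_ge0// lee_fin sw_kernel_ge0.
- by move=> y _; rewrite mule_ge0 ?riesz_integrand_ge0// lee_fin npow_ge0.
move: ae_neq0; apply: filterS => y y0 _.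
rewrite sw_kernelE !muleA -!EFinM; congr (_%:E * _)%E.
by rewrite -!mulrA npowN// mulr1.
Qed.

End stein_weiss.

(** * Complex-valued potentials *)

Section complex_values.
Context (R : realType).
Implicit Types (z w : R[i]) (r : R).
Local Open Scope complex_scope.
Local Notation Re := (@complex.Re R).
Local Notation Im := (@complex.Im R).

Lemma ReD z w : Re (z + w) = Re z + Re w. Proof. by case: z w => [? ?] []. Qed.
Lemma ImD z w : Im (z + w) = Im z + Im w. Proof. by case: z w => [? ?] []. Qed.
Lemma ReB z w : Re (z - w) = Re z - Re w. Proof. by case: z w => [? ?] []. Qed.
Lemma ImB z w : Im (z - w) = Im z - Im w. Proof. by case: z w => [? ?] []. Qed.
Lemma Re_mul z w : Re (z * w) = Re z * Re w - Im z * Im w.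
Proof. by case: z w => [? ?] []. Qed.
Lemma Im_mul z w : Im (z * w) = Re z * Im w + Im z * Re w.
Proof. by case: z w => [? ?] []. Qed.
Lemma Re_scale r z : Re (r%:C * z) = r * Re z.
Proof. by rewrite Re_mul /= mul0r subr0. Qed.
Lemma Im_scale r z : Im (r%:C * z) = r * Im z.
Proof. by rewrite Im_mul /= mul0r addr0. Qed.

Lemma complex_eq z w : Re z = Re w -> Im z = Im w -> z = w.
Proof. by case: z w => [a b] [c e] /= -> ->. Qed.

Lemma cabsE z : cabs z = Num.sqrt (Re z ^+ 2 + Im z ^+ 2).
Proof. by case: z. Qed.

Lemma cabs_ge0 z : 0 <= cabs z.
Proof. by rewrite cabsE sqrtr_ge0. Qed.

Lemma cabs0 : cabs (0%R : R[i]) = 0.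
Proof. exact: ComplexField.Normc.normc0. Qed.

Lemma cabs_eq0 z : cabs z = 0 -> z = 0.
Proof. exact: ComplexField.Normc.eq0_normc. Qed.

Lemma cabsM z w : cabs (z * w) = cabs z * cabs w.
Proof. exact: ComplexField.Normc.normcM. Qed.

Lemma cabs_real r : cabs (r%:C) = `|r|.
Proof. by rewrite cabsE /= expr0n/= addr0 sqrtr_sqr. Qed.

Lemma cabsD z w : cabs (z + w) <= cabs z + cabs w.
Proof. exact: (@le_normcD R). Qed.

Lemma cabsN z : cabs (- z) = cabs z.
Proof. by case: z => a b; rewrite !cabsE /= !sqrrN. Qed.

Lemma cabsB z w : cabs (z - w) <= cabs z + cabs w.
Proof. by rewrite -(cabsN w) cabsD. Qed.

Lemma Re_le_cabs z : `|Re z| <= cabs z.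
Proof. by rewrite cabsE -sqrtr_sqr ler_wsqrtr// lerDl sqr_ge0. Qed.

Lemma Im_le_cabs z : `|Im z| <= cabs z.
Proof. by rewrite cabsE -sqrtr_sqr ler_wsqrtr// lerDr sqr_ge0. Qed.

Lemma cabs_le_ReIm z : cabs z <= `|Re z| + `|Im z|.
Proof.
rewrite cabsE -[leRHS]ger0_norm ?addr_ge0// -sqrtr_sqr ler_wsqrtr//.
rewrite sqrrD !real_normK ?num_real// addrAC lerDl.
by rewrite mulrn_wge0// mulr_ge0.
Qed.

End complex_values.

Section complex_potential.
Context (R : realType) (n : nat).
Implicit Types (x y : 'rV[R]_n) (f g h u : 'rV[R]_n -> R[i]) (al eta s : R).
Local Open Scope complex_scope.
Local Notation mu := (lebesgue_rV R n).
Local Notation N := (n%:R : R).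
Local Notation Re := (@complex.Re R).
Local Notation Im := (@complex.Im R).

Definition cmod g x : \bar R := (cabs (g x))%:E.

Lemma cmod_ge0 g x : (0 <= cmod g x)%E.
Proof. by rewrite lee_fin cabs_ge0. Qed.

Lemma measurable_cmod g : cmeasurable g -> measurable_fun setT (cmod g).
Proof.
move=> [mr mi]; apply/measurable_EFinP.
under eq_fun do rewrite cabsE -powR12_sqrt ?addr_ge0 ?sqr_ge0//.
apply: (measurableT_comp (@measurable_powR R _)).
by apply: measurable_funD; exact: measurable_funX.
Qed.

(** True by conversion: the superlevel sets of [cmod g] unfold to those in
    [distribution_function]. *)
Lemma lorentz_normE a b g : lorentz_norm a b g = lnorm mu a b (cmod g).
Proof. by []. Qed.

Lemma cmod_weighted s g x : cmod (weighted s g) x = ((npow s x)%:E * cmod g x)%E.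
Proof.
rewrite /cmod /weighted cabsM cabs_real ger0_norm ?powR_ge0// -npowE EFinM//.
Qed.

Lemma cmeasurable_weighted s g : cmeasurable g -> cmeasurable (weighted s g).
Proof.
move=> [mr mi]; split.
- under eq_fun do rewrite Re_scale -npowE.
  by apply: measurable_funM => //; exact: measurable_npowT.
- under eq_fun do rewrite Im_scale -npowE.
  by apply: measurable_funM => //; exact: measurable_npowT.
Qed.

Let measurable_off0 (h h' : 'rV[R]_n -> R) : measurable_fun setT h' ->
  (forall x, x <> 0 -> h x = h' x) -> measurable_fun setT h.
Proof.
move=> mh' hh'.
have -> : h = fun x => h' x + (h 0 - h' 0) * \1_[set 0] x.
  apply/funext => x; rewrite indicE; have [->|x0] := pselect (x = 0).
    by rewrite mem_set// mulr1; ring.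
  by rewrite memNset// mulr0 addr0 hh'.
apply: measurable_funD => //; apply: measurable_funM => //.
by apply: measurable_indic; exact: measurable_rV_point.
Qed.

(** Membership in the weighted space provides measurability of the weighted function. The weight is
    invertible off the origin, and the value at the origin is restored by a multiple of an
    indicator. *)
Lemma cmeasurable_unweight s g : cmeasurable (weighted s g) -> cmeasurable g.
Proof.
move=> [mr mi].
have E r x : x <> 0 -> npow (- s) x * (npow s x * r) = r.
  by move=> x0; rewrite mulrA npowN// mul1r.
split.
- apply: (@measurable_off0 _ (fun x => npow (- s) x * Re (weighted s g x))).
    by apply: measurable_funM => //; exact: measurable_npowT.
  by move=> x x0; rewrite Re_scale -npowE E.
- apply: (@measurable_off0 _ (fun x => npow (- s) x * Im (weighted s g x))).
    by apply: measurable_funM => //; exact: measurable_npowT.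
  by move=> x x0; rewrite Im_scale -npowE E.
Qed.

Lemma riesz_integrandE al g x y :
  riesz_integrand al g x y = (dpow (- (N - al)) x y)%:C * g y.
Proof.
rewrite /riesz_integrand dpowE npowE powRN mulrC; congr (_ * _).
by rewrite fmorphV.
Qed.

(** Positive and negative parts are integrated separately, where Tonelli applies; [fine] then
    handles points at which the integral is not finite. *)
Lemma measurable_Rintegral_param (h : 'rV[R]_n -> 'rV[R]_n -> R) :
  measurable_fun setT (fun z : 'rV[R]_n * 'rV[R]_n => h z.1 z.2) ->
  measurable_fun setT (fun x => Rintegral mu setT (h x)).
Proof.
move=> mh; have meh : measurable_fun setT (fun z : 'rV[R]_n * 'rV[R]_n => (h z.1 z.2)%:E).
  exact/measurable_EFinP.
have -> : (fun x => Rintegral mu setT (h x)) = (fun x => fine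
    (\int[mu]_(y in setT) maxe (h x y)%:E 0 - \int[mu]_(y in setT) maxe (- (h x y)%:E) 0)%E).
  apply/funext => x; rewrite /Rintegral integralE; congr (fine (_ - _)%E).
    by apply: eq_integral => y _; rewrite funeposE.
  by apply: eq_integral => y _; rewrite funenegE.
apply: (measurableT_comp (f := @fine R)); first exact: fine_measurable.
apply: emeasurable_funB.
- apply: (measurable_integral_domain mu (f := fun x y => maxe (h x y)%:E 0%E)).
  + exact: measurableT.
  + exact: measurable_maxe.
  + by move=> x y; rewrite le_max lexx orbT.
- apply: (measurable_integral_domain mu (f := fun x y => maxe (- (h x y)%:E)%E 0%E)).
  + exact: measurableT.
  + by apply: measurable_maxe => //; exact: measurableT_comp.
  + by move=> x y; rewrite le_max lexx orbT.
Qed.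

Lemma cmeasurable_riesz_potential al g : cmeasurable g ->
  cmeasurable (riesz_potential al g).
Proof.
move=> [mr mi]; split.
- apply: (@measurable_Rintegral_param (fun x y => Re (riesz_integrand al g x y))).
  under eq_fun do rewrite riesz_integrandE Re_scale.
  apply: measurable_funM; first exact: measurable_dpow.
  exact: measurableT_comp mr measurable_snd.
- apply: (@measurable_Rintegral_param (fun x y => Im (riesz_integrand al g x y))).
  under eq_fun do rewrite riesz_integrandE Im_scale.
  apply: measurable_funM; first exact: measurable_dpow.
  exact: measurableT_comp mi measurable_snd.
Qed.

Lemma cmeasurable_scale (c : R) g : cmeasurable g -> cmeasurable (fun x => c%:C * g x).
Proof.
move=> [mr mi]; split.
- by under eq_fun do rewrite Re_scale; exact: measurable_funM.
- by under eq_fun do rewrite Im_scale; exact: measurable_funM.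
Qed.

Lemma cmeasurableM g h : cmeasurable g -> cmeasurable h ->
  cmeasurable (fun x => g x * h x).
Proof.
move=> [mr mi] [mr' mi']; split.
- under eq_fun do rewrite Re_mul.
  by apply: measurable_funB; exact: measurable_funM.
- under eq_fun do rewrite Im_mul.
  by apply: measurable_funD; exact: measurable_funM.
Qed.

Lemma cmeasurableD g h : cmeasurable g -> cmeasurable h ->
  cmeasurable (fun x => g x + h x).
Proof.
move=> [mr mi] [mr' mi']; split.
- by under eq_fun do rewrite ReD; exact: measurable_funD.
- by under eq_fun do rewrite ImD; exact: measurable_funD.
Qed.

Lemma cmeasurableB g h : cmeasurable g -> cmeasurable h ->
  cmeasurable (fun x => g x - h x).
Proof.
move=> [mr mi] [mr' mi']; split.
- by under eq_fun do rewrite ReB; exact: measurable_funB.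
- by under eq_fun do rewrite ImB; exact: measurable_funB.
Qed.

Lemma cmeasurable_hardy al (la : R[i]) : cmeasurable (@hardy_potential R n al la).
Proof.
split.
- under eq_fun do rewrite /hardy_potential mulrC Re_scale -npowE.
  by apply: measurable_funM => //; exact: measurable_npowT.
- under eq_fun do rewrite /hardy_potential mulrC Im_scale -npowE.
  by apply: measurable_funM => //; exact: measurable_npowT.
Qed.

Lemma cabs_hardy al (la : R[i]) x :
  cabs (hardy_potential al la x) = cabs la * npow (- al) x.
Proof. by rewrite cabsM cabs_real npowE ger0_norm// powR_ge0. Qed.

Lemma cmod_riesz_integrand al g x y :
  (cmod (riesz_integrand al g x) y = (dpow (- (N - al)) x y)%:E * cmod g y)%E.
Proof.
by rewrite /cmod riesz_integrandE cabsM cabs_real ger0_norm ?dpow_ge0// EFinM.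
Qed.

Lemma cmeasurable_riesz_integrand al g x : cmeasurable g ->
  cmeasurable (riesz_integrand al g x).
Proof.
move=> [mr mi]; split.
- under eq_fun do rewrite riesz_integrandE Re_scale.
  by apply: measurable_funM => //; exact: measurable_dpowr.
- under eq_fun do rewrite riesz_integrandE Im_scale.
  by apply: measurable_funM => //; exact: measurable_dpowr.
Qed.

Lemma cintegrable_cmod g : cmeasurable g ->
  (\int[mu]_y cmod g y < +oo)%E -> cintegrable g.
Proof.
move=> mg gfin; have mcg := measurable_cmod mg; case: mg => mr mi.
split; apply/integrableP; split; try exact/measurable_EFinP.
- apply: le_lt_trans gfin; apply: ge0_le_integral => //.
  + by apply: measurableT_comp => //; exact/measurable_EFinP.
  + by move=> x _; rewrite lee_fin Re_le_cabs.
- apply: le_lt_trans gfin; apply: ge0_le_integral => //.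
  + by apply: measurableT_comp => //; exact/measurable_EFinP.
  + by move=> x _; rewrite lee_fin Im_le_cabs.
Qed.

Lemma abs_fine_le (z : \bar R) : ((`|fine z|)%:E <= `|z|)%E.
Proof. by case: z => [r| |] //=; rewrite normr0 leey. Qed.

(** The factor 2 comes from bounding real and imaginary parts separately, and it reappears as
    [2 * kappa] in the majorizing operators. Infinite integrals are covered because [fine] sends
    them to 0. *)
Lemma cabs_cintegral_le g : cmeasurable g ->
  ((cabs (cintegral g))%:E <= 2%:E * \int[mu]_y cmod g y)%E.
Proof.
move=> mg; have mcg := measurable_cmod mg; case: mg => mr mi.
apply: (@le_trans _ _ ((`|Re (cintegral g)|)%:E + (`|Im (cintegral g)|)%:E)%E).
  by rewrite -EFinD lee_fin cabs_le_ReIm.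
rewrite mule_natl mule2n; apply: leeD.
- apply: le_trans (abs_fine_le _) _; apply: le_trans (le_abse_integral _ _ _) _ => //.
    exact/measurable_EFinP.
  apply: ge0_le_integral => //.
  + by apply: measurableT_comp => //; exact/measurable_EFinP.
  + by move=> x _; rewrite lee_fin Re_le_cabs.
- apply: le_trans (abs_fine_le _) _; apply: le_trans (le_abse_integral _ _ _) _ => //.
    exact/measurable_EFinP.
  apply: ge0_le_integral => //.
  + by apply: measurableT_comp => //; exact/measurable_EFinP.
  + by move=> x _; rewrite lee_fin Im_le_cabs.
Qed.

Lemma cintegralB g h : cintegrable g -> cintegrable h ->
  cintegral (fun y => g y - h y) = cintegral g - cintegral h.
Proof.
move=> [gr gi] [hr hi]; apply: complex_eq; rewrite /cintegral.
- rewrite ReB /=; under eq_Rintegral do rewrite ReB.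
  exact: RintegralB.
- rewrite ImB /=; under eq_Rintegral do rewrite ImB.
  exact: RintegralB.
Qed.

Lemma cabs_riesz_potential_le al g x : cmeasurable g ->
  ((cabs (riesz_potential al g x))%:E <= 2%:E * riesz_op (N - al) (cmod g) x)%E.
Proof.
move=> mg; apply: le_trans (cabs_cintegral_le _) _.
  exact: cmeasurable_riesz_integrand.
rewrite /riesz_op; under eq_integral do rewrite cmod_riesz_integrand.
by [].
Qed.

Lemma cintegrable_riesz al g x : cmeasurable g ->
  (riesz_op (N - al) (cmod g) x < +oo)%E -> cintegrable (riesz_integrand al g x).
Proof.
move=> mg gfin; apply: cintegrable_cmod; first exact: cmeasurable_riesz_integrand.
by under eq_integral do rewrite cmod_riesz_integrand.
Qed.

(** Positivity is part of [is_riesz_constant], and the default value of [xget] is 1, so both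
    branches are positive. *)
Lemma riesz_constant_gt0 al : 0 < riesz_constant n al.
Proof.
by rewrite /riesz_constant; case: xgetP => [y _ []|_] //; rewrite ltr01.
Qed.

End complex_potential.

(** * The Neumann series *)

Section neumann_iteration.
Context (R : realType) (n : nat).
Variables (al : R) (la : R[i]).
Implicit Types (x y : 'rV[R]_n) (f g u : 'rV[R]_n -> R[i]) (G : 'rV[R]_n -> \bar R).
Local Open Scope complex_scope.
Local Notation mu := (lebesgue_rV R n).
Local Notation Re := (@complex.Re R).
Local Notation Im := (@complex.Im R).
Local Notation kappa := (riesz_constant n al).
Local Notation eta := (n%:R - al : R).
Local Notation a := (hardy_potential al la).

Lemma riesz_opD G1 G2 x : measurable_fun setT G1 -> measurable_fun setT G2 ->
  (forall y, 0 <= G1 y)%E -> (forall y, 0 <= G2 y)%E ->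
  (riesz_op eta (fun y => G1 y + G2 y) x = riesz_op eta G1 x + riesz_op eta G2 x)%E.
Proof.
move=> mG1 mG2 G10 G20; rewrite /riesz_op -ge0_integralD; last 5 first.
- exact: measurableT.
- by move=> y _; exact: riesz_integrand_ge0.
- exact: measurable_riesz_integrand.
- by move=> y _; exact: riesz_integrand_ge0.
- exact: measurable_riesz_integrand.
apply: eq_integral => y _.
by rewrite ge0_muleDr.
Qed.

Lemma riesz_opZ (c : R) G x : 0 <= c -> measurable_fun setT G -> (forall y, 0 <= G y)%E ->
  (riesz_op eta (fun y => c%:E * G y) x = c%:E * riesz_op eta G x)%E.
Proof.
move=> c0 mG G0; rewrite /riesz_op -ge0_integralZl_EFin//.
- by apply: eq_integral => y _; rewrite muleCA.
- by move=> y _; exact: riesz_integrand_ge0.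
- exact: measurable_riesz_integrand.
Qed.

Lemma measurable_npow_mul (s : R) G : measurable_fun setT G ->
  measurable_fun setT (fun y => (npow s y)%:E * G y)%E.
Proof.
by move=> mG; apply: emeasurable_funM => //; apply/measurable_EFinP; exact: measurable_npowT.
Qed.

Lemma npow_mul_ge0 (s : R) G y : (0 <= G y)%E -> (0 <= (npow s y)%:E * G y)%E.
Proof. by move=> G0; rewrite mule_ge0// lee_fin npow_ge0. Qed.

(** Positive operator majorizing the modulus of the potential of a u, the 2 being that of
    [cabs_cintegral_le]. With extended real values it is meaningful before any convergence is
    known. *)
Definition hardy_op G x : \bar R :=
  ((2 * kappa * cabs la)%:E * riesz_op eta (fun y => (npow (- al) y)%:E * G y) x)%E.

Lemma two_kappa_ge0 : 0 <= 2 * kappa.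
Proof. by rewrite mulr_ge0// ltW// riesz_constant_gt0. Qed.

Lemma hardy_cst_ge0 : 0 <= 2 * kappa * cabs la.
Proof. by rewrite mulr_ge0 ?two_kappa_ge0 ?cabs_ge0. Qed.

Lemma hardy_op_ge0 G x : (forall y, 0 <= G y)%E -> (0 <= hardy_op G x)%E.
Proof.
move=> G0; rewrite mule_ge0 ?lee_fin ?hardy_cst_ge0//.
by apply: riesz_op_ge0 => y; exact: npow_mul_ge0.
Qed.

Lemma measurable_hardy_op G : measurable_fun setT G -> (forall y, 0 <= G y)%E ->
  measurable_fun setT (hardy_op G).
Proof.
move=> mG G0; apply: emeasurable_funM; first exact: measurable_cst.
apply: measurable_riesz_op; first exact: measurable_npow_mul.
by move=> y; exact: npow_mul_ge0.
Qed.

Lemma hardy_opD G1 G2 x : measurable_fun setT G1 -> measurable_fun setT G2 ->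
  (forall y, 0 <= G1 y)%E -> (forall y, 0 <= G2 y)%E ->
  (hardy_op (fun y => G1 y + G2 y) x = hardy_op G1 x + hardy_op G2 x)%E.
Proof.
move=> mG1 mG2 G10 G20.
have n10 y : (0 <= (npow (- al) y)%:E * G1 y)%E by exact: npow_mul_ge0.
have n20 y : (0 <= (npow (- al) y)%:E * G2 y)%E by exact: npow_mul_ge0.
rewrite /hardy_op -ge0_muleDr; last 2 first.
- exact: riesz_op_ge0.
- exact: riesz_op_ge0.
rewrite -riesz_opD//; try exact: measurable_npow_mul.
congr (_ * riesz_op _ _ _)%E; apply/funext => y.
by rewrite ge0_muleDr.
Qed.

Lemma le_hardy_op G1 G2 x : measurable_fun setT G1 -> measurable_fun setT G2 ->
  (forall y, 0 <= G1 y)%E -> (forall y, 0 <= G2 y)%E ->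
  {ae mu, forall y, (G1 y <= G2 y)%E} -> (hardy_op G1 x <= hardy_op G2 x)%E.
Proof.
move=> mG1 mG2 G10 G20 GG; apply: lee_wpmul2l.
  by rewrite lee_fin hardy_cst_ge0.
apply: le_riesz_op.
- exact: measurable_npow_mul.
- exact: measurable_npow_mul.
- by move=> y; exact: npow_mul_ge0.
- by move=> y; exact: npow_mul_ge0.
- move: GG; apply: filterS => y GG; apply: lee_wpmul2l => //.
  by rewrite lee_fin npow_ge0.
Qed.

Definition pot_mul g y : R[i] := a y * g y.

Lemma cmeasurable_potential g : cmeasurable g -> cmeasurable (pot_mul g).
Proof. by apply: cmeasurableM; exact: cmeasurable_hardy. Qed.

Lemma cmod_potential g y :
  (cmod (pot_mul g) y = (cabs la)%:E * ((npow (- al) y)%:E * cmod g y))%E.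
Proof. by rewrite /cmod /pot_mul cabsM cabs_hardy -!EFinM mulrA. Qed.

Lemma riesz_op_potential g x : cmeasurable g ->
  ((2 * kappa)%:E * riesz_op eta (cmod (pot_mul g)) x = hardy_op (cmod g) x)%E.
Proof.
move=> mg; rewrite /hardy_op (EFinM _ (cabs la)) -muleA; congr (_ * _)%E.
rewrite -riesz_opZ ?cabs_ge0//.
- by congr (riesz_op _ _ _); apply/funext => y; exact: cmod_potential.
- by apply: measurable_npow_mul; exact: measurable_cmod.
- by move=> y; apply: npow_mul_ge0; exact: cmod_ge0.
Qed.

Lemma cmod_inv_frac_laplacian_le g x : cmeasurable g ->
  (cmod (inv_frac_laplacian al g) x <= (2 * kappa)%:E * riesz_op eta (cmod g) x)%E.
Proof.
move=> mg; have k0 := riesz_constant_gt0 n al.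
rewrite /cmod /inv_frac_laplacian cabsM cabs_real ger0_norm ?(ltW k0)//.
rewrite EFinM (mulrC 2) (EFinM kappa 2) -muleA.
apply: lee_wpmul2l; first by rewrite lee_fin ltW.
exact: cabs_riesz_potential_le.
Qed.

Variable f : 'rV[R]_n -> R[i].
Hypothesis mf : cmeasurable f.

Definition source_op x : \bar R := ((2 * kappa)%:E * riesz_op eta (cmod f) x)%E.

Lemma source_op_ge0 x : (0 <= source_op x)%E.
Proof.
rewrite mule_ge0 ?lee_fin ?two_kappa_ge0//; apply: riesz_op_ge0 => y.
exact: cmod_ge0.
Qed.

Lemma measurable_source_op : measurable_fun setT source_op.
Proof.
apply: emeasurable_funM; first exact: measurable_cst.
by apply: measurable_riesz_op; [exact: measurable_cmod|move=> y; exact: cmod_ge0].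
Qed.

Definition rhs g y := pot_mul g y + f y.

Lemma cmeasurable_rhs g : cmeasurable g -> cmeasurable (rhs g).
Proof. by move=> mg; apply: cmeasurableD => //; exact: cmeasurable_potential. Qed.

Lemma cmod_rhs_le g y : (cmod (rhs g) y <= cmod (pot_mul g) y + cmod f y)%E.
Proof. by rewrite -EFinD lee_fin cabsD. Qed.

Lemma riesz_op_rhs_le g G x : cmeasurable g -> measurable_fun setT G ->
  (forall y, 0 <= G y)%E -> {ae mu, forall y, (cmod g y <= G y)%E} ->
  ((2 * kappa)%:E * riesz_op eta (cmod (rhs g)) x <= source_op x + hardy_op G x)%E.
Proof.
move=> mg mG G0 gG; have mag := cmeasurable_potential mg.
apply: (@le_trans _ _ (source_op x + hardy_op (cmod g) x)%E); last first.
  apply: leeD => //; apply: le_hardy_op => //; first exact: measurable_cmod.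
  by move=> y; exact: cmod_ge0.
rewrite -riesz_op_potential// /source_op -ge0_muleDr; last 2 first.
- by apply: riesz_op_ge0 => y; exact: cmod_ge0.
- by apply: riesz_op_ge0 => y; exact: cmod_ge0.
apply: lee_wpmul2l; first by rewrite lee_fin two_kappa_ge0.
rewrite addeC -riesz_opD; last 4 first.
- exact: measurable_cmod.
- exact: measurable_cmod.
- by move=> y; exact: cmod_ge0.
- by move=> y; exact: cmod_ge0.
apply: le_riesz_op.
- by apply: measurable_cmod; exact: cmeasurable_rhs.
- by apply: emeasurable_funD; exact: measurable_cmod.
- by move=> y; exact: cmod_ge0.
- by move=> y; apply: adde_ge0; exact: cmod_ge0.
- by apply/aeW => y; exact: cmod_rhs_le.
Qed.

Lemma riesz_op_fin g x : ((2 * kappa)%:E * riesz_op eta (cmod g) x < +oo)%E ->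
  (riesz_op eta (cmod g) x < +oo)%E.
Proof.
have k0 : 0 < 2 * kappa by rewrite mulr_gt0// riesz_constant_gt0.
rewrite !ltey; apply: contra => /eqP ->.
by rewrite gt0_muley// lte_fin.
Qed.

Lemma inv_frac_laplacianB g1 g2 x :
  cintegrable (riesz_integrand al g1 x) -> cintegrable (riesz_integrand al g2 x) ->
  inv_frac_laplacian al g1 x - inv_frac_laplacian al g2 x =
  inv_frac_laplacian al (fun y => g1 y - g2 y) x.
Proof.
move=> i1 i2; rewrite /inv_frac_laplacian -mulrBr; congr (_ * _).
rewrite /riesz_potential -cintegralB//; congr cintegral.
by apply/funext => y; rewrite !riesz_integrandE mulrBr.
Qed.

Fixpoint majorant (k : nat) : 'rV[R]_n -> \bar R :=
  if k is k'.+1 then fun x => (source_op x + hardy_op (majorant k') x)%E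
  else fun=> 0%E.

Lemma majorant_ge0 k x : (0 <= majorant k x)%E.
Proof.
elim: k x => [|k ih] x //=.
by apply: adde_ge0; [exact: source_op_ge0|exact: hardy_op_ge0].
Qed.

Lemma measurable_majorant k : measurable_fun setT (majorant k).
Proof.
elim: k => [|k ih] /=; first exact: measurable_cst.
apply: emeasurable_funD; first exact: measurable_source_op.
by apply: measurable_hardy_op => // y; exact: majorant_ge0.
Qed.

Lemma majorant_nd x : {homo majorant ^~ x : j k / (j <= k)%N >-> (j <= k)%E}.
Proof.
apply/nondecreasing_seqP => k; elim: k x => [|k ih] x.
  exact: majorant_ge0.
apply: leeD => //; apply: le_hardy_op.
- exact: measurable_majorant.
- exact: (measurable_majorant k.+1).
- by move=> y; exact: majorant_ge0.
- by move=> y; exact: (majorant_ge0 k.+1).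
- by apply/aeW => y; exact: ih.
Qed.

Definition majorant_lim x : \bar R := limn (majorant ^~ x).

Lemma majorant_cvg x : majorant ^~ x @ \oo --> majorant_lim x.
Proof. by apply: ereal_nondecreasing_is_cvgn; exact: majorant_nd. Qed.

Lemma majorant_limE x : majorant_lim x = ereal_sup (range (majorant ^~ x)).
Proof.
by apply/cvg_lim => //; apply: ereal_nondecreasing_cvgn; exact: majorant_nd.
Qed.

Lemma majorant_le k x : (majorant k x <= majorant_lim x)%E.
Proof. by rewrite majorant_limE; apply: ereal_sup_ubound; exists k. Qed.

Lemma majorant_lim_ge0 x : (0 <= majorant_lim x)%E.
Proof. exact: le_trans (majorant_ge0 0 x) (majorant_le 0 x). Qed.

Lemma measurable_majorant_lim : measurable_fun setT majorant_lim.
Proof.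
apply: (@emeasurable_fun_cvg _ _ R setT majorant majorant_lim).
  by move=> k; exact: measurable_majorant.
by move=> x _; exact: majorant_cvg.
Qed.

Lemma majorant_lim_lt x (s : R) : (s%:E < majorant_lim x)%E ->
  exists k, (s%:E < majorant k x)%E.
Proof. by rewrite majorant_limE => /ereal_sup_gt[_ [k _ <-]] ?; exists k. Qed.

(** Monotone convergence passes to the limit in the recursion. Where the limit U is finite, the
    potentials of |f| and of |lambda| |x|^-alpha U are therefore finite, which is the source of the
    integrability statements below. *)
Lemma majorant_lim_super x : (source_op x + hardy_op majorant_lim x <= majorant_lim x)%E.
Proof.
have c0 := hardy_cst_ge0.
pose h k y := ((dpow (- eta) x y)%:E * ((npow (- al) y)%:E * majorant k y))%E.
have dn0 y : 0 <= dpow (- eta) x y * npow (- al) y by rewrite mulr_ge0 ?dpow_ge0 ?npow_ge0.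
have h0 k y : (0 <= h k y)%E.
  apply: (riesz_integrand_ge0 _ (G := fun y => ((npow (- al) y)%:E * majorant k y)%E)).
  by apply: npow_mul_ge0; exact: majorant_ge0.
have hE : (riesz_op eta (fun y => (npow (- al) y)%:E * majorant_lim y) x =
    limn (fun k => \int[mu]_y h k y))%E.
  rewrite -monotone_convergence; last 4 first.
  - exact: measurableT.
  - move=> k; apply: measurable_riesz_integrand; apply: measurable_npow_mul.
    exact: measurable_majorant.
  - by move=> k y _; exact: h0.
  - move=> y _ j k jk; rewrite /h !muleA -!EFinM; apply: lee_wpmul2l.
      by rewrite lee_fin.
    exact: majorant_nd.
  apply: eq_integral => y _; apply/esym/cvg_lim => //.
  rewrite /h muleA -EFinM; under eq_fun do rewrite muleA -EFinM.
  apply: cvgeZl => //; exact: majorant_cvg.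
have ndh : nondecreasing_seq (fun k => \int[mu]_y h k y)%E.
  move=> j k jk; apply: ge0_le_integral.
  - exact: measurableT.
  - by move=> y _; exact: h0.
  - by apply: measurable_riesz_integrand; apply: measurable_npow_mul; exact: measurable_majorant.
  - by apply: measurable_riesz_integrand; apply: measurable_npow_mul; exact: measurable_majorant.
  - move=> y _; rewrite /h !muleA -!EFinM; apply: lee_wpmul2l; first by rewrite lee_fin.
    exact: majorant_nd.
rewrite /hardy_op hE.
have cv : (source_op x + (2 * kappa * cabs la)%:E * \int[mu]_y h k y @[k --> \oo] -->
    source_op x + (2 * kappa * cabs la)%:E * limn (fun k => \int[mu]_y h k y))%E.
  apply: cvgeD.
  - by rewrite ge0_adde_def// inE ?source_op_ge0// mule_ge0// lime_ge//;
      [exact: ereal_nondecreasing_is_cvgn|apply: nearW => k; apply: integral_ge0 => y _;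
       exact: h0].
  - exact: cvg_cst.
  - by apply: cvgeZl => //; exact: ereal_nondecreasing_is_cvgn.
rewrite -(cvg_lim _ cv)//; apply: lime_le; first by apply/cvg_ex; eexists; exact: cv.
by apply: nearW => k; exact: majorant_le k.+1 x.
Qed.

Fixpoint iterate (k : nat) : 'rV[R]_n -> R[i] :=
  if k is k'.+1 then inv_frac_laplacian al (rhs (iterate k')) else fun=> 0%R.

Lemma cmeasurable_inv_frac_laplacian g : cmeasurable g ->
  cmeasurable (inv_frac_laplacian al g).
Proof. by move=> mg; apply: cmeasurable_scale; exact: cmeasurable_riesz_potential. Qed.

Lemma cmeasurable_iterate k : cmeasurable (iterate k).
Proof.
elim: k => [|k ih] /=; first by split; exact: measurable_cst.
by apply: cmeasurable_inv_frac_laplacian; exact: cmeasurable_rhs.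
Qed.

Lemma iterate_le k x : (cmod (iterate k) x <= majorant k x)%E.
Proof.
elim: k x => [|k ih] x; first by rewrite /cmod [iterate 0 x]/= cabs0.
apply: le_trans (cmod_inv_frac_laplacian_le _ _) _.
  by apply: cmeasurable_rhs; exact: cmeasurable_iterate.
apply: riesz_op_rhs_le.
- exact: cmeasurable_iterate.
- exact: measurable_majorant.
- by move=> y; exact: majorant_ge0.
- by apply/aeW.
Qed.

Lemma iterate_integrable k x : (majorant_lim x < +oo)%E ->
  cintegrable (riesz_integrand al (rhs (iterate k)) x).
Proof.
move=> Ux; have mS := cmeasurable_iterate k.
apply: cintegrable_riesz; first exact: cmeasurable_rhs.
apply: riesz_op_fin; apply: le_lt_trans Ux; apply: le_trans (majorant_le k.+1 x).
apply: riesz_op_rhs_le => //.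
- exact: measurable_majorant.
- by move=> y; exact: majorant_ge0.
- by apply/aeW => y; exact: iterate_le.
Qed.

Hypothesis majorant_fin : {ae mu, forall x, (majorant_lim x < +oo)%E}.

Definition increment k y : R[i] := iterate k.+1 y - iterate k y.

(** Written additively to avoid differences of extended reals. Subtracting two consecutive equations
    at [x] uses absolute convergence there, hence the finiteness of the limit at [x]; under the
    integral the induction hypothesis holds almost everywhere. *)
Lemma iterate_diff k x : (majorant_lim x < +oo)%E ->
  (cmod (increment k) x + majorant k x <= majorant k.+1 x)%E.
Proof.
elim: k x => [|k ih] x Ux.
  rewrite adde0; apply: le_trans (iterate_le 1 x).
  by rewrite /cmod /increment subr0.
pose D := increment k.
have mD : cmeasurable D by apply: cmeasurableB; exact: cmeasurable_iterate.
have mcD := measurable_cmod mD.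
have step : (cmod (increment k.+1) x <= hardy_op (cmod D) x)%E.
  rewrite -riesz_op_potential//.
  apply: le_trans (cmod_inv_frac_laplacian_le x (cmeasurable_potential mD)).
  have DE : increment k.+1 x = inv_frac_laplacian al (rhs (iterate k.+1)) x -
    inv_frac_laplacian al (rhs (iterate k)) x by [].
  rewrite {1}/cmod DE.
  rewrite inv_frac_laplacianB; [|exact: iterate_integrable|exact: iterate_integrable].
  rewrite (_ : (fun y => _) = pot_mul D)//.
  by apply/funext => y; rewrite /rhs /pot_mul /D /increment /=; ring.
apply: le_trans (leeD step (lexx _)) _.
rewrite [majorant k.+1 x]/= [majorant k.+2 x]/= addeCA; apply: leeD => //.
rewrite -hardy_opD//; last 3 first.
- exact: measurable_majorant.
- by move=> y; exact: cmod_ge0.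
- by move=> y; exact: majorant_ge0.
apply: le_hardy_op.
- by apply: emeasurable_funD => //; exact: measurable_majorant.
- exact: (measurable_majorant k.+1).
- by move=> y; apply: adde_ge0; [exact: cmod_ge0|exact: majorant_ge0].
- by move=> y; exact: (majorant_ge0 k.+1).
- by move: majorant_fin; apply: filterS => y; exact: ih.
Qed.

End neumann_iteration.

(** * Real sequences with dominated increments *)

Section dominated_increments.
Context (R : realType).
Implicit Types (r w : R^nat) (M : R).

(** Both w and r + w are nondecreasing and bounded, and r is their difference. *)
Lemma cvgn_dominated_increments r w M : (forall k, w k <= M) ->
  (forall k, `|r k.+1 - r k| + w k <= w k.+1) -> (forall k, `|r k| <= M) -> cvgn r.
Proof.
move=> wM rw rM.
have ndw : nondecreasing_seq w.
  by apply/nondecreasing_seqP => k; have := rw k; have := normr_ge0 (r k.+1 - r k); lra.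
have cw : cvgn w by apply: nondecreasing_is_cvgn => //; exists M => _ [k _ <-].
have crw : cvgn (fun k => r k + w k).
  apply: nondecreasing_is_cvgn.
    apply/nondecreasing_seqP => k; have := rw k.
    by have := ler_norm (- (r k.+1 - r k)); rewrite normrN; lra.
  exists (M + M) => _ [k _ <-]; apply: lerD => //.
  exact: le_trans (ler_norm _) (rM k).
rewrite (_ : r = (fun k => r k + w k) \- w); last by apply/funext => k /=; rewrite addrK.
exact: is_cvgB.
Qed.

Lemma norm_limn_le r M : cvgn r -> (forall k, `|r k| <= M) -> `|limn r| <= M.
Proof.
move=> cr rM; rewrite -lim_norm//; apply: limr_le; first exact: is_cvg_norm.
exact: nearW.
Qed.

End dominated_increments.

(** * The limit of the Picard iterates *)

Section neumann_solution.
Context (R : realType) (n : nat).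
Variables (al : R) (la : R[i]) (f : 'rV[R]_n -> R[i]).
Hypothesis mf : cmeasurable f.
Implicit Types (x y : 'rV[R]_n).
Local Open Scope complex_scope.
Local Notation mu := (lebesgue_rV R n).
Local Notation Re := (@complex.Re R).
Local Notation Im := (@complex.Im R).
Local Notation kappa := (riesz_constant n al).
Local Notation eta := (n%:R - al : R).
Local Notation W := (majorant al la f).
Local Notation U := (majorant_lim al la f).
Local Notation S := (iterate al la f).
Hypothesis majorant_fin : {ae mu, forall x, (U x < +oo)%E}.

(** Set to 0 on the null set where the majorant is infinite, so that measurability and the bound by
    U + U hold at every point. *)
Definition solution x : R[i] :=
  (if (U x < +oo)%E then limn (fun k => Re (S k x)) else 0) +i*
  (if (U x < +oo)%E then limn (fun k => Im (S k x)) else 0).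

Lemma iterate_cvg (phi : R[i] -> R) x : (forall z w, phi (z - w) = phi z - phi w) ->
  (forall z, `|phi z| <= cabs z) -> (U x < +oo)%E ->
  cvgn (fun k => phi (S k x)) /\ (`|limn (fun k => phi (S k x))|%:E <= U x)%E.
Proof.
move=> phiB phile Ux.
have UE : U x = (fine (U x))%:E by rewrite fineK// ge0_fin_numE// majorant_lim_ge0.
have WE k : W k x = (fine (W k x))%:E.
  rewrite fineK// ge0_fin_numE ?majorant_ge0//.
  by apply: le_lt_trans Ux; exact: majorant_le.
have SM k : `|phi (S k x)| <= fine (U x).
  rewrite -lee_fin -UE; apply: le_trans (majorant_le al la mf k x).
  by apply: le_trans (iterate_le al la mf k x); rewrite lee_fin.
have c : cvgn (fun k => phi (S k x)).
  apply: (@cvgn_dominated_increments _ _ (fun k => fine (W k x)) (fine (U x))) => //.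
    by move=> k; rewrite -lee_fin -UE -WE; exact: majorant_le.
  move=> k; rewrite -lee_fin EFinD -!WE.
  apply: le_trans (iterate_diff mf majorant_fin k Ux).
  by apply: leeD => //; rewrite lee_fin -phiB; exact: phile.
split => //; rewrite UE lee_fin; exact: norm_limn_le.
Qed.

Lemma iterate_cvg_Re x : (U x < +oo)%E ->
  cvgn (fun k => Re (S k x)) /\ (`|limn (fun k => Re (S k x))|%:E <= U x)%E.
Proof. by apply: iterate_cvg; [exact: ReB|exact: Re_le_cabs]. Qed.

Lemma iterate_cvg_Im x : (U x < +oo)%E ->
  cvgn (fun k => Im (S k x)) /\ (`|limn (fun k => Im (S k x))|%:E <= U x)%E.
Proof. by apply: iterate_cvg; [exact: ImB|exact: Im_le_cabs]. Qed.

Lemma Re_solution x : (U x < +oo)%E -> (fun k => Re (S k x)) @ \oo --> Re (solution x).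
Proof. by move=> Ux; rewrite /= Ux; have [] := iterate_cvg_Re Ux. Qed.

Lemma Im_solution x : (U x < +oo)%E -> (fun k => Im (S k x)) @ \oo --> Im (solution x).
Proof. by move=> Ux; rewrite /= Ux; have [] := iterate_cvg_Im Ux. Qed.

Lemma cmod_solution_le x : (cmod solution x <= U x + U x)%E.
Proof.
have [Ux|] := ltP (U x) +oo%E; last by rewrite leye_eq => /eqP ->; rewrite leey.
apply: (@le_trans _ _ (`|Re (solution x)|%:E + `|Im (solution x)|%:E)%E).
  by rewrite -EFinD lee_fin cabs_le_ReIm.
rewrite /= Ux; apply: leeD.
  by have [] := iterate_cvg_Re Ux.
by have [] := iterate_cvg_Im Ux.
Qed.

Lemma cmeasurable_solution : cmeasurable solution.
Proof.
have mU : measurable_fun setT (fun x => (U x < +oo)%E).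
  by apply: measurable_fun_lte => //; exact: measurable_majorant_lim.
have aux (phi : R[i] -> R) : (forall k, measurable_fun setT (fun x => phi (S k x))) ->
    (forall x, (U x < +oo)%E -> cvgn (fun k => phi (S k x))) ->
    measurable_fun setT
      (fun x => if (U x < +oo)%E then limn (fun k => phi (S k x)) else 0%R).
  move=> mphi cphi.
  apply: (@measurable_fun_cvg _ _ R setT
    (fun k x => if (U x < +oo)%E then phi (S k x) else 0%R)).
    by move=> k; apply: measurable_fun_ifT.
  move=> x _; case: ifPn => Ux; [exact: cphi|exact: cvg_cst].
split.
- apply: (aux Re) => [k|x /iterate_cvg_Re[]//].
  by have [] := cmeasurable_iterate al la mf k.
- apply: (aux Im) => [k|x /iterate_cvg_Im[]//].
  by have [] := cmeasurable_iterate al la mf k.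
Qed.

(** Common majorant of the moduli of the right-hand sides a S_k + f; by [majorant_lim_super] its
    Riesz potential at x, multiplied by 2 kappa, is at most U(x). *)
Let dom y : \bar R := (cmod f y + (cabs la)%:E * ((npow (- al) y)%:E * U y))%E.

Let nU0 y : (0 <= (npow (- al) y)%:E * U y)%E.
Proof. by apply: npow_mul_ge0; exact: majorant_lim_ge0. Qed.

Let dom0 y : (0 <= dom y)%E.
Proof. by apply: adde_ge0; [exact: cmod_ge0|rewrite mule_ge0// lee_fin cabs_ge0]. Qed.

Let mnU : measurable_fun setT (fun y => (npow (- al) y)%:E * U y)%E.
Proof. by apply: measurable_npow_mul; exact: measurable_majorant_lim. Qed.

Let mclU : measurable_fun setT (fun y => (cabs la)%:E * ((npow (- al) y)%:E * U y))%E.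
Proof. by apply: emeasurable_funM => //; exact: measurable_cst. Qed.

Let mdom : measurable_fun setT dom.
Proof. by apply: emeasurable_funD => //; exact: measurable_cmod. Qed.

Let dom_fin x : (U x < +oo)%E -> (riesz_op eta dom x < +oo)%E.
Proof.
move=> Ux; have k0 : 0 < 2 * kappa by rewrite mulr_gt0// riesz_constant_gt0.
have : ((2 * kappa)%:E * riesz_op eta dom x < +oo)%E.
  apply: le_lt_trans Ux; apply: le_trans (majorant_lim_super al la mf x).
  rewrite /source_op /hardy_op (EFinM _ (cabs la)) -muleA -(riesz_opZ _ _ (cabs_ge0 la) mnU nU0).
  rewrite -ge0_muleDr; last 2 first.
  - by apply: riesz_op_ge0 => y; exact: cmod_ge0.
  - by apply: riesz_op_ge0 => y; rewrite mule_ge0// lee_fin cabs_ge0.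
  rewrite -riesz_opD//.
  - exact: measurable_cmod.
  - by move=> y; exact: cmod_ge0.
  - by move=> y; rewrite mule_ge0// lee_fin cabs_ge0.
rewrite !ltey; apply: contra => /eqP ->.
by rewrite gt0_muley// lte_fin.
Qed.

Let solution_rhs_le x y k : (cmod (riesz_integrand al (rhs al la f (S k)) x) y <=
  (dpow (- eta) x y)%:E * dom y)%E.
Proof.
rewrite cmod_riesz_integrand; apply: lee_wpmul2l; first by rewrite lee_fin dpow_ge0.
apply: le_trans (cmod_rhs_le _ _ _ _ _) _; rewrite addeC; apply: leeD => //.
rewrite cmod_potential; apply: lee_wpmul2l; first by rewrite lee_fin cabs_ge0.
apply: lee_wpmul2l; first by rewrite lee_fin npow_ge0.
by apply: le_trans (iterate_le al la mf k y) _; exact: majorant_le.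
Qed.

Lemma solution_integrable x : (U x < +oo)%E ->
  cintegrable (riesz_integrand al (rhs al la f solution) x).
Proof.
move=> Ux; have ms := cmeasurable_solution.
have mU := measurable_majorant_lim al la mf.
have U0 y : (0 <= U y)%E by exact: majorant_lim_ge0.
apply: cintegrable_riesz; first exact: cmeasurable_rhs.
apply: riesz_op_fin.
apply: le_lt_trans (riesz_op_rhs_le al la mf (G := fun y => (U y + U y)%E) x _ _ _ _) _ => //.
- exact: emeasurable_funD.
- by move=> y; exact: adde_ge0.
- by apply/aeW => y; exact: cmod_solution_le.
(* The bound U + U produces [hardy_op] of U twice: once together with the source, once alone, each
   at most U(x). *)
rewrite hardy_opD// addeA; apply: lte_add_pinfty.
  by apply: le_lt_trans (majorant_lim_super al la mf x) Ux.
apply: le_lt_trans Ux; apply: le_trans (majorant_lim_super al la mf x).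
by rewrite leeDr// source_op_ge0.
Qed.

Lemma solution_fixpoint x : (U x < +oo)%E ->
  solution x = inv_frac_laplacian al (rhs al la f solution) x.
Proof.
move=> Ux; have ms := cmeasurable_solution.
have mrs := cmeasurable_riesz_integrand al x (cmeasurable_rhs al la mf ms).
have mrS k := cmeasurable_riesz_integrand al x
  (cmeasurable_rhs al la mf (cmeasurable_iterate al la mf k)).
have domI : mu.-integrable setT (fun y => (dpow (- eta) x y)%:E * dom y)%E.
  apply/integrableP; split; first exact: measurable_riesz_integrand.
  under eq_integral => y _ do rewrite gee0_abs ?riesz_integrand_ge0//.
  exact: dom_fin.
have aux (phi : R[i] -> R) (l : R) : (forall z, `|phi z| <= cabs z) ->
    measurable_fun setT (fun y => phi (riesz_integrand al (rhs al la f solution) x y)) ->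
    (forall k, measurable_fun setT
       (fun y => phi (riesz_integrand al (rhs al la f (S k)) x y))) ->
    l = kappa * Rintegral mu setT
       (fun y => phi (riesz_integrand al (rhs al la f solution) x y)) ->
    (forall y, (U y < +oo)%E ->
       (fun k => phi (riesz_integrand al (rhs al la f (S k)) x y)) @ \oo -->
       phi (riesz_integrand al (rhs al la f solution) x y)) ->
    (fun k => kappa * Rintegral mu setT
       (fun y => phi (riesz_integrand al (rhs al la f (S k)) x y))) @ \oo --> l.
  move=> phile mphi mphiS -> cphi.
  have cphi' : {ae mu, forall y, [set: 'rV[R]_n] y ->
      (phi (riesz_integrand al (rhs al la f (S k)) x y))%:E @[k --> \oo] -->
      (phi (riesz_integrand al (rhs al la f solution) x y))%:E}.
    move: majorant_fin; apply: filterS => y Uy _.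
    by apply: cvg_EFin; [exact: nearW|exact: cphi].
  have bphi : {ae mu, forall y, forall k, [set: 'rV[R]_n] y ->
      (`|(phi (riesz_integrand al (rhs al la f (S k)) x y))%:E| <=
       (dpow (- eta) x y)%:E * dom y)%E}.
    apply/aeW => y k _; apply: le_trans (solution_rhs_le x y k).
    by rewrite lee_fin.
  have [I0 _ cI] := dominated_convergence measurableT
    (fun k => (measurable_EFinP _ _).2 (mphiS k)) ((measurable_EFinP _ _).2 mphi)
    cphi' domI bphi.
  apply: cvgMr; apply: fine_cvg; rewrite fineK//.
  exact: integrable_fin_num.
have shift (g : R^nat) (l : R) : g @ \oo --> l -> (fun k => g k.+1) @ \oo --> l.
  by rewrite -(cvg_shiftS g).
(* A common form for both parts of a product: (phi, psi, e) is (Re, Im, -1) or (Im, Re, 1). *)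
have pw (phi psi : R[i] -> R) (e : R) :
    (forall z w, phi (z + w) = phi z + phi w) ->
    (forall z w, phi (z * w) = phi z * Re w + e * psi z * Im w) ->
    (forall (c : R) z, phi (c%:C * z) = c * phi z) ->
    forall y, (U y < +oo)%E ->
    (fun k => phi (riesz_integrand al (rhs al la f (S k)) x y)) @ \oo -->
    phi (riesz_integrand al (rhs al la f solution) x y).
  move=> phiD phiM phiZ y Uy; rewrite riesz_integrandE phiZ.
  under eq_fun do rewrite riesz_integrandE phiZ.
  apply: cvgMr; rewrite phiD; under eq_fun do rewrite phiD.
  apply: cvgD; last exact: cvg_cst.
  rewrite /pot_mul phiM; under eq_fun do rewrite /pot_mul phiM.
  by apply: cvgD; apply: cvgMr; [exact: Re_solution|exact: Im_solution].
have lim_eq (g : R^nat) (l1 l2 : R) : g @ \oo --> l1 -> g @ \oo --> l2 -> l1 = l2.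
  by move=> h1 h2; rewrite -(cvg_lim (@Rhausdorff R) h1) (cvg_lim (@Rhausdorff R) h2).
apply: complex_eq.
- rewrite Re_scale; apply: (lim_eq _ _ _ (shift _ _ (Re_solution Ux))).
  rewrite (_ : (fun k => Re (S k.+1 x)) = (fun k => kappa * Rintegral mu setT
    (fun y => Re (riesz_integrand al (rhs al la f (S k)) x y)))).
    2: by apply/funext => k; exact: Re_scale.
  apply: (aux Re _ (@Re_le_cabs R) mrs.1 (fun k => (mrS k).1)); first by [].
  apply: (pw Re Im (-1)) => [z w|z w|c z].
  + exact: ReD.
  + by rewrite Re_mul mulN1r mulNr.
  + exact: Re_scale.
- rewrite Im_scale; apply: (lim_eq _ _ _ (shift _ _ (Im_solution Ux))).
  rewrite (_ : (fun k => Im (S k.+1 x)) = (fun k => kappa * Rintegral mu setT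
    (fun y => Im (riesz_integrand al (rhs al la f (S k)) x y)))).
    2: by apply/funext => k; exact: Im_scale.
  apply: (aux Im _ (@Im_le_cabs R) mrs.2 (fun k => (mrS k).2)); first by [].
  apply: (pw Im Re 1) => [z w|z w|c z].
  + exact: ImD.
  + by rewrite Im_mul mul1r addrC.
  + exact: Im_scale.
Qed.

End neumann_solution.

(** * Contraction in the weighted Lorentz space *)

Section contraction.
Context (R : realType) (n : nat).
Hypothesis n0 : (0 < n)%N.
Variables (be q : R) (rho : \bar R).
Hypotheses (q0 : 0 < q) (rho1 : (1 <= rho)%E).
Implicit Types (x y : 'rV[R]_n) (f u v : 'rV[R]_n -> R[i]) (G : 'rV[R]_n -> \bar R).
Local Notation mu := (lebesgue_rV R n).

Definition wnorm G : \bar R := lnorm mu q rho (fun x => (npow (- be) x)%:E * G x)%E.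

Lemma wnorm_ge0 G : (0 <= wnorm G)%E.
Proof. exact: lnorm_ge0. Qed.

Lemma wnorm_scale_ae : exists2 A : R, 0 < A & forall c G1 G2, 0 < c ->
  measurable_fun setT G1 -> measurable_fun setT G2 ->
  {ae mu, forall x, (G1 x <= c%:E * G2 x)%E} ->
  (wnorm G1 <= (A * c)%:E * wnorm G2)%E.
Proof.
have [A A0 HA] := lnorm_scale_ae mu q0 rho1; exists A => // c G1 G2 c0 mG1 mG2 GG.
apply: HA => //; try exact: measurable_npow_mul.
move: GG; apply: filterS => x GG; rewrite muleCA.
by apply: lee_wpmul2l => //; rewrite lee_fin npow_ge0.
Qed.

Lemma wnorm_add : exists2 A : R, 0 < A & forall G1 G2,
  measurable_fun setT G1 -> measurable_fun setT G2 ->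
  (forall x, 0 <= G1 x)%E -> (forall x, 0 <= G2 x)%E ->
  (wnorm (fun x => G1 x + G2 x)%E <= A%:E * maxe (wnorm G1) (wnorm G2))%E.
Proof.
have [A A0 HA] := lnorm_add mu q0 rho1; exists A => // G1 G2 mG1 mG2 G10 G20.
rewrite {1}/wnorm (_ : (fun x => _) =
  (fun x => (npow (- be) x)%:E * G1 x + (npow (- be) x)%:E * G2 x)%E).
  apply: HA; try exact: measurable_npow_mul.
    by move=> x; exact: npow_mul_ge0.
  by move=> x; exact: npow_mul_ge0.
by apply/funext => x; rewrite ge0_muleDr.
Qed.

Lemma wnorm_fin_ae G : measurable_fun setT G -> (forall x, 0 <= G x)%E ->
  (wnorm G < +oo)%E -> {ae mu, forall x, (G x < +oo)%E}.
Proof.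
move=> mG G0 Gfin.
have := lnorm_fin_ae q0 rho1 (measurable_npow_mul (- be) mG) Gfin.
apply: filterS2 (ae_neq0 R n0) => x x0; rewrite !ltey; apply: contra => /eqP ->.
by rewrite gt0_muley// lte_fin npowE powR_gt0// enorm_gt0.
Qed.

Lemma wnorm_eq0_ae G : measurable_fun setT G -> (forall x, 0 <= G x)%E ->
  wnorm G = 0%E -> {ae mu, forall x, G x = 0%E}.
Proof.
move=> mG G0 Gz.
have := lnorm_eq0_ae q0 rho1 (measurable_npow_mul (- be) mG)
  (fun x => npow_mul_ge0 (- be) (G0 x)) Gz.
apply: filterS2 (ae_neq0 R n0) => x x0 /eqP; rewrite mule_eq0 => /orP[|/eqP//].
by rewrite eqe npowE gt_eqF// powR_gt0// enorm_gt0.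
Qed.

Variables (al : R) (la : R[i]) (A1 A2 th : R).
Hypotheses (A10 : 0 < A1) (A20 : 0 < A2) (th0 : 0 <= th).
Hypothesis scaleA2 : forall c G1 G2, 0 < c ->
  measurable_fun setT G1 -> measurable_fun setT G2 ->
  {ae mu, forall x, (G1 x <= c%:E * G2 x)%E} ->
  (wnorm G1 <= (A2 * c)%:E * wnorm G2)%E.
Hypothesis addA1 : forall G1 G2,
  measurable_fun setT G1 -> measurable_fun setT G2 ->
  (forall x, 0 <= G1 x)%E -> (forall x, 0 <= G2 x)%E ->
  (wnorm (fun x => G1 x + G2 x)%E <= A1%:E * maxe (wnorm G1) (wnorm G2))%E.
Hypothesis hardyth : forall G, measurable_fun setT G -> (forall x, 0 <= G x)%E ->
  (wnorm (hardy_op al la G) <= th%:E * wnorm G)%E.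

(** With s the norm of the source and M = A1 + A2, a bound M s for one iterate gives A1 max(s, th M
    s) <= M s for the next. The summand A2 covers the start, where 0 is compared with the source
    through [scaleA2]. The Fatou property concludes. *)
Lemma wnorm_majorant_lim f : cmeasurable f -> A1 * th <= 1 ->
  (wnorm (majorant_lim al la f) <= (A1 + A2)%:E * wnorm (source_op al f))%E.
Proof.
move=> mf A1th; set s := wnorm (source_op al f).
have s0 : (0 <= s)%E by exact: wnorm_ge0.
have M0 : (0 <= (A1 + A2)%:E * s)%E by rewrite mule_ge0// lee_fin addr_ge0 ?ltW.
have W k : (wnorm (majorant al la f k) <= (A1 + A2)%:E * s)%E.
  elim: k => [|k ih].
    apply: (@le_trans _ _ ((A2 * 1)%:E * s)%E).
      apply: scaleA2 => //.
      - exact: measurable_majorant.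
      - exact: measurable_source_op.
      - by apply/aeW => x; rewrite mul1e source_op_ge0.
    by apply: lee_wpmul2r => //; rewrite lee_fin mulr1 lerDr ltW.
  apply: le_trans (addA1 (G2 := hardy_op al la (majorant al la f k)) _ _ _ _) _.
  - exact: measurable_source_op.
  - apply: measurable_hardy_op; first exact: measurable_majorant.
    by move=> y; exact: majorant_ge0.
  - by move=> x; exact: source_op_ge0.
  - by move=> x; apply: hardy_op_ge0 => y; exact: majorant_ge0.
  rewrite maxe_pMr ?lee_fin ?(ltW A10)// ge_max; apply/andP; split.
    by apply: lee_wpmul2r => //; rewrite lee_fin lerDl ltW.
  apply: (@le_trans _ _ (A1%:E * (th%:E * ((A1 + A2)%:E * s)))%E).
    apply: lee_wpmul2l; first by rewrite lee_fin ltW.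
    apply: le_trans (hardyth _ _) _; first exact: measurable_majorant.
      by move=> y; exact: majorant_ge0.
    by apply: lee_wpmul2l; rewrite ?lee_fin.
  by rewrite muleA -EFinM -[leRHS]mul1e; apply: lee_wpmul2r.
apply: (lnorm_fatou q0 rho1 (U_ := fun k x => ((npow (- be) x)%:E * majorant al la f k x)%E)).
- by move=> k; apply: measurable_npow_mul; exact: measurable_majorant.
- move=> x j k jk; apply: lee_wpmul2l; first by rewrite lee_fin npow_ge0.
  exact: majorant_nd.
(* The weight may vanish at the origin; both weighted values are then 0, and any index will do. *)
- move=> x t; have [z|z] := eqVneq (npow (- be) x) 0.
    by move=> h; exists 0%N; move: h; rewrite z !mul0e.
  have np : 0 < npow (- be) x by rewrite lt_neqAle eq_sym z npow_ge0.
  rewrite -lte_pdivrMl// => /(majorant_lim_lt mf)[k hk].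
  by exists k; rewrite -lte_pdivrMl.
- by apply: measurable_npow_mul; exact: measurable_majorant_lim.
- exact: M0.
- exact: W.
Qed.

Lemma majorant_lim_fin_ae f : cmeasurable f -> A1 * th <= 1 ->
  (wnorm (source_op al f) < +oo)%E -> {ae mu, forall x, (majorant_lim al la f x < +oo)%E}.
Proof.
move=> mf A1th sfin; apply: wnorm_fin_ae.
- exact: measurable_majorant_lim.
- by move=> x; exact: majorant_lim_ge0.
apply: le_lt_trans (wnorm_majorant_lim mf A1th) _.
by apply: lte_mul_pinfty => //; rewrite lee_fin addr_ge0 ?ltW.
Qed.

Lemma wnorm_solution f : cmeasurable f -> A1 * th <= 1 ->
  {ae mu, forall x, (majorant_lim al la f x < +oo)%E} ->
  (wnorm (cmod (solution al la f)) <=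
   (A2 * 2 * (A1 + A2))%:E * wnorm (source_op al f))%E.
Proof.
move=> mf A1th Ufin; rewrite EFinM -muleA.
apply: (@le_trans _ _ ((A2 * 2)%:E * wnorm (majorant_lim al la f))%E).
  apply: scaleA2 => //.
  - by apply: measurable_cmod; exact: cmeasurable_solution.
  - exact: measurable_majorant_lim.
  - by apply/aeW => x; rewrite mule_natl mule2n; exact: cmod_solution_le.
apply: lee_wpmul2l; first by rewrite lee_fin mulr_ge0 ?ltW.
exact: wnorm_majorant_lim.
Qed.

(** Subtracting the two equations is legitimate by the absolute convergence contained in
    [mild_solution]. Finiteness of the norm of the difference, from the quasi-triangle inequality,
    is what turns the contraction estimate into vanishing. *)
Lemma mild_solution_uniq f u v : A2 * th < 1 ->
  cmeasurable u -> cmeasurable v ->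
  (wnorm (cmod u) < +oo)%E -> (wnorm (cmod v) < +oo)%E ->
  mild_solution al (hardy_potential al la) f u ->
  mild_solution al (hardy_potential al la) f v ->
  {ae mu, forall x, v x = u x}.
Proof.
move=> A2th mu_ mv ufin vfin solu solv.
pose w x := v x - u x.
have mw : cmeasurable w by exact: cmeasurableB.
have cu x : (0 <= cmod u x)%E by exact: cmod_ge0.
have cv x : (0 <= cmod v x)%E by exact: cmod_ge0.
have mcu := measurable_cmod mu_; have mcv := measurable_cmod mv.
have mcw := measurable_cmod mw.
have cw x : (0 <= cmod w x)%E by exact: cmod_ge0.
have wh : {ae mu, forall x, (cmod w x <= hardy_op al la (cmod w) x)%E}.
  move: solu solv; apply: filterS2 => x [iu uE] [iv vE].
  rewrite -riesz_op_potential//.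
  apply: le_trans (cmod_inv_frac_laplacian_le al x (cmeasurable_potential al la mw)).
  rewrite {1}/cmod {1}/w vE uE inv_frac_laplacianB//.
  rewrite (_ : (fun y => _) = pot_mul al la w)//.
  by apply/funext => y; rewrite /pot_mul /w; ring.
have wfin : (wnorm (cmod w) < +oo)%E.
  apply: (@le_lt_trans _ _ ((A2 * 1)%:E * wnorm (fun x => cmod v x + cmod u x)%E)%E).
    apply: scaleA2 => //; first exact: emeasurable_funD.
    by apply/aeW => x; rewrite mul1e -EFinD lee_fin cabsB.
  apply: lte_mul_pinfty; [by rewrite lee_fin mulr1 ltW|by []|].
  apply: le_lt_trans (addA1 mcv mcu cv cu) _.
  apply: lte_mul_pinfty; [by rewrite lee_fin ltW|by []|].
  by rewrite gt_max vfin ufin.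
have w0 := wnorm_ge0 (cmod w).
have wle : (wnorm (cmod w) <= (A2 * th)%:E * wnorm (cmod w))%E.
  rewrite EFinM -muleA; apply: (@le_trans _ _ ((A2 * 1)%:E * wnorm (hardy_op al la (cmod w)))%E).
    apply: scaleA2 => //; first exact: measurable_hardy_op.
    by move: wh; apply: filterS => x; rewrite mul1e.
  rewrite mulr1; apply: lee_wpmul2l; first by rewrite lee_fin ltW.
  exact: hardyth.
have wz : wnorm (cmod w) = 0%E.
  move: w0 wfin wle; case: (wnorm (cmod w)) => [r| |]//.
  rewrite -EFinM !lee_fin => r0 _ rle; congr (_%:E).
  by apply/eqP; rewrite eq_le r0 andbT -(pmulr_rle0 (x := 1 - A2 * th)) ?subr_gt0//
    mulrBl mul1r subr_le0.
have := wnorm_eq0_ae mcw cw wz; apply: filterS => x [/cabs_eq0 wx].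
by apply/eqP; rewrite -subr_eq0; apply/eqP.
Qed.

End contraction.

(** * Norm bounds for the source and Hardy operators *)

Section weighted_bounds.
Context (R : realType) (n : nat).
Hypothesis n0 : (0 < n)%N.
Local Notation N := (n%:R : R).
Variables (al be q : R) (rho : \bar R).
Hypotheses (al0 : 0 < al) (alN : al < N) (q1 : 1 < q) (rho1 : (1 <= rho)%E).
Hypotheses (bq : be < N / q) (bq' : N / q < be + (N - al)).
Implicit Types (f : 'rV[R]_n -> R[i]) (G : 'rV[R]_n -> \bar R).
Local Notation mu := (lebesgue_rV R n).

Let N0 : 0 < N. Proof. by rewrite ltr0n. Qed.
Let q0 : 0 < q. Proof. exact: lt_trans ltr01 q1. Qed.
Let eta0 : 0 < N - al < N. Proof. by rewrite subr_gt0 alN gtrBl. Qed.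
Let bqr : be < N * q^-1 < be + (N - al). Proof. by rewrite bq bq'. Qed.

(** With eta = N - alpha the homogeneity is N - (alpha - be - ga), strictly below N. *)
Lemma source_op_lorentz (ga p : R) : 0 < p -> 0 <= be + ga -> 0 < al - be - ga ->
  N / q < be + (N - al) + ga -> q^-1 = p^-1 - (al - be - ga) / N ->
  exists2 A : R, 0 < A & forall f, cmeasurable f ->
    (wnorm be q rho (source_op al f) <= A%:E * lorentz_norm p rho (weighted ga f))%E.
Proof.
move=> p0 bega om0 omq pq.
have [|||A A0 HA] := riesz_op_lorentz n0 p0 q0 rho1 eta0 bega _ _ bqr omq.
- by move: om0; lra.
- by left; move: om0; lra.
- by rewrite pq; field; rewrite !gt_eqF.
have [B B0 HB] := wnorm_scale_ae n be q0 rho1.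
have k0 : 0 < 2 * riesz_constant n al by rewrite mulr_gt0// riesz_constant_gt0.
exists (B * (2 * riesz_constant n al) * A); first by rewrite mulr_gt0// mulr_gt0.
move=> f mf; have mcf := measurable_cmod mf.
have cf0 y : (0 <= cmod f y)%E by exact: cmod_ge0.
apply: le_trans (HB _ _ (riesz_op (N - al) (cmod f)) k0 _ _ _) _.
- exact: measurable_source_op.
- exact: measurable_riesz_op.
- by apply/aeW.
rewrite (EFinM _ A) -muleA; apply: lee_wpmul2l.
  by rewrite lee_fin mulr_ge0 ?ltW.
apply: le_trans (HA _ mcf cf0) _; apply: lee_wpmul2l; first by rewrite lee_fin ltW.
rewrite lorentz_normE (_ : cmod (weighted ga f) =
  (fun y => (npow ga y)%:E * cmod f y)%E)//.
by apply/funext => y; exact: cmod_weighted.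
Qed.

(** Here p = q and ga = alpha - be. The homogeneity is exactly N, and be + ga = alpha > 0 is the
    alternative that keeps the kernel bound available. A positive bound [t] on the modulus of [la]
    lets [la = 0] be included. *)
Lemma hardy_op_lorentz : exists2 A : R, 0 < A & forall (la : R[i]) (t : R) G,
  0 < t -> cabs la <= t ->
  measurable_fun setT G -> (forall x, 0 <= G x)%E ->
  (wnorm be q rho (hardy_op al la G) <= (A * t)%:E * wnorm be q rho G)%E.
Proof.
have [|||||A A0 HA] := @riesz_op_lorentz _ _ n0 be (N - al) (al - be) q q rho
  q0 q0 rho1 eta0 _ _ _ bqr.
- by rewrite addrCA subrr addr0 ltW.
- by rewrite (_ : _ + _ = N)//; ring.
- by right; rewrite addrCA subrr addr0.
- rewrite (_ : _ + (al - be) = N); last by ring.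
  by rewrite gtr_pMr// invf_lt1.
- rewrite (_ : _ + (al - be) = N); last by ring.
  by rewrite divff ?gt_eqF// addrK.
have [B B0 HB] := lnorm_scale_ae mu q0 rho1.
have k0 : 0 < riesz_constant n al by exact: riesz_constant_gt0.
have [C C0 HC] := wnorm_scale_ae n be q0 rho1.
exists (C * (2 * riesz_constant n al) * (A * B)); first by rewrite !mulr_gt0.
move=> la t G t0 lat mG G0.
have mnG : measurable_fun setT (fun y => (npow (- al) y)%:E * G y)%E.
  exact: measurable_npow_mul.
have nG0 y : (0 <= (npow (- al) y)%:E * G y)%E by exact: npow_mul_ge0.
have base : (wnorm be q rho (riesz_op (N - al) (fun y => (npow (- al) y)%:E * G y)%E) <=
    (A * B)%:E * wnorm be q rho G)%E.
  rewrite EFinM -muleA; apply: le_trans (HA _ mnG nG0) _.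
  apply: lee_wpmul2l; first by rewrite lee_fin ltW.
  rewrite -(mulr1 B); apply: HB => //.
  - exact: measurable_npow_mul.
  - exact: measurable_npow_mul.
  (* The weights |x|^(alpha - be) and |x|^-alpha combine to |x|^-be off the origin. *)
  - move: (ae_neq0 R n0); apply: filterS => x x0.
    by rewrite mul1e muleA -EFinM !npowE -powR_gt0D ?enorm_gt0// (_ : al - be - al = - be)//; ring.
have c0 : 0 < 2 * riesz_constant n al * t by rewrite !mulr_gt0.
apply: le_trans (HC _ _ (riesz_op (N - al) (fun y => (npow (- al) y)%:E * G y)%E) c0 _ _ _) _.
- exact: measurable_hardy_op.
- exact: measurable_riesz_op.
- apply/aeW => x; apply: lee_wpmul2r; first exact: riesz_op_ge0.
  by rewrite lee_fin ler_wpM2l// mulr_ge0// ltW.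
rewrite (_ : C * (2 * riesz_constant n al) * (A * B) * t =
  C * (2 * riesz_constant n al * t) * (A * B)); last by ring.
rewrite (EFinM _ (A * B)) -muleA; apply: lee_wpmul2l => //.
by rewrite lee_fin mulr_ge0 ?ltW.
Qed.

End weighted_bounds.

(** * Choice of the constants and conclusion *)

Unset Implicit Arguments.

Theorem corollary5p12 (R : realType) (d : nat)
    (alpha p q beta gamma : R) (rho : \bar R) :
  0 < alpha -> alpha < d%:R ->
  1 < p -> p <= q ->
  beta < d%:R / q ->
  gamma < d%:R / fine (hoelder_conjugate p%:E) ->
  0 <= beta + gamma ->
  q^-1 = p^-1 - (alpha - beta - gamma) / d%:R ->
  0 < alpha - beta - gamma ->
  (1%:E <= rho)%E ->
  exists2 lambda0 : R, 0 < lambda0 &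
  forall lambda : R[i], cabs lambda < lambda0 ->
  exists2 C : R, 0 < C &
  forall f : 'rV[R]_d -> R[i], in_lorentz p rho (weighted gamma f) ->
  exists u : 'rV[R]_d -> R[i],
    [/\ in_weighted_lorentz beta q rho u,
        mild_solution alpha (hardy_potential alpha lambda) f u,
        forall v : 'rV[R]_d -> R[i],
          in_weighted_lorentz beta q rho v ->
          mild_solution alpha (hardy_potential alpha lambda) f v ->
          {ae lebesgue_rV R d, forall x, v x = u x}
      & (lorentz_norm q rho (weighted (- beta) u) <=
         C%:E * lorentz_norm p rho (weighted gamma f))%E].
Proof.
move=> al0 ald p1 pq bq gap bega scal om0 rho1.
have d0 : (0 < d)%N by rewrite -(ltr0n R); exact: lt_trans ald.
have N0 : 0 < (d%:R : R) by rewrite ltr0n.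
have p0 : 0 < p by exact: lt_trans p1.
have q1 : 1 < q by exact: lt_le_trans pq.
have q0 : 0 < q by exact: lt_trans q1.
have gap' : gamma < d%:R - d%:R / p.
  move: gap; rewrite /hoelder_conjugate/= eqe (gt_eqF p0) -EFinD inver subr_eq0 (gt_eqF p1) /=.
  congr (_ < _); field.
  by rewrite subr_eq0 !gt_eqF.
have Nq : d%:R / q = d%:R / p - (alpha - beta - gamma).
  by rewrite scal mulrBr [_ * (_ / _)]mulrCA divff ?gt_eqF// mulr1.
have Np : d%:R / p < d%:R by rewrite gtr_pMr// invf_lt1.
(* Through the scaling relation this is the hypothesis gamma < d / p'; the next inequality is p >
   1. *)
have bq' : d%:R / q < beta + (d%:R - alpha) by rewrite Nq; clear -gap'; lra.
have omq : d%:R / q < beta + (d%:R - alpha) + gamma by rewrite Nq; clear -Np; lra.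
have [As As0 HAs] := source_op_lorentz d0 al0 ald q1 rho1 bq bq' p0 bega om0 omq scal.
have [Ah Ah0 HAh] := hardy_op_lorentz d0 al0 ald q1 rho1 bq bq'.
have [A1 A10 HA1] := wnorm_add d beta q0 rho1.
have [A2 A20 HA2] := wnorm_scale_ae d beta q0 rho1.
have normE (u : 'rV[R]_d -> R[i]) :
    lorentz_norm q rho (weighted (- beta) u) = wnorm beta q rho (cmod u).
  rewrite lorentz_normE (_ : cmod (weighted (- beta) u) =
    (fun y => (npow (- beta) y)%:E * cmod u y)%E)//.
  by apply/funext => y; exact: cmod_weighted.
have K0 : 0 < Ah * (A1 + A2 + 1) by rewrite mulr_gt0// !addr_gt0.
(* For |lambda| below this value the Hardy operator has bound th = 1 / (A1 + A2 + 1), small enough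
   for the uniform bound (A1 th <= 1) and for uniqueness (A2 th < 1). *)
exists (Ah * (A1 + A2 + 1))^-1; first by rewrite invr_gt0.
set t := _^-1; have t0 : 0 < t by rewrite invr_gt0.
have Aht : (A1 + A2 + 1) * (Ah * t) = 1.
  by rewrite mulrA (mulrC _ Ah) divff// gt_eqF.
have th0 : 0 < Ah * t by rewrite mulr_gt0.
have A1th : A1 * (Ah * t) <= 1.
  by rewrite -Aht ler_pM2r// -addrA lerDl addr_ge0// ltW.
have A2th : A2 * (Ah * t) < 1.
  by rewrite -Aht ltr_pM2r//; clear -A10; lra.
move=> lambda /ltW lat.
have Hh (G : 'rV[R]_d -> \bar R) : measurable_fun setT G -> (forall x, 0 <= G x)%E ->
    (wnorm beta q rho (hardy_op alpha lambda G) <= (Ah * t)%:E * wnorm beta q rho G)%E.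
  exact: HAh.
(* [As] bounds the source and A1 + A2 the majorant relative to it; 2 and A2 come from |u| <= 2 U.
   The constant depends on neither [f] nor [lambda]. *)
exists (A2 * 2 * (A1 + A2) * As); first by rewrite !mulr_gt0// addr_gt0.
move=> f [/cmeasurable_unweight mf ffin].
have sfin : (wnorm beta q rho (source_op alpha f) < +oo)%E.
  apply: le_lt_trans (HAs _ mf) _.
  by apply: lte_mul_pinfty; [rewrite lee_fin ltW|by []|exact: ffin].
have Ufin := majorant_lim_fin_ae d0 q0 rho1 A10 A20 (ltW th0) HA2 HA1 Hh mf A1th sfin.
have ms := cmeasurable_solution mf Ufin.
have ns := wnorm_solution q0 rho1 A10 A20 (ltW th0) HA2 HA1 Hh mf A1th Ufin.
have nsfin : (wnorm beta q rho (cmod (solution alpha lambda f)) < +oo)%E.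
  apply: le_lt_trans ns _; apply: lte_mul_pinfty; [|by []|exact: sfin].
  by rewrite lee_fin !mulr_ge0// ?addr_ge0// ltW.
have sol : mild_solution alpha (hardy_potential alpha lambda) f (solution alpha lambda f).
  apply: filterS (Ufin) => x Ux; split.
    exact: (solution_integrable mf Ufin Ux).
  exact: (solution_fixpoint mf Ufin Ux).
exists (solution alpha lambda f); split.
- split; first exact: cmeasurable_weighted.
  by rewrite normE.
- exact: sol.
- move=> v [/cmeasurable_unweight mv]; rewrite normE => vfin solv.
  exact: (mild_solution_uniq d0 q0 rho1 A10 A20 HA2 HA1 Hh A2th ms mv nsfin vfin sol solv).
- rewrite normE; apply: le_trans ns _; rewrite (EFinM _ As) -muleA.
  apply: lee_wpmul2l; last exact: HAs.
  by rewrite lee_fin !mulr_ge0// ?addr_ge0// ltW.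
Qed.
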